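(* Let $E$ be a countable set, $(G,\mathcal{G})$ a measurable space, $f:E\times G\to E$ a measurable map and $\beta$ a probability measure on $(G,\mathcal{G})$. Let $\Pi$ and $\Pi_2$ be the associated transition kernels on $E$ and $E^2$, and let $D$ be the diagonal of $E^2$ (see context). If the kernel $\Pi$ is irreducible and positive recurrent, then the following conditions are equivalent: (1) The points of $E$ are pairwise accordable. (2) For every stationary chain $(X_n)_{n\in\mathbf{Z}}$ governed by $f$ and by a sequence $(V_n)_{n\in\mathbf{Z}}$ of independent random variables with law $\beta$, one has $\mathcal{F}^X_n\subset\mathcal{F}^V_n$ for every $n\in\mathbf{Z}$. (3) Every stationary Markov chain with kernel $\Pi_2$ lives on the diagonal $D$ (i.e. if $(X_n,Y_n)_{n\in\mathbf{Z}}$ is a stationary Markov chain on $E^2$ with kernel $\Pi_2$, then almost surely $X_n=Y_n$ for all $n$).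
   Context: $E$ carries its discrete $\sigma$-algebra. For $v\in G$ let $f_v:E\to E$, $f_v(x)=f(x,v)$. Let $(V_n)_{n\in\mathbf{Z}}$ be independent random variables with law $\beta$. For $x\in E$, $\Pi(x,\cdot)$ is the law of $f(x,V_1)$; for $(x,y)\in E^2$, $\Pi_2((x,y),\cdot)$ is the law of $(f(x,V_1),f(y,V_1))$. $D=\{(x,x):x\in E\}$. Two states $x,y\in E$ are accordable if $D$ is accessible from $(x,y)$ for chains with kernel $\Pi_2$, i.e. if there is $l\in\mathbf{N}^*=\{1,2,\dots\}$ such that $P[f_{V_l}\circ\cdots\circ f_{V_1}(x)=f_{V_l}\circ\cdots\circ f_{V_1}(y)]>0$. A chain $(X_n)_{n\in\mathbf{Z}}$ is governed by $f$ and by the innovations $(V_n)_{n\in\mathbf{Z}}$ if, for every $n\in\mathbf{Z}$, $X_{n+1}=f(X_n,V_{n+1})$ and $V_{n+1}$ is independent of $((X_k,V_k))_{k\le n}$. For a sequence of random variables $(Y_n)_{n\in\mathbf{Z}}$, $\mathcal{F}^Y_n$ is the completion of $\sigma(Y_k:k\le n)$. *)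

(* Defs.v *)
From HB Require Import structures.
From mathcomp Require Import all_boot all_order all_algebra.
From mathcomp Require Import finmap.
From mathcomp Require Import all_classical all_reals all_analysis.
From mathcomp Require Import measurable_realfun lebesgue_measure.

Set Implicit Arguments.
Unset Strict Implicit.
Unset Printing Implicit Defensive.

Import Order.TTheory GRing.Theory Num.Theory.

Local Open Scope classical_set_scope.
Local Open Scope ring_scope.
Local Open Scope ereal_scope.

Section random_map_kernel.
Context (dS dG : measure_display) (S : measurableType dS)
  (G : measurableType dG) (R : realType) (beta : probability G R).
Variable g : {mfun (S * G)%type >-> S}.

Definition map_section (x : S) (v : G) : S := g (x, v).

Let measurable_map_section x : measurable_fun [set: G] (map_section x).
Proof. exact: measurableT_comp. Qed.

HB.instance Definition _ x :=
  isMeasurableFun.Build _ _ _ _ (map_section x) (measurable_map_section x).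

(* The law of g (x, V) when V has law beta. *)
Definition random_map_kernel (x : S) : {measure set S -> \bar R} :=
  distribution beta (map_section x).

Let measurable_random_map_kernel A : measurable A ->
  measurable_fun [set: S] (random_map_kernel ^~ A).
Proof.
move=> mA.
have mgA : measurable (g @^-1` A).
  by rewrite -[X in measurable X]setTI; exact: measurable_funP.
apply: eq_measurable_fun (measurable_fun_xsection beta mgA) => x _ /=.
rewrite /random_map_kernel /distribution /pushforward /=; congr (beta _).
by apply/seteqP; split => v /=; rewrite /xsection/= inE.
Qed.

HB.instance Definition _ := isKernel.Build _ _ _ _ _ random_map_kernel
  measurable_random_map_kernel.

Let random_map_kernelT x : random_map_kernel x [set: S] = 1.
Proof. exact: probability_setT. Qed.

HB.instance Definition _ := Kernel_isProbability.Build _ _ _ _ _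
  random_map_kernel random_map_kernelT.

End random_map_kernel.

Section two_point_motion.
Context (dE dG : measure_display) (E : measurableType dE)
  (G : measurableType dG) (f : {mfun (E * G)%type >-> E}).

Definition two_point_map (u : ((E * E) * G)%type) : (E * E)%type :=
  (f (u.1.1, u.2), f (u.1.2, u.2)).

Let measurable_two_point_map : measurable_fun setT two_point_map.
Proof.
apply: measurable_fun_pair; apply: measurableT_comp => //;
  apply: measurable_fun_pair => //; exact: measurableT_comp.
Qed.

HB.instance Definition _ :=
  isMeasurableFun.Build _ _ _ _ two_point_map measurable_two_point_map.

End two_point_motion.

Definition Pi_kernel (dE dG : measure_display) (E : measurableType dE)
    (G : measurableType dG) (R : realType) (beta : probability G R)
    (f : {mfun (E * G)%type >-> E}) : R.-pker E ~> E :=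
  random_map_kernel beta f.

Definition Pi2_kernel (dE dG : measure_display) (E : measurableType dE)
    (G : measurableType dG) (R : realType) (beta : probability G R)
    (f : {mfun (E * G)%type >-> E}) : R.-pker (E * E)%type ~> (E * E)%type :=
  random_map_kernel beta (two_point_map f).

Section kernels.
Context (d : measure_display) (S : measurableType d) (R : realType).
Variable K : R.-pker S ~> S.

Fixpoint kernel_iter (n : nat) (x : S) (A : set S) : \bar R :=
  if n is m.+1 then \int[K x]_y kernel_iter m y A else \d_x A.

Definition irreducible : Prop :=
  forall x y : S, exists2 n : nat, (0 < n)%N & 0 < kernel_iter n x [set y].

(* P_x [T_A = n.+1], where T_A = inf {k >= 1 : X_k \in A} for the chain with
   kernel K. *)
Fixpoint first_passage (n : nat) (x : S) (A : set S) : \bar R :=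
  if n is m.+1 then \int[K x]_(y in ~` A) first_passage m y A else K x A.

Definition recurrent_state (x : S) : Prop :=
  \sum_(0 <= n <oo) first_passage n x [set x] = 1.

Definition mean_return_time (x : S) : \bar R :=
  \sum_(0 <= n <oo) (n.+1)%:R%:E * first_passage n x [set x].

Definition positive_recurrent : Prop :=
  forall x, recurrent_state x /\ mean_return_time x < +oo.

End kernels.

Section processes.
Context (d : measure_display) (Omega : measurableType d) (R : realType).
Variable P : probability Omega R.

(* sigma (Z_k : k <= n) *)
Definition past dS (S : measurableType dS) (Z : int -> Omega -> S) (n : int) :
    set (set Omega) :=
  <<s \bigcup_(k in [set k : int | (k <= n)%R])
        preimage_set_system setT (Z k) measurable >>.

Definition completed_past dS (S : measurableType dS) (Z : int -> Omega -> S)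
    (n : int) : set (set Omega) :=
  <<s past Z n `|` [set A | P.-negligible A] >>.

Definition stationary dS (S : measurableType dS) (Z : int -> {RV P >-> S}) :
    Prop :=
  forall (h : int) (I : {fset int}) (A : int -> set S),
    (forall k, measurable (A k)) ->
    P (\bigcap_(k in [set` I]) (Z (k + h)%R @^-1` A k)) =
    P (\bigcap_(k in [set` I]) (Z k @^-1` A k)).

(* P [Z_{n+1} \in A | sigma (Z_k : k <= n)] = K (Z_n, A) almost surely, with
   the conditional probability replaced by its defining property. *)
Definition markov_chain dS (S : measurableType dS) (K : R.-pker S ~> S)
    (Z : int -> {RV P >-> S}) : Prop :=
  forall (n : int) (A : set S) (B : set Omega),
    measurable A -> past Z n B ->
    P (Z (n + 1)%R @^-1` A `&` B) = \int[P]_(w in B) K (Z n w) A.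

Definition mutually_independent dS (S : measurableType dS)
    (V : int -> {RV P >-> S}) : Prop :=
  forall (I : {fset int}) (A : int -> set S),
    (forall k, measurable (A k)) ->
    P (\bigcap_(k in [set` I]) (V k @^-1` A k)) =
    \prod_(k <- I) P (V k @^-1` A k).

Definition iid dG (G : measurableType dG) (beta : probability G R)
    (V : int -> {RV P >-> G}) : Prop :=
  mutually_independent V /\
  forall n A, measurable A -> distribution P (V n) A = beta A.

Definition governed dE dG (E : measurableType dE) (G : measurableType dG)
    (f : (E * G)%type -> E) (V : int -> {RV P >-> G}) (X : int -> {RV P >-> E}) :
    Prop :=
  (forall n w, X (n + 1)%R w = f (X n w, V (n + 1)%R w)) /\
  (forall n A B, measurable A -> past (fun k w => (X k w, V k w)) n B ->
    P (V (n + 1)%R @^-1` A `&` B) = P (V (n + 1)%R @^-1` A) * P B).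

End processes.

(* f_{v_l} o ... o f_{v_1} *)
Fixpoint composed_maps (E G : Type) (f : (E * G)%type -> E) (v : int -> G) (l : nat)
    (x : E) : E :=
  if l is m.+1 then f (composed_maps f v m x, v (Posz m.+1)) else x.

Section conditions.
Context (dE dG : measure_display) (E : measurableType dE)
  (G : measurableType dG) (R : realType) (beta : probability G R)
  (f : {mfun (E * G)%type >-> E}).

(* The probability depends only on beta, not on the realization of the
   independent sequence V on which it is computed. *)
Definition accordable (x y : E) : Prop :=
  exists (d : measure_display) (Omega : measurableType d)
    (P : probability Omega R) (V : int -> {RV P >-> G}) (l : nat),
  [/\ iid beta V, (0 < l)%N &
    0 < P [set w | composed_maps f (V ^~ w) l x =
                   composed_maps f (V ^~ w) l y]].

Definition pairwise_accordable : Prop := forall x y : E, accordable x y.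

Definition stationary_chains_adapted_to_innovations : Prop :=
  forall (d : measure_display) (Omega : measurableType d)
    (P : probability Omega R) (V : int -> {RV P >-> G})
    (X : int -> {RV P >-> E}),
  iid beta V -> governed f V X -> stationary X ->
  forall n : int, completed_past P X n `<=` completed_past P V n.

Definition stationary_Pi2_chains_diagonal : Prop :=
  forall (d : measure_display) (Omega : measurableType d)
    (P : probability Omega R) (Z : int -> {RV P >-> (E * E)%type}),
  markov_chain (Pi2_kernel beta f) Z -> stationary Z ->
  {ae P, forall w, forall n : int, (Z n w).1 = (Z n w).2}.

End conditions.

(* Main.v *)
Require Import Defs.
From HB Require Import structures.
From mathcomp Require Import all_boot all_order all_algebra.
From mathcomp Require Import finmap.
From mathcomp Require Import all_classical all_reals all_analysis.
From mathcomp Require Import measurable_realfun.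
From mathcomp Require Import zify ring lra.

Set Implicit Arguments.
Unset Strict Implicit.
Unset Printing Implicit Defensive.

Import Order.TTheory GRing.Theory Num.Theory.
Import numFieldNormedType.Exports.

Local Open Scope classical_set_scope.
Local Open Scope ring_scope.
Local Open Scope ereal_scope.

(** The pivot of the proof is accordability expressed with the kernel Pi_2 alone:
    x and y are accordable if and only if some iterate of Pi_2, of order at least 1,
    charges the diagonal D from (x, y), because two copies of the chain driven by the
    same innovations form a chain with kernel Pi_2 (accordableP). The diagonal is
    absorbing for Pi_2.

    Suppose that all pairs are accordable. The mass that a stationary chain with
    kernel Pi_2 gives to D does not depend on time; since D is absorbing and
    accessible from everywhere, the law is carried by D (invariant_absorbed), which
    is condition 3. For condition 2, couple a stationary governed chain X with the
    path started at a remote time from a fixed state and driven by the same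
    innovations. The pair is a chain with kernel Pi_2 whose laws are tight: one
    marginal is constant, and positive recurrence makes the other one tight
    (positive_recurrent_tight). Hence the pair is absorbed in D with probability
    tending to 1 (absorbed_in_the_limit), and X_n is almost surely a limit of
    functions of the past of the innovations (coupled_from_the_past).

    Suppose conversely that x and y are not accordable. The chain with kernel Pi_2
    started at (x, y) never visits D and is tight, so the averages of its laws
    have a limit which is an invariant probability nu with nu D = 0. It may be taken
    symmetric (off_diagonal_invariant). Let (X, Y) be a two-sided stationary chain of
    law nu governed by independent innovations V. It is a stationary chain with kernel
    Pi_2 off the diagonal, against condition 3 (Pi2_diagonal_accordable). Moreover X and
    Y are governed by the same V and have the same one-dimensional laws, so X_0 and Y_0
    have the same joint law with the past of V (governed_same_law). Were X_0
    almost surely a function of this past, as in condition 2, Y_0 would be the same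
    function of it, against nu D = 0 (adapted_accordable).

    The innovations live in an arbitrary measurable space, where Kolmogorov's
    extension theorem may fail. The two-sided chain is obtained from the
    theorem of Ionescu-Tulcea applied to an evolution that starts at time -1 and
    reveals the past step by step, drawing the previous state and the innovation
    from their conditional law given the current state; the state space is countable,
    so these conditional laws are elementary (reversal, stationary_process_exists).
    In the same step it draws a fresh innovation for the future. *)

(** * Probability laws on sequences *)

Section trajectories.
Context d (W : measurableType d).

Definition coord_events : set (set (nat -> W)) :=
  \bigcup_n preimage_set_system setT (fun w : nat -> W => w n) measurable.

(** The space of sequences of points of W, with its product sigma-algebra. *)
Definition traj := g_sigma_algebraType coord_events.

HB.instance Definition _ := Measurable.on traj.

Lemma measurable_coord n : measurable_fun [set: traj] (fun w : traj => w n).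
Proof.
move=> _ A mA; apply: sub_sigma_algebra; exists n => //.
by exists A.
Qed.

Lemma measurable_to_traj d' (T : measurableType d') (h : T -> traj) :
  (forall n, measurable_fun [set: T] (fun x => h x n)) ->
  measurable_fun [set: T] h.
Proof.
move=> mh; apply: (@measurability _ _ T traj setT h coord_events) => //.
move=> _ [A [n _ [B mB <-]] <-].
by rewrite setTI; apply: mh.
Qed.

(** The sequence that follows w up to time k and is equal to u from time k + 1 on. *)
Definition upd (w : traj) (k : nat) (u : W) : traj :=
  fun i => if (i <= k)%N then w i else u.

Lemma measurable_upd k :
  measurable_fun [set: traj * W] (fun x : traj * W => upd x.1 k x.2).
Proof.
apply: measurable_to_traj => n; rewrite /upd.
case: (leqP n k) => _ /=; last exact: measurable_snd.
exact: (measurableT_comp (measurable_coord n) measurable_fst).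
Qed.

Lemma measurable_upd2 k w : measurable_fun [set: W] (upd w k).
Proof.
apply: measurable_to_traj => n; rewrite /upd.
by case: (leqP n k) => _ /=.
Qed.

(** h depends only on the coordinates of index at most N. For an event A, seen
    as a function to Prop, this says that A depends on these coordinates. *)
Definition determined (N : nat) (X : Type) (h : traj -> X) :=
  forall w w' : traj, (forall i, (i <= N)%N -> w i = w' i) -> h w = h w'.

Lemma determinedW N M X (h : traj -> X) : (N <= M)%N ->
  determined N h -> determined M h.
Proof. by move=> NM dh w w' ww'; apply: dh => i iN; apply/ww'/(leq_trans iN). Qed.

Definition cylinder (A : set traj) :=
  measurable A /\ exists N, determined N A.

(** The sequences again, this time with the algebra of measurable sets that
    depend on finitely many coordinates. *)
Definition cyl := nat -> W.
HB.instance Definition _ := Pointed.on cyl.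

Let cylinder0 : cylinder set0.
Proof. by split => //; exists 0%N. Qed.

Let cylinderU : setU_closed cylinder.
Proof.
move=> A B [mA [N NA]] [mB [M MB]]; split; first exact: measurableU.
exists (maxn N M) => w w' ww'; rewrite /setU/=.
rewrite (NA w w') 1?(MB w w')// => i iN; apply: ww'.
- by rewrite (leq_trans iN)// leq_maxr.
- by rewrite (leq_trans iN)// leq_maxl.
Qed.

Let cylinderC : setC_closed cylinder.
Proof.
move=> A [mA [N NA]]; split; first exact: measurableC.
by exists N => w w' ww'; rewrite /setC/= (NA w w').
Qed.

Fact cyl_display : measure_display. Proof. by []. Qed.

HB.instance Definition _ := @isAlgebraOfSets.Build cyl_display
  cyl cylinder cylinder0 cylinderU cylinderC.

End trajectories.

Section ionescu_tulcea.
Context d (W : measurableType d) (R : realType).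
Variable K : nat -> R.-pker (traj W) ~> W.

(** K k w is the law of the coordinate of index k + 1 when the previous ones are
    those of w, and tstep k g w is the expectation of g once this
    coordinate has been drawn. *)
Definition tstep k (g : traj W -> \bar R) : traj W -> \bar R :=
  fun w => \int[K k w]_u g (upd w k u).

(** Expectation of g after l draws, those of the coordinates k + 1, ..., k + l. *)
Fixpoint titer l k (g : traj W -> \bar R) : traj W -> \bar R :=
  if l is l'.+1 then tstep k (titer l' k.+1 g) else g.

Let upd_comp k (g : traj W -> \bar R) w : measurable_fun setT g ->
  measurable_fun setT (fun u => g (upd w k u)).
Proof. by move=> mg; apply: measurableT_comp => //; exact: measurable_upd2. Qed.

Lemma tstep_ge0 k g : (forall w, 0 <= g w) -> forall w, 0 <= tstep k g w.
Proof. by move=> g0 w; apply: integral_ge0. Qed.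

Lemma measurable_tstep k g : (forall w, 0 <= g w) -> measurable_fun setT g ->
  measurable_fun setT (tstep k g).
Proof.
move=> g0 mg; rewrite /tstep.
apply: (@measurable_fun_integral_finite_kernel _ _ _ _ R
  (fun x => g (upd x.1 k x.2)) (K k)) => //.
by apply: measurableT_comp => //; exact: measurable_upd.
Qed.

Lemma titer_ge0 l k g : (forall w, 0 <= g w) -> forall w, 0 <= titer l k g w.
Proof. by move=> g0; elim: l k => //= l ih k w; apply: tstep_ge0. Qed.

Lemma measurable_titer l k g : (forall w, 0 <= g w) -> measurable_fun setT g ->
  measurable_fun setT (titer l k g).
Proof.
move=> g0 mg; elim: l k => //= l ih k; apply: measurable_tstep => //.
exact: titer_ge0.
Qed.

Lemma tstepD k g h w : (forall w, 0 <= g w) -> (forall w, 0 <= h w) ->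
  measurable_fun setT g -> measurable_fun setT h ->
  tstep k (g \+ h) w = tstep k g w + tstep k h w.
Proof.
move=> g0 h0 mg mh; rewrite /tstep /= ge0_integralD//; exact: upd_comp.
Qed.

Lemma titerD l k g h : (forall w, 0 <= g w) -> (forall w, 0 <= h w) ->
  measurable_fun setT g -> measurable_fun setT h ->
  titer l k (g \+ h) = titer l k g \+ titer l k h.
Proof.
move=> g0 h0 mg mh; elim: l k => //= l ih k; apply/funext => w.
rewrite ih tstepD//; [exact: titer_ge0|exact: titer_ge0|
  exact: measurable_titer|exact: measurable_titer].
Qed.

Lemma le_titer l k g h : (forall w, 0 <= g w) -> (forall w, g w <= h w) ->
  measurable_fun setT g -> measurable_fun setT h ->
  forall w, titer l k g w <= titer l k h w.
Proof.
move=> g0 gh mg mh; have h0 w : 0 <= h w by exact: le_trans (gh w).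
elim: l k => //= l ih k w; apply: ge0_le_integral => //.
- by move=> u _; exact: titer_ge0.
- by apply: upd_comp; exact: measurable_titer.
- by apply: upd_comp; exact: measurable_titer.
Qed.

Lemma titer_cst l k c w : titer l k (cst c) w = c.
Proof.
elim: l k w => //= l ih k w; rewrite /tstep; under eq_integral do rewrite ih.
by rewrite integral_cst// prob_kernel mule1.
Qed.

Lemma titer_determined N l k g : (N <= k)%N -> determined N g ->
  titer l k g = g.
Proof.
move=> Nk dg; elim: l k Nk => //= l ih k Nk; apply/funext => w.
rewrite /tstep ih; last exact: leq_trans Nk _.
under eq_integral => u _.
  rewrite (dg (upd w k u) w); last first.
    by move=> i iN; rewrite /upd (leq_trans iN Nk).
  over.
by rewrite integral_cst// prob_kernel mule1.
Qed.

(** Drawing more coordinates than those which g depends on changes nothing. *)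
Lemma titer_stable N l l' k g : determined N g ->
  (N <= k + l)%N -> (N <= k + l')%N -> titer l k g = titer l' k g.
Proof.
move=> dg; elim: l l' k => [|l ih] l' k.
  by rewrite addn0 => Nk _; rewrite !(titer_determined _ Nk).
case: l' => [|l'].
  by rewrite addn0 => _ Nk; rewrite !(titer_determined _ Nk).
rewrite -!addSnnS => Nl Nl' /=; congr (tstep _ _); exact: ih.
Qed.

Lemma titerSr l k g : titer l.+1 k g = titer l k (tstep (k + l) g).
Proof.
elim: l k => [|l ih] k; first by rewrite addn0.
by rewrite [LHS]/= -/(titer l.+1 k.+1 g) ih/= addSnnS.
Qed.

Definition ind (A : set (traj W)) : traj W -> \bar R := fun w => (\1_A w)%:E.

Lemma ind_ge0 A w : 0 <= ind A w.
Proof. by rewrite lee_fin. Qed.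

Lemma le_ind A B w : A `<=` B -> ind A w <= ind B w.
Proof.
move=> AB; rewrite lee_fin !indicE.
by have [/set_mem/AB/mem_set ->|_] := boolP (w \in A).
Qed.

Lemma measurable_ind A : measurable A -> measurable_fun setT (ind A).
Proof. by move=> mA; exact/measurable_EFinP. Qed.

Lemma determined_ind N (A : set (traj W)) : determined N A -> determined N (ind A).
Proof.
move=> dA w w' ww'; rewrite /ind !indicE; congr (_%:R%:E).
by rewrite /in_mem/= /in_set/= (dA w w').
Qed.

Hint Resolve ind_ge0 : core.

Variable w0 : traj W.

(** An index up to which the coordinates determine A, when there is one. *)
Definition depth (A : set (traj W)) : nat :=
  if pselect (exists N, determined N A) is left h then projT1 (cid h) else 0%N.

Lemma depthP A : (exists N, determined N A) -> determined (depth A) A.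
Proof. by move=> h; rewrite /depth; case: pselect => // h'; case: cid. Qed.

(** The probability of a cylinder when the coordinate 0 is that of w0. *)
Definition cyl_prob (A : set (cyl W)) : \bar R := titer (depth A) 0 (ind A) w0.

Lemma cyl_probE N A : determined N A -> cyl_prob A = titer N 0 (ind A) w0.
Proof.
move=> dA; rewrite /cyl_prob; congr (_ w0).
have dd : determined (depth A) A by apply: depthP; exists N.
rewrite (@titer_stable (depth A) _ (maxn N (depth A)))//; last 2 first.
- exact: determined_ind.
- by rewrite add0n leq_maxr.
apply: (@titer_stable N) => //; first exact: determined_ind.
by rewrite add0n leq_maxl.
Qed.

Let cyl_prob_ge0 A : 0 <= cyl_prob A. Proof. exact: titer_ge0. Qed.

Lemma cyl_prob0 : cyl_prob set0 = 0.
Proof.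
rewrite (@cyl_probE 0)//= /ind indicE; by rewrite in_set0.
Qed.

Lemma cyl_probT : cyl_prob setT = 1.
Proof. by rewrite (@cyl_probE 0)//= /ind indicE in_setT. Qed.

Lemma cyl_prob_additive : additive2 (cyl_prob : set (cyl W) -> \bar R).
Proof.
move=> A B [mA [N NA]] [mB [M MB]] AB.
pose L := maxn N M.
have LA : determined L A by apply: determinedW NA; rewrite leq_maxl.
have LB : determined L B by apply: determinedW MB; rewrite leq_maxr.
have LAB : determined L (A `|` B).
  by move=> w w' ww'; rewrite /setU/= (LA w w')// (LB w w').
rewrite !(@cyl_probE L)//.
have -> : ind (A `|` B) = ind A \+ ind B.
  apply/funext => w; rewrite /ind/= -EFinD !indicE in_setU; congr EFin.
  have [wA|_] := boolP (w \in A); last by rewrite add0r.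
  rewrite memNset ?addr0//= => wB; rewrite -[False]/(set0 w) -AB.
  by split => //; apply: set_mem.
by rewrite titerD//; exact: measurable_ind.
Qed.

Let cyl_prob_semi_additive : measure_function.semi_additive (cyl_prob : set (cyl W) -> \bar R).
Proof. by apply/additive2P; [exact: cyl_prob0|exact: cyl_prob_additive]. Qed.

HB.instance Definition _ := @isContent.Build _ (cyl W) R cyl_prob
  cyl_prob_ge0 cyl_prob_semi_additive.

Section continuity.
Variable B : nat -> set (cyl W).
Hypothesis mB : forall n, measurable (B n).
Hypothesis dB : forall n m, (n <= m)%N -> B m `<=` B n.

Let N n : nat := depth (B n).

Let NB n : determined (N n) (B n).
Proof. by apply: depthP; have [] := mB n. Qed.

Let mBt n : measurable (B n : set (traj W)).
Proof. by have [] := mB n. Qed.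

(* conditional probability of B n given the coordinates of w up to time k *)
Let q k n w := titer (N n) k (ind (B n)) w.

Let q_ge0 k n w : 0 <= q k n w. Proof. exact: titer_ge0. Qed.

Let mq k n : measurable_fun setT (q k n).
Proof. by apply: measurable_titer => //; exact: measurable_ind. Qed.

Let q_le1 k n w : q k n w <= 1.
Proof.
rewrite -(titer_cst (N n) k 1 w); apply: le_titer => //.
- by move=> w'; rewrite lee_fin indicE lern1 leq_b1.
- exact: measurable_ind.
Qed.

Let q_step k n w : q k n w = tstep k (q k.+1 n) w.
Proof.
rewrite /q -[RHS]/(titer (N n).+1 k (ind (B n)) w); congr (_ w).
apply: (@titer_stable (N n)); first exact: determined_ind.
- by rewrite leq_addl.
- by rewrite addnS ltnW// ltnS leq_addl.
Qed.

Let q_noninc k w : nonincreasing_seq (fun n => q k n w).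
Proof.
move=> n m nm; rewrite /q.
rewrite (@titer_stable (N m) (N m) (maxn (N n) (N m)))//; last 3 first.
- exact: determined_ind.
- by rewrite leq_addl.
- by rewrite (leq_trans (leq_maxr (N n) _))// leq_addl.
rewrite (@titer_stable (N n) (N n) (maxn (N n) (N m)))//; last 3 first.
- exact: determined_ind.
- by rewrite leq_addl.
- by rewrite (leq_trans (leq_maxl _ (N m)))// leq_addl.
apply: le_titer => //; [|exact: measurable_ind|exact: measurable_ind].
by move=> w'; apply/le_ind/dB.
Qed.

Let Q k w := limn (fun n => q k n w).

Let q_cvg k w : (fun n => q k n w) @ \oo --> Q k w.
Proof. by apply: ereal_nonincreasing_is_cvgn; exact: q_noninc. Qed.

Let Q_ge0 k w : 0 <= Q k w.
Proof. by apply: lime_ge; [exact: q_cvg|exact: nearW]. Qed.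

Let Q_leq k n w : Q k w <= q k n w.
Proof.
apply: lime_le; first exact: q_cvg.
by exists n => // m /= nm; exact: q_noninc.
Qed.

Let Q_step k w : Q k w = \int[K k w]_u Q k.+1 (upd w k u).
Proof.
rewrite /Q; under eq_fun do rewrite q_step.
apply/cvg_lim => //; rewrite /tstep.
have mq' n : measurable_fun setT (fun u => q k.+1 n (upd w k u)) by exact: upd_comp.
have := @dominated_convergence _ _ R (K k w) setT measurableT
  (fun n u => q k.+1 n (upd w k u)) (fun u => Q k.+1 (upd w k u)) (EFin \o cst 1%R) mq'.
case.
- by apply: emeasurable_fun_cvg mq' _ => u _; exact: q_cvg.
- by apply: aeW => u _; exact: q_cvg.
- apply/integrableP; split; first exact/measurable_EFinP.
  by under eq_integral do rewrite /= normr1; rewrite integral_cst// mul1e prob_kernel ltry.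
- by apply: aeW => u n _; rewrite gee0_abs// q_le1.
by [].
Qed.

Let Q_choice k w : 0 < Q k w -> exists u, 0 < Q k.+1 (upd w k u).
Proof.
move=> Q0; apply: contrapT => /forallNP nQ; move: Q0.
rewrite Q_step integral0_eq ?ltxx// => u _.
by apply/eqP; rewrite eq_le Q_ge0 andbT leNgt; apply/negP/nQ.
Qed.

(** A sequence in the intersection is built one coordinate after the other: if
    the limit Q k w of the conditional probabilities of the B n given the
    coordinates up to k is positive, then so is Q k.+1 for some choice of the
    next coordinate. *)
Lemma cyl_prob_bigcap_neq0 : (exists2 e : R, (0 < e)%R & forall n, e%:E <= cyl_prob (B n)) ->
  \bigcap_n B n !=set0.
Proof.
move=> [e e0 eB].
have Q0 : 0 < Q 0 w0.
  apply: (@lt_le_trans _ _ e%:E); first by rewrite lte_fin.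
  apply: lime_ge; first exact: q_cvg.
  by apply: nearW => n; exact: eB.
pose next k (x : {w | 0 < Q k w}) : {w | 0 < Q k.+1 w} :=
  let h := cid (Q_choice (projT2 x)) in exist _ (upd (projT1 x) k (projT1 h)) (projT2 h).
pose s := fix s k : {w | 0 < Q k w} :=
  if k is k'.+1 then next k' (s k') else exist _ w0 Q0.
pose w k : traj W := projT1 (s k).
have wS k i : (i <= k)%N -> w k.+1 i = w k i by move=> ik; rewrite /w/= /upd ik.
have wE k i : (i <= k)%N -> w k i = w i i.
  elim: k => [|k ih]; first by rewrite leqn0 => /eqP ->.
  by rewrite leq_eqVlt => /predU1P[->//|]; rewrite ltnS => ik; rewrite wS// ih.
(* the diagonal sequence agrees with w k up to time k, hence lies in each B n *)
exists (fun i => w i i) => n _ /=.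
have : 0 < q (N n) n (w (N n)).
  by apply: lt_le_trans (Q_leq _ _ _); exact: (projT2 (s (N n))).
rewrite /q (@titer_determined (N n))//; last exact: determined_ind.
rewrite /ind indicE; case: (boolP (w (N n) \in B n)); last by rewrite ltxx.
move=> /set_mem wB _.
by rewrite (NB (w' := w (N n)))// => i iN; rewrite wE.
Qed.

End continuity.

Lemma cyl_prob_cvg0 (B : nat -> set (cyl W)) :
  (forall n, measurable (B n)) -> (forall n m, (n <= m)%N -> B m `<=` B n) ->
  \bigcap_n B n = set0 -> (fun n => cyl_prob (B n)) @ \oo --> 0.
Proof.
move=> mB dB B0.
have noninc : nonincreasing_seq (fun n => cyl_prob (B n)).
  move=> n m nm; apply: (le_measure cyl_prob); rewrite ?inE//; exact: dB.
have /= cv := ereal_nonincreasing_cvgn noninc.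
set l := ereal_inf _ in cv.
have l0 : 0 <= l by apply/ereal_infP => _ [n _ <-].
have [l_gt0|] := ltP 0 l; last first.
  by move=> l_le0; rewrite (_ : 0 = l)//; apply/eqP; rewrite eq_le l0 l_le0.
have [e e0 el] : exists2 e : R, (0 < e)%R & e%:E <= l.
  have l1 : l <= 1.
    apply: (@le_trans _ _ (cyl_prob (B 0%N))); last first.
      by rewrite -cyl_probT; apply: (le_measure cyl_prob); rewrite ?inE//; exact: measurableT.
    by apply: ereal_inf_lbound; exists 0%N.
  have lfin : l \is a fin_num by rewrite ge0_fin_numE// (le_lt_trans l1)// ltry.
  by exists (fine l); rewrite ?fineK// fine_gt0// l_gt0 (le_lt_trans l1) ?ltry.
have [|w] := cyl_prob_bigcap_neq0 mB dB; last by rewrite B0.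
exists e => // n; apply: (le_trans el).
by apply: ereal_inf_lbound; exists n.
Qed.

Let cyl_prob_semi_sigma_additive :
  measure_function.semi_sigma_additive (cyl_prob : set (cyl W) -> \bar R).
Proof.
move=> F mF tF mUF.
pose S n := \big[setU/set0]_(i < n) F i.
have mS n : measurable (S n) by apply: bigsetU_measurable.
pose B n := (\bigcup_n F n) `\` S n.
have mB n : measurable (B n) by apply: measurableD.
have SU n : S n `<=` \bigcup_n F n.
  by rewrite /S -bigcup_mkord => w [i _ Fi]; exists i.
have fin A : measurable A -> cyl_prob A \is a fin_num.
  move=> mA; rewrite ge0_fin_numE ?cyl_prob_ge0//.
  apply: (@le_lt_trans _ _ 1); last by rewrite ltry.
  by rewrite -cyl_probT; apply: (le_measure cyl_prob); rewrite ?inE//; exact: measurableT.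
have sumE n : \sum_(0 <= i < n) cyl_prob (F i) = cyl_prob (\bigcup_n F n) - cyl_prob (B n).
  have -> : cyl_prob (\bigcup_n F n) = cyl_prob (S n) + cyl_prob (B n).
    rewrite -measureU//; first by rewrite /B setDUK//; exact: SU.
    by rewrite /B setDE setICA setICr setI0.
  rewrite addeK ?fin//; rewrite big_mkord /S measure_bigsetU//.
rewrite (_ : (fun n => _) = (fun n => cyl_prob (\bigcup_n F n) - cyl_prob (B n))); last first.
  by apply/funext => n; exact: sumE.
rewrite -[X in _ --> X]sube0; apply: cvgeB => //; [|exact: cvg_cst|].
- by rewrite fin_num_adde_defr// fin.
apply: cyl_prob_cvg0 => //.
- by move=> n m nm; apply: setDS; rewrite /S; exact: subset_bigsetU.
- apply/seteqP; split => // w Bw.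
  have [[n _ Fn] _] := Bw 0%N I.
  have [_] := Bw n.+1 I; apply.
  by rewrite /S -bigcup_mkord; exists n => /=.
Qed.

HB.instance Definition _ := @Content_isMeasure.Build _ (cyl W) R cyl_prob
  cyl_prob_semi_sigma_additive.

(** The Caratheodory extension of the probability of cylinders. *)
Definition tulcea : set (g_sigma_algebraType (@measurable _ (cyl W))) -> \bar R :=
  measure_extension cyl_prob.

HB.instance Definition _ := Measure.on tulcea.

Let tulcea_setT : tulcea setT = 1.
Proof. by rewrite /tulcea /measure_extension measurable_mu_extE//= cyl_probT. Qed.

HB.instance Definition _ := @Measure_isProbability.Build _ _ R tulcea tulcea_setT.

Lemma tulceaE N (A : set (traj W)) : measurable A -> determined N A ->
  tulcea A = titer N 0 (ind A) w0.
Proof.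
move=> mA dA; rewrite /tulcea /measure_extension measurable_mu_extE/=.
  exact: cyl_probE.
by split => //; exists N.
Qed.

End ionescu_tulcea.

Section ionescu_tulcea_theorem.
Context d (W : measurableType d) (R : realType).
Variables (K : nat -> R.-pker (traj W) ~> W) (w0 : traj W).

(** The cylinders generate the product sigma-algebra. *)
Lemma measurable_cyl_traj (A : set (traj W)) : measurable A ->
  measurable (A : set (g_sigma_algebraType (@measurable _ (cyl W)))).
Proof.
move: A; apply: smallest_sub; first exact: sigma_algebra_measurable.
move=> _ [n _ [B mB <-]]; rewrite setTI; apply: sub_sigma_algebra.
split; first by rewrite -[X in measurable X]setTI; exact: measurable_coord.
by exists n => w w' ww'; rewrite /preimage/= ww'.
Qed.

(** Existence of a law on sequences for which the probability of an event about the
    coordinates up to N is computed by N successive draws from the kernels K,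
    starting from the coordinate of index 0 of w0. *)
Theorem ionescu_tulcea : exists P : probability (traj W) R,
  forall N (A : set (traj W)), measurable A -> determined N A ->
    P A = titer K N 0 (@ind _ W R A) w0.
Proof.
pose toT : g_sigma_algebraType (@measurable _ (cyl W)) -> traj W := idfun.
have mT : measurable_fun setT toT.
  by move=> _ A mA; rewrite setTI; exact: measurable_cyl_traj.
pose T := mfun_Sub (mem_set mT).
exists (distribution (tulcea K w0 : probability _ R) T) => N A mA dA.
by rewrite /distribution /pushforward/= (tulceaE K w0 mA dA).
Qed.

End ionescu_tulcea_theorem.

(** * Kernels and countable state spaces *)

Section kernel_on_snd.
Context dX d d' (X : measurableType dX) (S : measurableType d)
  (T : measurableType d') (R : realType).
Variable k : R.-pker S ~> T.

(** The kernel k, seen as a kernel from a product that ignores the first factor. *)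
Definition kernel_on_snd (x : X * S) : {measure set T -> \bar R} := k x.2.

Let measurable_kernel_on_snd A : measurable A ->
  measurable_fun setT (kernel_on_snd ^~ A).
Proof.
move=> mA; rewrite /kernel_on_snd.
exact: (measurableT_comp (measurable_kernel k A mA) measurable_snd).
Qed.

HB.instance Definition _ := isKernel.Build _ _ _ _ _ kernel_on_snd
  measurable_kernel_on_snd.

Let kernel_on_snd_prob x : kernel_on_snd x setT = 1.
Proof. exact: prob_kernel. Qed.

HB.instance Definition _ := Kernel_isProbability.Build _ _ _ _ _ kernel_on_snd
  kernel_on_snd_prob.

End kernel_on_snd.

Section mixture.
Context d d' (S : measurableType d) (T : measurableType d') (R : realType).
Variables (lam : {measure set S -> \bar R}) (lam_fin : lam setT < +oo).
Variable k : R.-pker S ~> T.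

(** The measure lam, seen as a kernel from a one-point space. *)
Definition kernel_cst (_ : unit) : {measure set S -> \bar R} := lam.

Let measurable_kernel_cst A : measurable A ->
  measurable_fun setT (kernel_cst ^~ A).
Proof. by move=> _; exact: measurable_cst. Qed.

HB.instance Definition _ := isKernel.Build _ _ _ _ _ kernel_cst
  measurable_kernel_cst.

Let kernel_cst_uub : measure_fam_uub kernel_cst.
Proof.
have lf : lam setT \is a fin_num by rewrite ge0_fin_numE.
exists (fine (lam setT) + 1)%R => -[]; rewrite /kernel_cst EFinD fineK//.
by rewrite lteDl// lte_fin.
Qed.

HB.instance Definition _ := Kernel_isFinite.Build _ _ _ _ _ kernel_cst
  kernel_cst_uub.

(** Integration against the mixture of the measures k x under lam. The mixture is
    the composition of two kernels, for which the formula is known. *)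
Lemma integral_mixture (lam' : {measure set T -> \bar R}) (g : T -> \bar R) :
  (forall A, measurable A -> lam' A = \int[lam]_x k x A) ->
  (forall x, 0 <= g x) -> measurable_fun setT g ->
  \int[lam']_y g y = \int[lam]_x \int[k x]_y g y.
Proof.
move=> lamE g0 mg.
rewrite -(@integral_kcomp _ _ _ unit S T R kernel_cst (@kernel_on_snd _ _ _ unit S T R k) tt)//.
by apply: eq_measure_integral => A mA _; rewrite lamE.
Qed.

End mixture.

Section discrete.
Context d (S : measurableType d).
Hypothesis cS : countable [set: S].
Hypothesis mS : forall A : set S, measurable A.

Lemma measurable_discrete d' (T : measurableType d') (D : set S) (h : S -> T) :
  measurable_fun D h.
Proof. by move=> _ A _; exact: mS. Qed.

Lemma countable_index : exists e : S -> nat, injective e.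
Proof.
have /countable_injP[e ie] := cS.
by exists e => x y; apply: ie; rewrite inE.
Qed.

(** A variable with countably many values cuts its domain into countably many
    events on which it is constant. *)
Lemma countable_fibers d' (T : measurableType d') (z : T -> S) :
  measurable_fun setT z -> exists F : nat -> set T,
  [/\ trivIset setT F, \bigcup_n F n = setT, forall n, measurable (F n) &
      forall n, F n = set0 \/ exists s, F n = z @^-1` [set s]].
Proof.
move=> mz; have [e ie] := countable_index.
exists (fun n => z @^-1` (e @^-1` [set n])); split.
- by move=> i j _ _ [t [<- <-]].
- by apply/seteqP; split => // t _; exists (e (z t)).
- by move=> n; rewrite -[X in measurable X]setTI; apply: mz.
- move=> n; have [[s sn]|/forallNP ns] := pselect (exists s, e s = n); last first.
    by left; apply/seteqP; split => // t /= /ns.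
  right; exists s; apply/seteqP; split => t /=.
    by rewrite -sn => /ie.
  by move=> ->.
Qed.

End discrete.

Section discrete_prod.
Context d (S : measurableType d).
Hypothesis cS : countable [set: S].
Hypothesis mS : forall A : set S, measurable A.

Lemma countable_prod : countable [set: S * S].
Proof. by rewrite -setXTT; exact: countableX. Qed.

Lemma measurable_prod_discrete (A : set (S * S)) : measurable A.
Proof.
apply: countable_measurable => [[x y]|].
  rewrite (_ : [set (x, y)] = [set x] `*` [set y]).
    by apply: measurableX.
  by apply/seteqP; split=> [[a b] [-> ->]|[a b] /= [-> ->]].
exact: (sub_countable (subset_card_le (@subsetT _ A)) countable_prod).
Qed.

End discrete_prod.

(** * Iterated kernels, and tightness under positive recurrence *)

Section kernel_composition.
Context d (S : measurableType d) (R : realType).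
Variables l k : R.-pker S ~> S.

(** First a step of l, then a step of k. *)
Definition kernel_comp (x : S) : {measure set S -> \bar R} :=
  mkcomp l (@kernel_on_snd _ _ _ S S S R k) x.

Let measurable_kernel_comp A : measurable A ->
  measurable_fun setT (kernel_comp ^~ A).
Proof.
by move=> mA; exact: (measurable_kernel (mkcomp l (@kernel_on_snd _ _ _ S S S R k)) A mA).
Qed.

HB.instance Definition _ := isKernel.Build _ _ _ _ _ kernel_comp
  measurable_kernel_comp.

Let kernel_comp_prob x : kernel_comp x setT = 1.
Proof.
rewrite /kernel_comp/= /kcomp /kernel_on_snd/=.
under eq_integral do rewrite prob_kernel.
by rewrite integral_cst// mul1e prob_kernel.
Qed.

HB.instance Definition _ := Kernel_isProbability.Build _ _ _ _ _ kernel_comp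
  kernel_comp_prob.

End kernel_composition.

Section iterates.
Context d (S : measurableType d) (R : realType).
Variable K : R.-pker S ~> S.

(** The iterates of K as probability kernels. *)
Fixpoint kiter (n : nat) : R.-pker S ~> S :=
  if n is m.+1 then kernel_comp K (kiter m) else kdirac (@measurable_id _ S setT).

Lemma kernel_iterE n x A : kernel_iter K n x A = kiter n x A.
Proof.
elim: n x => //= n ih x; under eq_integral do rewrite ih.
by [].
Qed.

Lemma kernel_iter1 x A : measurable A -> kernel_iter K 1 x A = K x A.
Proof. by move=> mA; rewrite /= (integral_indic (K x) measurableT)// setIT. Qed.

Lemma kernel_iter_ge0 n x A : 0 <= kernel_iter K n x A.
Proof. by rewrite kernel_iterE. Qed.

Lemma kernel_iter_le1 n x A : measurable A -> kernel_iter K n x A <= 1.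
Proof.
move=> mA; rewrite kernel_iterE (_ : 1 = kiter n x setT); last by rewrite prob_kernel.
by apply: le_measure; rewrite ?inE.
Qed.

Lemma measurable_kernel_iter n A : measurable A ->
  measurable_fun setT (fun x => kernel_iter K n x A).
Proof.
move=> mA; under eq_fun do rewrite kernel_iterE.
exact: measurable_kernel.
Qed.

Lemma chapman_kolmogorov n m x A : measurable A ->
  kernel_iter K (n + m) x A = \int[kiter n x]_y kernel_iter K m y A.
Proof.
move=> mA; elim: n x => [|n ih] x.
  by rewrite integral_dirac//= ?diracT ?mul1e//; exact: measurable_kernel_iter.
rewrite /=; under eq_integral do rewrite ih.
apply/esym/integral_mixture => //.
- by rewrite prob_kernel ltry.
- by move=> y; exact: kernel_iter_ge0.
- exact: measurable_kernel_iter.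
Qed.

Lemma law_evolution (lam : nat -> {measure set S -> \bar R}) :
  (forall j, lam j setT < +oo) ->
  (forall j A, measurable A -> lam j.+1 A = \int[lam j]_x K x A) ->
  forall m j A, measurable A -> lam (j + m)%N A = \int[lam j]_x kernel_iter K m x A.
Proof.
move=> lamT lamS; elim=> [|m ih] j A mA.
  by rewrite addn0/= (integral_indic (lam j) measurableT)// setIT.
rewrite addnS -addSn ih//=.
apply: integral_mixture => //.
- by move=> A' mA'; exact: lamS.
- by move=> y; exact: kernel_iter_ge0.
- exact: measurable_kernel_iter.
Qed.

End iterates.

Lemma ereal_cvg_lt (R : realType) (I : Type) (F : set_system I) {FF : Filter F}
    (u : I -> \bar R) (l b : \bar R) :
  u @ F --> l -> l < b -> \forall i \near F, u i < b.
Proof. by move=> ul lb; exact: (ul _ (open_ereal_lt' lb)). Qed.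

Section excursions.
Context d (S : measurableType d) (R : realType).
Hypothesis mS : forall A : set S, measurable A.
Variables (K : R.-pker S ~> S) (x : S).

Let mf d' (T : measurableType d') (D : set S) (h : S -> T) : measurable_fun D h.
Proof. exact: measurable_discrete. Qed.

Hint Extern 0 (measurable _) => exact: mS : core.
Hint Extern 0 (measurable_fun _ _) => exact: mf : core.

(** taboo n y A is the probability, for the chain started at y, that it is in A
    at time n and avoids x at the times 1, ..., n. *)
Fixpoint taboo (n : nat) (y : S) (A : set S) : \bar R :=
  if n is m.+1 then \int[K y]_(z in ~` [set x]) taboo m z A else \d_y A.

Lemma taboo_ge0 n y A : 0 <= taboo n y A.
Proof.
elim: n y => [|n ih] y; first exact: measure_ge0.
by apply: integral_ge0 => z _.
Qed.

Lemma first_passage_ge0 n y A : 0 <= first_passage K n y A.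
Proof.
elim: n y => [|n ih] y; first exact: measure_ge0.
by apply: integral_ge0 => z _.
Qed.

Lemma taboo_le n y A : taboo n y A <= kernel_iter K n y A.
Proof.
elim: n y => [|n ih] y //=.
apply: (@le_trans _ _ (\int[K y]_z taboo n z A)).
  by apply: ge0_subset_integral => // z _; exact: taboo_ge0.
apply: ge0_le_integral => // z _; exact: taboo_ge0.
Qed.

Lemma taboo_leT n y A : taboo n y A <= taboo n y setT.
Proof.
elim: n y => [|n ih] y; first by apply: le_measure; rewrite ?inE.
by apply: ge0_le_integral => // z _; exact: taboo_ge0.
Qed.

Lemma integral_split_point y (g : S -> \bar R) : (forall z, 0 <= g z) ->
  \int[K y]_z g z = \int[K y]_(z in ~` [set x]) g z + g x * K y [set x].
Proof.
move=> g0; rewrite -(setvU [set x]) ge0_integral_setU//; last first.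
  by apply/disj_setPS => z [].
congr (_ + _); rewrite -integral_cst//; apply: eq_integral => z.
by rewrite inE => ->.
Qed.

(** Decomposition according to the last visit to x at a time 1, ..., n, if any. *)
Lemma last_exit n y A : kernel_iter K n y A = taboo n y A +
  \sum_(k < n) kernel_iter K (n - k) y [set x] * taboo k x A.
Proof.
elim: n y => [|n ih] y; first by rewrite big_ord0 adde0.
rewrite [LHS]/=; under eq_integral do rewrite ih.
have p0 m z B k : 0 <= kernel_iter K m z B * taboo k x A.
  by rewrite mule_ge0 ?kernel_iter_ge0 ?taboo_ge0.
rewrite ge0_integralD//; last 2 first.
- by move=> z _; exact: taboo_ge0.
- by move=> z _; apply: sume_ge0.
rewrite ge0_integral_sum//.
rewrite integral_split_point; last by move=> z; exact: taboo_ge0.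
rewrite big_ord_recr/= subSnn -addeA; congr (_ + _).
rewrite addeC; congr (_ + _).
  apply: eq_bigr => k _; rewrite ge0_integralZr//.
  - by rewrite subSn// ltnW.
  - by move=> z _; exact: kernel_iter_ge0.
  - exact: taboo_ge0.
by rewrite muleC/= (integral_indic (K y) measurableT)// setIT.
Qed.

Lemma kernel_iter_le_taboo n A :
  kernel_iter K n x A <= \sum_(k < n.+1) taboo k x A.
Proof.
rewrite last_exit big_ord_recr/= addeC leeD2r//.
apply: lee_sum => k _; rewrite gee_pMl ?kernel_iter_le1//.
- by rewrite ge0_fin_numE ?kernel_iter_ge0// (le_lt_trans (kernel_iter_le1 _ _ _ _))// ltry.
- exact: taboo_ge0.
Qed.

Lemma taboo0T y : taboo 0 y setT = 1.
Proof. by rewrite /= diracT. Qed.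

(** Either x is still unvisited at time n + 1 or this is the first visit. *)
Lemma tabooT n y : taboo n y setT = taboo n.+1 y setT + first_passage K n y [set x].
Proof.
elim: n y => [|n ih] y.
  have K1 : K y setT = 1 by rewrite prob_kernel.
  have KU : K y setT = K y (~` [set x]) + K y [set x].
    by rewrite -(setvU [set x]) measureU// setICl.
  rewrite taboo0T -K1 KU /=; congr (_ + _); under eq_integral do rewrite diracT.
  by rewrite integral_cst// mul1e.
rewrite [LHS]/=; under eq_integral do rewrite ih.
rewrite ge0_integralD//.
- by move=> z _; exact: (taboo_ge0 n.+1).
- by move=> z _; exact: first_passage_ge0.
Qed.

(** Under recurrence the return time T to x is finite, so that P (T > n) is the
    sum of the P (T = k) for k > n; the index of first_passage is shifted by one. *)
Lemma taboo_tail : recurrent_state K x -> forall n,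
  taboo n x setT = \sum_(n <= k <oo) first_passage K k x [set x].
Proof.
move=> rx n.
have fin k : first_passage K k x [set x] \is a fin_num.
  have t1 m : taboo m x setT <= 1.
    elim: m => [|m ih]; first by rewrite taboo0T.
    by rewrite (le_trans _ ih)// [leRHS]tabooT leeDl// first_passage_ge0.
  rewrite ge0_fin_numE ?first_passage_ge0// (@le_lt_trans _ _ 1) ?ltry//.
  by rewrite (le_trans _ (t1 k))// [leRHS]tabooT leeDr// taboo_ge0.
have sfin m : \sum_(0 <= k < m) first_passage K k x [set x] \is a fin_num.
  by apply/sum_fin_numP.
have sumE m : \sum_(0 <= k < m) first_passage K k x [set x] + taboo m x setT = 1.
  elim: m => [|m ih]; first by rewrite big_nil add0e taboo0T.
  by rewrite big_nat_recr//= -ih [in RHS]tabooT -addeA (addeC (first_passage _ _ _ _)).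
have tailE : \sum_(0 <= k < n) first_passage K k x [set x] +
    \sum_(n <= k <oo) first_passage K k x [set x] = 1.
  rewrite -[RHS]rx (nneseries_split 0 n) ?add0n// => k _.
  exact: first_passage_ge0.
rewrite -[LHS](addeK _ (sfin n)) -[RHS](addeK _ (sfin n)); congr (_ - _).
by rewrite addeC sumE addeC tailE.
Qed.

(** The sum of the P (T > k) is the expectation of T; one inequality suffices. *)
Lemma expected_excursion : recurrent_state K x ->
  \sum_(0 <= k <oo) taboo k x setT <= mean_return_time K x.
Proof.
move=> rx; rewrite /mean_return_time.
pose a k := first_passage K k x [set x].
have a0 k : 0 <= a k by exact: first_passage_ge0.
have sumE n : \sum_(0 <= k < n) taboo k x setT =
    \sum_(0 <= k < n) k.+1%:R%:E * a k + n%:R%:E * taboo n x setT.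
  elim: n => [|n ih]; first by rewrite !big_nil mul0e adde0.
  rewrite !big_nat_recr//= ih -!addeA; congr (_ + _).
  rewrite -[in X in _ + X](mul1e (taboo n x setT)) -ge0_muleDl// -EFinD -natr1.
  by rewrite [in LHS]tabooT ge0_muleDr ?taboo_ge0 ?first_passage_ge0// addeC.
apply: lime_le.
  by apply: is_cvg_nneseries => k _ _; exact: taboo_ge0.
apply: nearW => n; rewrite sumE (nneseries_split 0 n)//; last first.
  by move=> k _; apply: mule_ge0; [rewrite lee_fin ler0n|exact: first_passage_ge0].
rewrite add0n leeD2l// (taboo_tail rx).
rewrite -nneseriesZl//; last by move=> k _; exact: first_passage_ge0.
rewrite eseries_cond [leRHS]eseries_cond; apply: lee_nneseries => [k _ _|k nk].
  by apply: mule_ge0; [rewrite lee_fin ler0n|exact: first_passage_ge0].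
apply: lee_wpmul2r; first exact: a0.
by rewrite lee_fin ler_nat; move: nk => /andP[_ nk]; exact: ltnW.
Qed.

(** The laws at time n of the chain started at a positive recurrent state are
    tight. By the last exit decomposition the mass of A at time n is at most the
    expected time spent in A by an excursion from x. The excursions have a finite
    mean length, and the sum over k is cut at a level N beyond which it is small
    for all A at once. *)
Lemma positive_recurrent_tight (e : S -> nat) (eps : R) : injective e ->
  recurrent_state K x -> mean_return_time K x < +oo -> (0 < eps)%R ->
  exists M, forall n, kernel_iter K n x [set z | (M <= e z)%N] <= eps%:E.
Proof.
move=> ie rx mx eps0.
pose A M := [set z | (M <= e z)%N].
have tsum : \sum_(0 <= k <oo) taboo k x setT < +oo.
  exact: le_lt_trans (expected_excursion rx) mx.
have e2 : 0 < (eps / 2)%:E by rewrite lte_fin divr_gt0.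
have /= := nneseries_tail_cvg tsum (fun k _ => taboo_ge0 k x setT).
move=> /ereal_cvg_lt /(_ e2) [N _ tailN].
have A0 k : (fun M => kiter K k x (A M)) @ \oo --> 0.
  have I0 : \bigcap_M A M = set0.
    by apply/seteqP; split => // z Az; have := Az (e z).+1 I; rewrite /A/= ltnn.
  rewrite -(measure0 (kiter K k x)) -I0; apply: nonincreasing_cvg_mu => //.
    by rewrite (@le_lt_trans _ _ 1) ?ltry// -kernel_iterE kernel_iter_le1.
  by move=> n m nm; apply/subsetPset => z /=; exact: leq_trans.
have sA0 : (fun M => \sum_(k < N) kiter K k x (A M)) @ \oo --> 0.
  rewrite [X in _ --> X](_ : 0 = \sum_(k < N) 0 :> \bar R); last by rewrite big1.
  apply: (cvg_nnesum (f := fun (k : 'I_N) M => kiter K k x (A M)) (l := fun=> 0)).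
    by move=> k _; exact: nearW.
  by move=> k _; exact: A0.
have [M _ headM] := ereal_cvg_lt sA0 e2.
exists M => n; rewrite (le_trans (kernel_iter_le_taboo _ _))//.
rewrite -(big_mkord xpredT (fun k => taboo k x (A M))).
apply: (@le_trans _ _ (\sum_(0 <= k <oo) taboo k x (A M))).
  apply: nneseries_lim_ge => k _ _; exact: taboo_ge0.
rewrite (nneseries_split 0 N); last by move=> k _; exact: taboo_ge0.
rewrite add0n (splitr eps) EFinD; apply: leeD.
  apply: (@le_trans _ _ _ _ _ _ (ltW (headM M (leqnn M)))).
  by rewrite big_mkord; apply: lee_sum => k _; rewrite -kernel_iterE taboo_le.
apply: le_trans (ltW (tailN N (leqnn N))).
apply: lee_nneseries => [k _ _|k _]; first exact: taboo_ge0.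
exact: taboo_leT.
Qed.

End excursions.

(** * Invariant probabilities as limits of averages *)

(** Along an ultrafilter bounded sequences of reals converge; this replaces the
    extraction of a diagonal subsequence. *)
Lemma ultra_bounded_cvg (R : realType) (U : set_system nat) (u : nat -> R) :
  UltraFilter U -> (forall n, 0 <= u n <= 1)%R -> exists l : R, u @ U --> l.
Proof.
move=> UU u01.
have := @segment_compact R 0 1; rewrite compact_ultra => /(_ (u @ U)).
have uU : UltraFilter (u @ U).
  split; first exact: fmap_proper_filter.
  move=> G PG uG; apply/seteqP; split => // A GA; rewrite /fmap/=.
  have [//|nUA] := in_ultra_setVsetC (u @^-1` A) UU.
  have /uG GnA : (u @ U) (~` A) by [].
  have : G (A `&` ~` A) by exact: filterI.
  by rewrite setICr => /filter_not_empty.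
move=> /(_ uU) [|l [_ ul]]; last by exists l.
suff : U (u @^-1` `[0%R, 1%R]%classic) by [].
by apply: filterE => n; rewrite /= in_itv/= u01.
Qed.

Section limit_of_averages.
Context d (S : measurableType d) (R : realType).
Hypothesis mS : forall A : set S, measurable A.
Variables (K : R.-pker S ~> S) (e : S -> nat) (ie : injective e).
Variable lam : nat -> {measure set S -> \bar R}.
Hypothesis lam1 : forall k, lam k setT = 1.
Hypothesis lamS : forall k A, lam k.+1 A = \int[lam k]_z K z A.
Variables (M : nat) (c : R).
Hypothesis c0 : (0 < c)%R.
Hypothesis lamc : forall k, c%:E <= lam k [set z | (e z < M)%N].

Let mf d' (T : measurableType d') (D : set S) (h : S -> T) : measurable_fun D h.
Proof. exact: measurable_discrete. Qed.

Hint Extern 0 (measurable _) => exact: mS : core.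
Hint Extern 0 (measurable_fun _ _) => exact: mf : core.

(* the point of index n, as a set and as an element of S (a default element
   when no point has index n, in which case F n is empty) *)
Let F n : set S := e @^-1` [set n].
Let t n : S := xget point (F n).

Let FE n : F n = set0 \/ F n = [set t n].
Proof.
have [[z Fz]|/forallNP nF] := pselect (exists z, F n z).
  have Ft : F n (t n) by exact: xgetPex (ex_intro _ z Fz).
  right; apply/seteqP; split => [y Fy|_ ->//]; apply: ie.
  by rewrite [e y]Fy [e _]Ft.
by left; apply/seteqP; split.
Qed.

Let tF : trivIset setT F.
Proof. by move=> i j _ _ [z [<- <-]]. Qed.

Let UF : \bigcup_n F n = setT.
Proof. by apply/seteqP; split => // z _; exists (e z). Qed.

Let lam_fin k A : lam k A \is a fin_num.
Proof.
rewrite ge0_fin_numE// (@le_lt_trans _ _ 1) ?ltry// -(lam1 k).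
by apply: le_measure; rewrite ?inE.
Qed.

Let lam_le1 k A : lam k A <= 1.
Proof. by rewrite -(lam1 k); apply: le_measure; rewrite ?inE. Qed.

Let K_fin z A : K z A \is a fin_num.
Proof.
rewrite ge0_fin_numE// (@le_lt_trans _ _ 1) ?ltry//.
rewrite (_ : 1 = K z setT); last by rewrite prob_kernel.
by apply: le_measure; rewrite ?inE.
Qed.

(* mass at time k of the point of index n, and its Cesaro average *)
Let a k n : R := fine (lam k (F n)).

Let a01 k n : (0 <= a k n <= 1)%R.
Proof. by rewrite fine_ge0//= -lee_fin fineK. Qed.

Let avg N n : R := (N.+1%:R^-1 * \sum_(k < N.+1) a k n)%R.

Let avg01 N n : (0 <= avg N n <= 1)%R.
Proof.
apply/andP; split.
  by rewrite mulr_ge0// sumr_ge0// => k _; have /andP[] := a01 k n.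
rewrite /avg mulrC ler_pdivrMr ?ltr0n// mul1r.
rewrite -[leRHS](_ : \sum_(k < N.+1) 1 = _)%R; last by rewrite sumr_const card_ord.
by apply: ler_sum => k _; have /andP[] := a01 k n.
Qed.

Let integral_fiber (mu : {measure set S -> \bar R}) (g : S -> \bar R) n :
  \int[mu]_(z in F n) g z = g (t n) * mu (F n).
Proof.
have [->|->] := FE n; first by rewrite integral_set0 measure0 mule0.
by rewrite -integral_cst//; apply: eq_integral => z; rewrite inE => ->.
Qed.

Let sum_le k (g : S -> \bar R) L : (forall z, 0 <= g z) ->
  \sum_(n < L) g (t n) * lam k (F n) <= \int[lam k]_z g z.
Proof.
move=> g0; rewrite -(UF) ge0_integral_bigcup//.
rewrite -(big_mkord xpredT (fun n => g (t n) * lam k (F n))).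
apply: (@le_trans _ _ (\sum_(0 <= n < L) \int[lam k]_(z in F n) g z)).
  by apply: lee_sum => n _; rewrite integral_fiber.
by apply: nneseries_lim_ge => n _ _; exact: integral_ge0.
Qed.

(** Let lam k be the successive laws of a chain on a countable space. If they all
    keep a mass at least c > 0 in one finite set, then there is an invariant
    probability that charges only sets charged by some lam k. The averages of the
    lam k converge pointwise along an ultrafilter to the weights of a measure of
    total mass between c and 1; the limit is subinvariant by Fatou, hence
    invariant because the total mass is finite, and it remains to normalize it. *)
Lemma limit_of_averages : exists nu : probability S R,
  (forall A, nu A = \int[nu]_z K z A) /\
  (forall A, (forall k, lam k A = 0) -> nu A = 0).
Proof.
have [U [UU UN]] := @ultraFilterLemma nat \oo _.
have /choice[w wP] : forall n, exists l : R, (avg ^~ n) @ U --> l.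
  by move=> n; apply: ultra_bounded_cvg => N; exact: avg01.
have w0 n : (0 <= w n)%R.
  apply: (cvgr_to_ge (wP n)).
  by apply: nearW => N; have /andP[] := avg01 N n.
have sumcvg L (h : nat -> R) :
  (fun N => \sum_(n < L) h n * avg N n)%R @ U --> (\sum_(n < L) h n * w n)%R.
  elim: L => [|L ih]; first by under eq_fun do rewrite big_ord0; rewrite big_ord0; exact: cvg_cst.
  under eq_fun do rewrite big_ord_recr/=; rewrite big_ord_recr/=.
  by apply: cvgD => //; apply: cvgM; [exact: cvg_cst|exact: wP].
pose ms n : {measure set S -> \bar R} := mscale (NngNum (w0 n)) (\d_(t n)).
pose nu0 : {measure set S -> \bar R} := mseries ms 0.
have nu0E A : nu0 A = \sum_(n <oo) (w n)%:E * \d_(t n) A by [].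
have int_nu0 (g : S -> \bar R) : (forall z, 0 <= g z) ->
    \int[nu0]_z g z = \sum_(n <oo) (w n)%:E * g (t n).
  move=> g0; rewrite ge0_integral_measure_series//; apply: eq_eseriesr => n _.
  by rewrite ge0_integral_mscale// integral_dirac// diracT mul1e.
have avgE N L (h : nat -> R) : (\sum_(n < L) h n * avg N n =
    N.+1%:R^-1 * \sum_(k < N.+1) \sum_(n < L) h n * a k n)%R.
  rewrite exchange_big/= mulr_sumr; apply: eq_bigr => n _.
  by rewrite /avg mulrCA -mulr_sumr.
have sum_fine k (g : S -> \bar R) L : (forall z, 0 <= g z) ->
    (forall z, g z \is a fin_num) ->
    (\sum_(n < L) fine (g (t n)) * a k n)%:E <= \int[lam k]_z g z.
  move=> g0 gfin; apply: le_trans (sum_le k L g0).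
  by rewrite -sumEFin; apply: lee_sum => n _; rewrite EFinM !fineK.
have nu0_le1 : nu0 setT <= 1.
  rewrite nu0E; apply: lime_le.
    by apply: is_cvg_nneseries => n _ _; rewrite mule_ge0// lee_fin.
  apply: nearW => L; rewrite big_mkord.
  under eq_bigr do rewrite diracT mule1.
  rewrite sumEFin lee_fin.
  have := sumcvg L (fun=> 1%R); under [X in _ --> X]eq_bigr do rewrite mul1r.
  move=> /cvgr_to_le; apply; apply: nearW => N.
  rewrite (avgE N L (fun=> 1%R)) mulrC ler_pdivrMr ?ltr0n// mul1r.
  rewrite -[leRHS](_ : \sum_(k < N.+1) 1 = _)%R; last by rewrite sumr_const card_ord.
  apply: ler_sum => k _; rewrite -lee_fin.
  apply: (le_trans (sum_fine k (cst 1) L _ _)) => //.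
  by rewrite integral_cst// mul1e.
have nu0_fin A : nu0 A \is a fin_num.
  rewrite ge0_fin_numE// (@le_lt_trans _ _ 1) ?ltry// (le_trans _ nu0_le1)//.
  by apply: le_measure; rewrite ?inE.
(* subinvariance at the point of index j: the average of the laws moved by one
   step differs from the average by at most 1 / (N + 1) *)
have sub_point j : \int[nu0]_z K z (F j) <= (w j)%:E.
  rewrite int_nu0//; apply: lime_le.
    by apply: is_cvg_nneseries => n _ _; rewrite mule_ge0// lee_fin.
  apply: nearW => L; rewrite big_mkord.
  rewrite (eq_bigr (fun n : 'I_L => (fine (K (t n) (F j)) * w n)%:E)); last first.
    by move=> n _; rewrite EFinM fineK// muleC.
  rewrite sumEFin lee_fin.
  have := sumcvg L (fun n => fine (K (t n) (F j))).
  have inv0 : (fun N => avg N j + N.+1%:R^-1)%R @ U --> (w j + 0)%R.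
    apply: cvgD; first exact: wP.
    by apply: cvg_trans (@cvg_harmonic R); exact: cvg_app.
  rewrite addr0 in inv0.
  move=> /ler_cvg_to /(_ inv0); apply; apply: nearW => N.
  rewrite (avgE N L (fun n => fine (K (t n) (F j)))) /avg.
  rewrite -[X in (_ <= _ + X)%R]mulr1 -mulrDr ler_pM2l ?invr_gt0 ?ltr0n//.
  apply: (@le_trans _ _ (\sum_(k < N.+1) a k.+1 j)%R).
    apply: ler_sum => k _; rewrite -lee_fin.
    apply: (le_trans (sum_fine k (fun z => K z (F j)) L _ _)) => //.
    by rewrite -lamS fineK.
  rewrite big_ord_recr [X in (_ <= X + _)%R]big_ord_recl/= (addrC (a 0%N j)) -addrA.
  apply: lerD; first by apply: ler_sum => k _; rewrite /bump/= add1n.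
  have /andP[_ aN1] := a01 N.+1 j; have /andP[a00 _] := a01 0%N j.
  by rewrite -[leLHS]add0r lerD.
(* a set is cut along the points; this lifts subinvariance to all sets *)
have splitF (mu : {measure set S -> \bar R}) A : mu A = \sum_(j <oo) mu (A `&` F j).
  rewrite -measure_semi_bigcup//; last by apply: trivIset_setIl.
  by rewrite -setI_bigcupr UF setIT.
have sub A : \int[nu0]_z K z A <= nu0 A.
  rewrite (splitF nu0 A).
  under eq_integral do rewrite (splitF (K _) A).
  rewrite integral_nneseries//; apply: lee_nneseries => [n _ _|j _].
    exact: integral_ge0.
  have [F0|Ft] := FE j.
    by rewrite F0 setI0 measure0 integral0_eq// => z _; rewrite measure0.
  have [At|At] := pselect (A (t j)); last first.
    rewrite Ft (_ : _ `&` _ = set0); last first.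
      by apply/seteqP; split => // z [Az zt]; apply: At; rewrite -zt.
    by rewrite measure0 integral0_eq// => z _; rewrite measure0.
  rewrite (_ : _ `&` _ = F j); last first.
    by rewrite Ft; apply/seteqP; split => [z []//|z ->].
  apply: (le_trans (sub_point j)); rewrite nu0E.
  apply: (@le_trans _ _ (\sum_(0 <= n < j.+1) (w n)%:E * \d_(t n) (F j))).
    rewrite big_nat_recr//= [X in \d__ X]Ft diracE mem_set// mule1 leeDr//.
    by apply: sume_ge0 => n _; rewrite mule_ge0// lee_fin.
  by apply: nneseries_lim_ge => n _ _; rewrite mule_ge0// lee_fin.
(* the two sides have the same finite total mass, so subinvariance on A and on
   its complement gives equality *)
have inv A : nu0 A = \int[nu0]_z K z A.
  apply/eqP; rewrite eq_le sub andbT.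
  have IC_fin : \int[nu0]_z K z (~` A) \is a fin_num.
    rewrite ge0_fin_numE ?integral_ge0// (le_lt_trans (sub _))//.
    by rewrite -ge0_fin_numE.
  rewrite -(leeD2rE _ _ IC_fin) -ge0_integralD//.
  have KT z : K z A + K z (~` A) = 1.
    rewrite -measureU//; last by rewrite setICr.
    by rewrite setUv; exact: prob_kernel.
  under [leRHS]eq_integral do rewrite KT.
  have TU : nu0 setT = nu0 A + nu0 (~` A) by rewrite -measureU// ?setUv ?setICr.
  rewrite integral_cst// mul1e [leRHS]TU.
  by apply: leeD2l; exact: sub.
(* no more than a mass 1 - c can be lost at infinity *)
have nu0c : c%:E <= nu0 setT.
  apply: (@le_trans _ _ (\sum_(0 <= n < M) (w n)%:E * \d_(t n) setT)); last first.
    by apply: nneseries_lim_ge => n _ _; rewrite mule_ge0// lee_fin.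
  rewrite big_mkord; under eq_bigr do rewrite diracT mule1.
  rewrite sumEFin lee_fin.
  have := sumcvg M (fun=> 1%R); under [X in _ --> X]eq_bigr do rewrite mul1r.
  move=> /cvgr_to_ge; apply; apply: nearW => N.
  rewrite (avgE N M (fun=> 1%R)) mulrC ler_pdivlMr ?ltr0n//.
  rewrite [leLHS](_ : _ = \sum_(k < N.+1) c)%R; last by rewrite sumr_const card_ord mulr_natr.
  apply: ler_sum => k _; rewrite -lee_fin (le_trans (lamc k))//.
  rewrite [X in lam k X](_ : _ = \big[setU/set0]_(n < M) F n); last first.
    rewrite -bigcup_mkord; apply/seteqP; split => z /=.
      by move=> zM; exists (e z).
    by move=> [n nM]; rewrite /F/= => ->.
  rewrite measure_bigsetU// -sumEFin; apply: lee_sum => n _.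
  by rewrite mul1r fineK.
have nu0_null A : (forall k, lam k A = 0) -> nu0 A = 0.
  move=> lamA; rewrite nu0E eseries0// => n _ _.
  have [tA|tA] := boolP (t n \in A); last by rewrite diracE (negbTE tA) mule0.
  suff -> : w n = 0%R by rewrite mul0e.
  have avg0 N : avg N n = 0%R.
    rewrite /avg big1 ?mulr0// => k _; rewrite /a.
    apply/eqP; rewrite -eqe fineK//; apply/eqP.
    have [->|->] := FE n; first by rewrite measure0.
    apply: (subset_measure0 _ _ _ (lamA k)) => // z ->; exact: set_mem.
  have := wP n; under eq_fun do rewrite avg0.
  by move=> /cvg_lim <-//; rewrite lim_cst.
have nu0T0 : nu0 setT != 0 by rewrite gt_eqF// (lt_le_trans _ nu0c)// lte_fin.
have nu0Ty : nu0 setT != +oo by rewrite lt_eqF// -ge0_fin_numE.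
pose r := (fine (nu0 setT))^-1%R.
have r0 : (0 <= r)%R by rewrite invr_ge0 fine_ge0.
(* the default measure of the normalization is not used: the mass is neither 0 nor infinite *)
pose nu : probability S R := mnormalize nu0 (\d_point : probability S R).
have nuE A : nu A = mscale (NngNum r0) nu0 A.
  by rewrite /nu /= /mnormalize (negbTE nu0T0) (negbTE nu0Ty)/= /mscale/= muleC.
exists nu; split => [A|A lamA]; last first.
  by rewrite nuE /mscale/= nu0_null// mule0.
rewrite (eq_measure_integral (mscale (NngNum r0) nu0)); last by move=> B _ _; exact: nuE.
by rewrite ge0_integral_mscale//= nuE /mscale/= inv.
Qed.

End limit_of_averages.

(** * The past of a process, and independence *)

Section uniqueness.
Context d (T : measurableType d) (R : realType).

(** The pi-lambda uniqueness theorem, for finite measures. *)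
Lemma finite_measure_unique (m1 m2 : {measure set T -> \bar R})
    (G : set (set T)) : G setT -> setI_closed G -> G `<=` measurable ->
  m1 setT < +oo -> (forall A, G A -> m1 A = m2 A) ->
  forall A, <<s G >> A -> m1 A = m2 A.
Proof.
move=> GT GI Gm m1T m12.
apply: (g_sigma_algebra_measure_unique G _ (fun=> setT)) => //.
by apply/seteqP; split => // x _; exists 0%N.
Qed.

Lemma independent_generated (P : probability T R) (C : set T) (G : set (set T)) :
  measurable C -> G setT -> setI_closed G -> G `<=` measurable ->
  (forall B, G B -> P (C `&` B) = P C * P B) ->
  forall B, <<s G >> B -> P (C `&` B) = P C * P B.
Proof.
move=> mC GT GI Gm GP B GB.
have PC0 : (0 <= fine (P C))%R by rewrite fine_ge0.
have E m : mscale (NngNum PC0) P m = P C * P m.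
  by rewrite /mscale/= fineK// fin_num_measure.
rewrite -E setIC -[LHS]/(mrestr P mC B).
apply: (finite_measure_unique (G := G)) => //.
  rewrite [ltLHS]/= /mrestr setTI; apply: (le_lt_trans (probability_le1 P mC)).
  by rewrite ltry.
by move=> A GA; rewrite [RHS]E -GP// setIC.
Qed.

End uniqueness.

Section past_events.
Context d (Omega : measurableType d) dS (S : measurableType dS).
Implicit Types (Z : int -> Omega -> S).

Lemma past_mem Z n k A : (k <= n)%R -> measurable A -> past Z n (Z k @^-1` A).
Proof.
move=> kn mA; apply: sub_sigma_algebra; exists k => //.
by exists A => //; rewrite setTI.
Qed.

Lemma past_le Z n m : (n <= m)%R -> past Z n `<=` past Z m.
Proof.
move=> nm; apply: sub_sigma_algebra2 => A [k /= kn ZA]; exists k => //=.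
exact: le_trans nm.
Qed.

Lemma past_measurable Z n : (forall k, measurable_fun setT (Z k)) ->
  past Z n `<=` measurable.
Proof.
move=> mZ; apply: smallest_sub; first exact: sigma_algebra_measurable.
by move=> _ [k _ [B mB <-]]; apply: mZ.
Qed.

Lemma past_comp Z dT (T : measurableType dT) (h : S -> T) n :
  measurable_fun setT h -> past (fun k w => h (Z k w)) n `<=` past Z n.
Proof.
move=> mh; apply: sub_sigma_algebra2 => _ [k /= kn [B mB <-]]; exists k => //.
exists (h @^-1` B) => //; by rewrite -[X in measurable X]setTI; exact: mh.
Qed.

Lemma past_sigma Z n : sigma_algebra setT (past Z n).
Proof. exact: smallest_sigma_algebra. Qed.

Lemma past_setT Z n : past Z n setT.
Proof.
have [p0 pC _] := past_sigma Z n.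
by rewrite -setC0 -setTD; exact: pC.
Qed.

Lemma past_setC Z n A : past Z n A -> past Z n (~` A).
Proof. by have [p0 pC _] := past_sigma Z n; rewrite -setTD; exact: pC. Qed.

Lemma past_bigcup Z n (F : nat -> set Omega) :
  (forall i, past Z n (F i)) -> past Z n (\bigcup_i F i).
Proof. by have [_ _ pU] := past_sigma Z n; exact: pU. Qed.

Lemma past_bigcap Z n (F : nat -> set Omega) :
  (forall i, past Z n (F i)) -> past Z n (\bigcap_i F i).
Proof.
move=> pF; rewrite -[X in past _ _ X]setCK setC_bigcap; apply: past_setC.
by apply: past_bigcup => i; exact: past_setC.
Qed.

Lemma past_setI Z n A B : past Z n A -> past Z n B -> past Z n (A `&` B).
Proof.
move=> pA pB; rewrite -bigcap2E; apply: past_bigcap => -[|[|i]] //=.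
exact: past_setT.
Qed.

End past_events.

Section finite_cylinders.
Context d (Omega : measurableType d) dS (S : measurableType dS) (R : realType).
Variables (P : probability Omega R) (Z : int -> Omega -> S) (n : int).
Hypothesis mZ : forall k, measurable_fun setT (Z k).

(** The events which constrain separately finitely many of the Z k, k <= n. *)
Definition cylinders : set (set Omega) :=
  [set B | exists (I : {fset int}) (A : int -> set S),
    [/\ (forall k, measurable (A k)), (forall k, k \in I -> (k <= n)%R) &
        B = \bigcap_(k in [set` I]) (Z k @^-1` A k)]].

Lemma cylinders_setT : cylinders setT.
Proof. by exists fset0, (fun=> setT); split => //; rewrite set_fset0 bigcap_set0. Qed.

Lemma cylinders_setI : setI_closed cylinders.
Proof.
move=> _ _ [I [A [mA In ->]]] [J [A' [mA' Jn ->]]].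
exists (I `|` J)%fset, (fun k => (if k \in I then A k else setT) `&`
   (if k \in J then A' k else setT)); split.
- by move=> k; apply: measurableI; case: ifP.
- by move=> k; rewrite inE => /orP[/In|/Jn].
- apply/seteqP; split => w /=.
    move=> [wI wJ] k /=; rewrite inE => _; split.
      by case: ifP => // kI; exact: wI.
    by case: ifP => // kJ; exact: wJ.
  move=> wIJ; split => k /= kI.
    by have := wIJ k; rewrite /= inE kI => /(_ isT)[].
  by have := wIJ k; rewrite /= inE kI orbT => /(_ isT)[].
Qed.

Lemma cylinders_measurable : cylinders `<=` measurable.
Proof.
move=> _ [I [A [mA In ->]]]; apply: fin_bigcap_measurable => // k _.
by rewrite -[X in measurable X]setTI; exact: mZ.
Qed.

Lemma past_cylinders : past Z n `<=` <<s cylinders >>.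
Proof.
apply: sub_sigma_algebra2 => _ [k /= kn [A mA <-]].
exists [fset k]%fset, (fun=> A); split => //.
  by move=> k'; rewrite inE => /eqP ->.
by rewrite set_fset1 bigcap_set1 setTI.
Qed.

Lemma past_measure_unique (m1 m2 : {measure set Omega -> \bar R}) :
  m1 setT < +oo -> (forall B, cylinders B -> m1 B = m2 B) ->
  forall B, past Z n B -> m1 B = m2 B.
Proof.
move=> m1T m12 B /past_cylinders; move: B.
apply: finite_measure_unique => //; first exact: cylinders_setT.
  exact: cylinders_setI.
exact: cylinders_measurable.
Qed.

Lemma past_indep_finite (C : set Omega) : measurable C ->
  (forall B, cylinders B -> P (C `&` B) = P C * P B) ->
  forall B, past Z n B -> P (C `&` B) = P C * P B.
Proof.
move=> mC ind B /past_cylinders; move: B.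
apply: independent_generated => //; first exact: cylinders_setT.
  exact: cylinders_setI.
exact: cylinders_measurable.
Qed.

End finite_cylinders.

Section iid_past.
Context d (Omega : measurableType d) dG (G : measurableType dG) (R : realType).
Variables (P : probability Omega R) (beta : probability G R).
Variable V : int -> {RV P >-> G}.
Hypothesis iidV : iid beta V.

Let mV k A : measurable A -> measurable (V k @^-1` A).
Proof. by move=> mA; exact: measurable_funPTI. Qed.

Lemma iid_law n A : measurable A -> P (V n @^-1` A) = beta A.
Proof. by move=> mA; rewrite -(iidV.2 n A mA). Qed.

Lemma iid_past_indep n A B : measurable A -> past V n B ->
  P (V (n + 1)%R @^-1` A `&` B) = P (V (n + 1)%R @^-1` A) * P B.
Proof.
move=> mA; apply: past_indep_finite => //; first exact: mV.
move=> _ [I [C [mC In ->]]].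
have nI : (n + 1)%R \notin I.
  by apply/negP => /In; rewrite gerDl.
pose D k := if k == (n + 1)%R then A else C k.
have mD k : measurable (D k) by rewrite /D; case: ifP.
have := iidV.1 ((n + 1)%R |` I)%fset D mD.
rewrite big_fsetU1//= {2}/D eqxx.
have -> : \prod_(i <- I) P (V i @^-1` D i) = P (\bigcap_(k in [set` I]) (V k @^-1` C k)).
  rewrite iidV.1//; rewrite big_seq [RHS]big_seq; apply: eq_bigr => k kI.
  by rewrite /D; case: eqP => // kn; rewrite -kn kI in nI.
move=> <-; congr (P _); apply/seteqP; split => w /=.
  move=> [wA wI] k /=; rewrite !inE /D; case: eqP => [-> //|_ /= kI].
  exact: wI.
move=> wI; split.
  by have := wI (n + 1)%R; rewrite /= !inE eqxx /D eqxx; exact.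
move=> k /= kI; have := wI k; rewrite /= !inE kI orbT /D.
by case: eqP => [kn|_]; [rewrite -kn kI in nI|exact].
Qed.

End iid_past.

(** * One step of a random map, and accordability *)

Section one_step.
Context d (Omega : measurableType d) dS (S : measurableType dS)
  dG (G : measurableType dG) (R : realType).
Hypothesis cS : countable [set: S].
Hypothesis mS : forall A : set S, measurable A.
Variables (P : probability Omega R) (beta : probability G R).
Variable g : {mfun (S * G)%type >-> S}.

Let msec s A : measurable A -> measurable ((fun v => g (s, v)) @^-1` A : set G).
Proof.
move=> mA; rewrite -[X in measurable X]setTI.
exact: (measurableT_comp (measurable_funPT g) (pair1_measurable s)).
Qed.

(** Let v have law beta and be independent of the event B together with the
    discrete variable zeta. On B, the conditional law of g (zeta, v) given zeta is
    given by the kernel of the random map g. *)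
Lemma random_map_step (zeta : {mfun Omega >-> S}) (v : {mfun Omega >-> G})
    (B : set Omega) : measurable B ->
  (forall s C, measurable C -> P (v @^-1` C `&` (zeta @^-1` [set s] `&` B)) =
     beta C * P (zeta @^-1` [set s] `&` B)) ->
  forall A, P ((fun w => g (zeta w, v w)) @^-1` A `&` B) =
    \int[P]_(w in B) random_map_kernel beta g (zeta w) A.
Proof.
move=> mB ind A.
have [F [tF UF mF FE]] := countable_fibers cS mS (measurable_funPT zeta).
set X := _ @^-1` A.
have mX : measurable X.
  rewrite -[X in measurable X]setTI; apply: (measurableT_comp (measurable_funPT g)) => //.
  exact: measurable_fun_pair.
rewrite -[in LHS](setIT (X `&` B)) -UF setI_bigcupr measure_semi_bigcup//; last 3 first.
- by move=> n; apply: measurableI => //; exact: measurableI.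
- exact: trivIset_setIl.
- by apply: bigcup_measurable => n _; apply: measurableI => //; exact: measurableI.
rewrite -[in RHS](setIT B) -[in RHS]UF setI_bigcupr ge0_integral_bigcup//; last 3 first.
- by move=> n; exact: measurableI.
- apply: measurable_funTS.
  exact: (measurableT_comp (measurable_kernel (random_map_kernel beta g) A (mS A))).
- exact: trivIset_setIl.
apply: eq_eseriesr => n _.
have [->|[s Fs]] := FE n; first by rewrite !setI0 measure0 integral_set0.
rewrite Fs (eq_integral (cst (random_map_kernel beta g s A))); last first.
  by move=> w; rewrite inE => -[_ ->].
rewrite integral_cst; last by rewrite -Fs; exact: measurableI.
rewrite [in RHS]setIC -ind; last exact: msec.
congr (P _); apply/seteqP; split => [w [[Xw Bw] zw]|w [vw [zw Bw]]].
  by split => //; rewrite /= -zw.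
by split => //; split => //; rewrite /X/= zw.
Qed.

(** The state space being countable, an event about (zeta, v) is a countable union
    of events {zeta = s, v in A_s}, so it belongs to any sigma-algebra Q that
    contains the fibers of zeta and the events about v. *)
Lemma adapted_pair (Q : set (set Omega)) (zeta : Omega -> S) (v : Omega -> G) :
  sigma_algebra setT Q -> (forall s, Q (zeta @^-1` [set s])) ->
  (forall C, measurable C -> Q (v @^-1` C)) ->
  forall A, measurable A -> Q ((fun w => (zeta w, v w)) @^-1` A).
Proof.
move=> [Q0 QC QU] Qz Qv A mA.
have QC' B : Q B -> Q (~` B) by rewrite -setTD; exact: QC.
have QI B C : Q B -> Q C -> Q (B `&` C).
  move=> QB Qc; rewrite -[_ `&` _]setCK setCI; apply: (QC').
  rewrite -bigcup2E; apply: (QU) => -[|[|n]] //=; exact: QC'.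
have [F [_ UF _ FE]] := countable_fibers cS mS (@measurable_id _ S setT).
rewrite [X in Q X](_ : _ = \bigcup_n (zeta @^-1` F n `&`
   (fun w => (zeta w, v w)) @^-1` A)); last first.
  by rewrite -setI_bigcupl -preimage_bigcup UF preimage_setT setTI.
apply: QU => n; have [->|[s ->]] := FE n; first by rewrite preimage_set0 set0I.
rewrite [X in Q X](_ : _ = zeta @^-1` [set s] `&` v @^-1` ((pair s) @^-1` A)).
  apply: QI; [exact: Qz|apply: Qv].
  by rewrite -[X in measurable X]setTI; exact: (pair1_measurable s).
by apply/seteqP; split => w /= [zw]; rewrite zw.
Qed.

Lemma adapted_step (Q : set (set Omega)) (zeta : Omega -> S) (v : Omega -> G) :
  sigma_algebra setT Q -> (forall s, Q (zeta @^-1` [set s])) ->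
  (forall C, measurable C -> Q (v @^-1` C)) ->
  forall A, Q ((fun w => g (zeta w, v w)) @^-1` A).
Proof.
move=> sQ Qz Qv A; apply: (adapted_pair sQ Qz Qv (A := g @^-1` A)).
by rewrite -[X in measurable X]setTI; exact: measurable_funPT.
Qed.

(** The laws of a recursion driven by innovations independent of the past Q follow
    the kernel of the random map. *)
Lemma driven_law (Q : nat -> set (set Omega)) (W : nat -> {mfun Omega >-> S})
    (V : nat -> {mfun Omega >-> G}) :
  (forall j, Q j `<=` measurable) ->
  (forall j C B, measurable C -> Q j B ->
     P (V j.+1 @^-1` C `&` B) = beta C * P B) ->
  (forall j s, Q j (W j @^-1` [set s])) ->
  (forall j w, W j.+1 w = g (W j w, V j.+1 w)) ->
  forall j A, distribution P (W j.+1) A =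
    \int[distribution P (W j)]_z random_map_kernel beta g z A.
Proof.
move=> mQ ind QW WS j A.
rewrite ge0_integral_pushforward//.
rewrite preimage_setT -(@random_map_step (W j) (V j.+1) setT)//; last first.
  by move=> s C mC; rewrite setIT; apply: ind.
by rewrite setIT; congr (P _); apply/seteqP; split => w /=; rewrite WS.
Qed.

End one_step.

Section accordable_kernel.
Context (dE dG : measure_display) (E : measurableType dE) (G : measurableType dG)
  (R : realType).
Hypothesis cE : countable [set: E].
Hypothesis mE : forall A : set E, measurable A.
Variables (beta : probability G R) (f : {mfun (E * G)%type >-> E}).

Let cEE := countable_prod cE.
Let mEE := measurable_prod_discrete cE mE.

Definition diag (T : Type) : set (T * T) := [set u | u.1 = u.2].

Local Notation K2 := (Pi2_kernel beta f).

(** Two copies driven by the same independent innovations form a chain with kernel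
    Pi_2; in particular the probability in the definition of accordability does
    not depend on the realization of the innovations. *)
Lemma iid_coupling d (Omega : measurableType d) (P : probability Omega R)
    (V : int -> {RV P >-> G}) (x y : E) l : iid beta V ->
  P [set w | composed_maps f (V ^~ w) l x = composed_maps f (V ^~ w) l y] =
    kernel_iter K2 l (x, y) (@diag E).
Proof.
move=> iidV.
have mC j z : measurable_fun setT (fun w => composed_maps f (V ^~ w) j z).
  elim: j => [|j ih] /=; first exact: measurable_cst.
  apply: measurableT_comp => //; exact: measurable_fun_pair.
have mW j : measurable_fun setT (fun w =>
    (composed_maps f (V ^~ w) j x, composed_maps f (V ^~ w) j y)).
  exact: measurable_fun_pair.
pose W j : {mfun Omega >-> (E * E)%type} := mfun_Sub (mem_set (mW j)).
have WE j w : W j w = (composed_maps f (V ^~ w) j x, composed_maps f (V ^~ w) j y) by [].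
have WS j w : W j.+1 w = two_point_map f (W j w, V (Posz j.+1) w) by rewrite !WE.
have QW j A : past V (Posz j) (W j @^-1` A).
  elim: j A => [|j ih] A.
    have [Axy|Axy] := pselect (A (x, y)).
      have -> : W 0%N @^-1` A = setT by apply/seteqP; split.
      exact: past_setT.
    have -> : W 0%N @^-1` A = ~` setT by apply/seteqP; split => // w; rewrite setCT.
    by apply: past_setC; exact: past_setT.
  rewrite (_ : _ @^-1` _ = (fun w => two_point_map f (W j w, V (Posz j.+1) w)) @^-1` A)//.
  apply: (adapted_step cEE mEE (two_point_map f) (past_sigma V (Posz j.+1))).
    by move=> s; apply: past_le (ih [set s]); rewrite lez_nat.
  by move=> C mC'; exact: past_mem.
have lawS := driven_law cEE mEE (g := two_point_map f) (Q := fun j => past V (Posz j))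
  (V := fun j => V (Posz j)) (W := W) _ _ (fun j s => QW j [set s]) WS.
rewrite -[LHS]/(distribution P (W (0 + l)%N) (@diag E)).
rewrite (@law_evolution _ _ _ K2 (fun j => distribution P (W j)))//.
- rewrite ge0_integral_pushforward//=; last by move=> u _; exact: kernel_iter_ge0.
  rewrite preimage_setT (eq_integral (cst (kernel_iter K2 l (x, y) (@diag E))))//.
  rewrite integral_cst// -[RHS]mule1; congr (_ * _); exact: probability_setT.
- move=> j; apply: (le_lt_trans (probability_le1 (distribution P (W j)) measurableT)).
  by rewrite ltry.
- move=> j A _; apply: lawS.
  + by move=> i; apply: past_measurable => k.
  + move=> i C B mC' pB.
    by have := iid_past_indep iidV mC' pB; rewrite -PoszD addn1 => ->; rewrite (iid_law iidV).
Qed.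

(** Accordability in terms of the iterates of Pi_2 only, without any realization
    of the innovations. *)
Definition kernel_accordable x y :=
  exists2 l, (0 < l)%N & 0 < kernel_iter K2 l (x, y) (@diag E).

Lemma accordable_kernel x y : accordable beta f x y -> kernel_accordable x y.
Proof.
move=> [d [Om [P [V [l [iidV l0]]]]]]; rewrite (iid_coupling _ _ _ iidV) => Dl.
by exists l.
Qed.

End accordable_kernel.

(** * Absorption in an accessible set *)

Section absorbing.
Context d (S : measurableType d) (R : realType).
Hypothesis cS : countable [set: S].
Hypothesis mS : forall A : set S, measurable A.
Variables (K : R.-pker S ~> S) (D : set S).
Hypothesis absD : forall u, D u -> K u D = 1.

Let mf d' (T : measurableType d') (A : set S) (h : S -> T) : measurable_fun A h.
Proof. exact: measurable_discrete. Qed.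

Hint Extern 0 (measurable _) => exact: mS : core.
Hint Extern 0 (measurable_fun _ _) => exact: mf : core.

Let iter1 u A : kernel_iter K 1 u A = K u A.
Proof. exact: kernel_iter1. Qed.

Lemma absorbing_iter_le n m u : (n <= m)%N ->
  kernel_iter K n u D <= kernel_iter K m u D.
Proof.
move=> /subnK <-; elim: (m - n)%N => // k ih; rewrite (le_trans ih)// addSn.
rewrite -[(k + n).+1]addn1 (chapman_kolmogorov K (k + n) 1)// kernel_iterE.
apply: (@le_trans _ _ (\int[kiter K (k + n) u]_(z in D) kernel_iter K 1 z D)).
  rewrite (eq_integral (cst 1)); last by move=> z; rewrite inE iter1 => /absD.
  by rewrite integral_cst// mul1e.
by apply: ge0_subset_integral => // z _; exact: kernel_iter_ge0.
Qed.

Lemma absorbing_iter1 n u : D u -> kernel_iter K n u D = 1.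
Proof.
move=> Du; apply/eqP; rewrite eq_le kernel_iter_le1//=.
apply: le_trans (absorbing_iter_le u (leq0n n)).
by rewrite /= diracE mem_set.
Qed.

Hypothesis accD : forall u, exists l, 0 < kernel_iter K l u D.

Let splitD (mu : {measure set S -> \bar R}) l :
  \int[mu]_u kernel_iter K l u D =
  mu D + \int[mu]_(u in ~` D) kernel_iter K l u D.
Proof.
have k0 u : 0 <= kernel_iter K l u D by exact: kernel_iter_ge0.
rewrite -(setUv D) ge0_integral_setU//; last by apply/disj_setPS => z [].
congr (_ + _); rewrite (eq_integral (cst 1)); last first.
  by move=> z; rewrite inE => Dz; rewrite absorbing_iter1.
by rewrite integral_cst// mul1e.
Qed.

(** If D is absorbing and accessible from every state, then no invariant finite
    measure charges its complement: a charged point outside D would make the mass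
    of D increase. *)
Lemma invariant_absorbed (mu : {measure set S -> \bar R}) : mu setT < +oo ->
  (forall l, mu D = \int[mu]_u kernel_iter K l u D) -> mu (~` D) = 0.
Proof.
move=> muT muD.
have muf A : mu A \is a fin_num.
  rewrite ge0_fin_numE//; apply: le_lt_trans muT.
  by apply: le_measure; rewrite ?inE.
have mu1 z : ~ D z -> mu [set z] = 0.
  move=> Dz; have [l l0] := accD z.
  have I0 : \int[mu]_(u in ~` D) kernel_iter K l u D = 0.
    have := muD l; rewrite splitD => /eqP; rewrite addeC -[X in X == _]add0e.
    move=> /eqP h; rewrite -[LHS](addeK _ (muf D)) -h add0e subee//.
  have : \int[mu]_(u in [set z]) kernel_iter K l u D <= 0.
    rewrite -I0; apply: ge0_subset_integral => //; last by move=> u ->.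
    by move=> u _; exact: kernel_iter_ge0.
  rewrite (eq_integral (cst (kernel_iter K l z D))); last first.
    by move=> u; rewrite inE => ->.
  rewrite integral_cst//; apply: contraTeq => muz.
  by rewrite -ltNge mule_gt0// measure_gt0.
have [F [tF UF _ FE]] := countable_fibers cS mS (@measurable_id _ S setT).
rewrite -[X in mu X]setIT -UF setI_bigcupr measure_semi_bigcup//; last first.
  exact: trivIset_setIl.
apply: eseries0 => n _ _ /=; have [->|[z Fz]] := FE n; first by rewrite setI0.
have [Dz|Dz] := pselect (D z).
  rewrite (_ : _ `&` _ = set0) ?measure0//.
  by rewrite Fz; apply/seteqP; split => // u [Du zu]; apply: Du; rewrite zu.
apply: subset_measure0 (mu1 z Dz) => //; rewrite Fz; exact: subIsetr.
Qed.

Variable e : S -> nat.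
Hypothesis ie : injective e.

(** From finitely many points, the absorbing set D is reached at one common time
    with a probability bounded below. Common times exist because the probability
    to be in D is nondecreasing in time. *)
Lemma uniform_access N : exists l (p : R), (0 < p)%R /\
  forall u, (e u < N)%N -> p%:E <= kernel_iter K l u D.
Proof.
elim: N => [|N [l [p [p0 lp]]]]; first by exists 0%N, 1%R.
have [[z zN]|/forallNP nN] := pselect (exists z, e z = N); last first.
  exists l, p; split => // u; rewrite ltnS leq_eqVlt => /predU1P[uN|]; last exact: lp.
  by have := nN u.
have [m m0] := accD z.
have mfin : kernel_iter K m z D \is a fin_num.
  rewrite ge0_fin_numE ?kernel_iter_ge0// (le_lt_trans (kernel_iter_le1 _ _ _ _))//.
  by rewrite ltry.
exists (maxn l m), (Num.min p (fine (kernel_iter K m z D))); split.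
  by rewrite lt_min p0 -lte_fin fineK.
move=> u; rewrite ltnS leq_eqVlt EFin_min fineK// => /predU1P[uN|uN].
  have -> : u = z by apply: ie; rewrite zN.
  by rewrite ge_min absorbing_iter_le ?orbT// leq_maxr.
by rewrite ge_min (le_trans (lp u uN))// absorbing_iter_le// leq_maxl.
Qed.

(** If D is absorbing, accessible from every state, and if the laws lam j of the
    chain are tight, then the mass outside D tends to 0. *)
Lemma absorbed_in_the_limit (lam : nat -> {measure set S -> \bar R}) :
  (forall j, lam j setT = 1) ->
  (forall j A, lam j.+1 A = \int[lam j]_x K x A) ->
  (forall eps : R, (0 < eps)%R ->
     exists N, forall j, lam j [set u | (N <= e u)%N] <= eps%:E) ->
  (fun j => fine (lam j (~` D))) @ \oo --> (0 : R)%R.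
Proof.
move=> lam1 lamS tight.
have lamT j : lam j setT < +oo by rewrite lam1 ltry.
have lamf j A : lam j A \is a fin_num.
  rewrite ge0_fin_numE//; apply: le_lt_trans (lamT j).
  by apply: le_measure; rewrite ?inE.
pose b j := fine (lam j (~` D)).
have bE j : (b j)%:E = lam j (~` D) by rewrite fineK.
have bD j : lam j D = (1 - b j)%:E.
  have h : lam j D + lam j (~` D) = 1 by rewrite -measureU ?setICr// setUv; exact: lam1.
  by rewrite EFinB bE -h addeK.
have evol m i A : lam (i + m)%N A = \int[lam i]_x kernel_iter K m x A.
  by apply: law_evolution => // k B _; exact: lamS.
(* among the points outside D, those of index < N are absorbed within l steps
   with probability at least p *)
have b_step : forall j l N (p : R), (0 <= p)%R ->
    (forall u, (e u < N)%N -> p%:E <= kernel_iter K l u D) ->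
    (b (j + l)%N <= b j - p * (b j - fine (lam j [set u | (N <= e u)%N])))%R.
  move=> j l N p p0 pl.
  have : lam (j + l)%N D >= lam j D + p%:E * (lam j (~` D `&` [set u | (e u < N)%N])).
    rewrite (evol l j D) splitD; apply: leeD2l.
    apply: (@le_trans _ _ (\int[lam j]_(u in ~` D `&` [set u | (e u < N)%N]) kernel_iter K l u D)).
      rewrite -integral_cst//; apply: ge0_le_integral => //.
      by move=> u [_ /= uN]; exact: pl.
    by apply: ge0_subset_integral => // u _; exact: kernel_iter_ge0.
  rewrite !bD -[X in _ * X]fineK// -EFinM -EFinD lee_fin.
  set q := fine (lam j (_ `&` _)) => h.
  have : (b j <= q + fine (lam j [set u | (N <= e u)%N]))%R.
    rewrite -lee_fin EFinD bE !fineK//.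
    apply: le_trans (measureU2 _ _ _) => //.
    apply: le_measure; rewrite ?inE// => u Du.
    by have [Nu|uN] := leqP N (e u); [right|left].
  move=> h2.
  have h3 : (p * (b j - fine (lam j [set u | (N <= e u)%N])) <= p * q)%R.
    by rewrite ler_wpM2l// lerBlDr.
  by move: h h3; lra.
have b0 j : (0 <= b j)%R by rewrite fine_ge0.
have bnoninc : nonincreasing_seq b.
  apply/nonincreasing_seqP => j.
  have := @b_step j 1%N 0%N 0%R (lexx _) _; rewrite addn1 mul0r subr0; apply.
  by move=> u.
have /cvg_ex[L bL] : cvg (b @ \oo).
  by apply: nonincreasing_is_cvgn => //; exists 0%R => _ [j _ <-].
have L0 : (0 <= L)%R by apply: (cvgr_to_ge bL); exact: nearW.
suff -> : 0%R = L by [].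
apply/eqP; rewrite eq_le L0/=; apply/ler_addgt0Pl => eps eps0; rewrite addr0.
have [N tN] := tight _ eps0.
have [l [p [p0 pl]]] := uniform_access N.
have bl : (fun j => b (j + l)%N) @ \oo --> L by rewrite cvg_shiftn.
have br : (fun j => b j - p * (b j - eps))%R @ \oo --> (L - p * (L - eps))%R.
  apply: cvgB => //; apply: cvgM; first exact: cvg_cst.
  by apply: cvgB => //; exact: cvg_cst.
(* in the limit, the inequality b_step says that L <= eps *)
have : (L <= L - p * (L - eps))%R.
  apply: (ler_cvg_to bl br); apply: nearW => j.
  apply: (le_trans (b_step j l N p (ltW p0) pl)).
  rewrite lerD2l lerN2 ler_pM2l// lerD2l lerN2 -lee_fin fineK//.
by rewrite -subr_ge0 addrAC subrr sub0r oppr_ge0 pmulr_rle0// subr_le0.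
Qed.

End absorbing.

(** * Stationary two-point motions when all points are accordable *)

(** An enumeration of pairs deduced from an enumeration e of the points. *)
Definition pair_index (T : Type) (e : T -> nat) (u : T * T) : nat :=
  choice.pickle (e u.1, e u.2).

Lemma pair_index_inj (T : Type) (e : T -> nat) :
  injective e -> injective (pair_index e).
Proof.
move=> ie [a b] [a' b'] /(pcan_inj (@choice.pickleK _)) [ea eb].
by rewrite (ie _ _ ea) (ie _ _ eb).
Qed.

Lemma pair_index_bound (T : Type) (e : T -> nat) M : exists N, forall u : T * T,
  (N <= pair_index e u)%N -> (M <= e u.1)%N \/ (M <= e u.2)%N.
Proof.
pose N := (\max_(i < M) \max_(j < M) choice.pickle (i : nat, j : nat)).+1.
exists N => u Nu.
have [?|u1] := leqP M (e u.1); first by left.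
have [?|u2] := leqP M (e u.2); first by right.
exfalso; move: Nu; rewrite /N ltnNge => /negP; apply.
apply: (leq_trans _ (leq_bigmax (Ordinal u1))).
exact: (leq_trans _ (leq_bigmax (Ordinal u2))).
Qed.

Section laws.
Context d (Omega : measurableType d) dS (S : measurableType dS) (R : realType).
Variables (P : probability Omega R) (Z : int -> {RV P >-> S}).

Lemma stationary_law (n : int) A : stationary Z -> measurable A ->
  distribution P (Z n) A = distribution P (Z 0%R) A.
Proof.
move=> /(_ n [fset 0%R]%fset (fun=> A) (fun=> _)) + mA => /(_ (fun=> mA)).
by rewrite set_fset1 !bigcap_set1 add0r.
Qed.

Lemma markov_law (K : R.-pker S ~> S) (n : int) A : markov_chain K Z -> measurable A ->
  distribution P (Z (n + 1)%R) A = \int[distribution P (Z n)]_z K z A.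
Proof.
move=> mZ mA; have pT : past (fun k => Z k) n setT by exact: past_setT.
have := mZ n A setT mA pT; rewrite setIT => ZA.
rewrite ge0_integral_pushforward//.
exact: measurable_kernel.
Qed.

End laws.

Section two_points.
Context (dE dG : measure_display) (E : measurableType dE) (G : measurableType dG)
  (R : realType).
Hypothesis cE : countable [set: E].
Hypothesis mE : forall A : set E, measurable A.
Variables (beta : probability G R) (f : {mfun (E * G)%type >-> E}).

Let cEE := countable_prod cE.
Let mEE := measurable_prod_discrete cE mE.

Local Notation K1 := (Pi_kernel beta f).
Local Notation K2 := (Pi2_kernel beta f).
Local Notation D := (@diag E).

Lemma diag_absorbing u : D u -> K2 u D = 1.
Proof.
move=> Du; rewrite -(@probability_setT _ _ _ beta); congr (beta _).
apply/seteqP; split => // v _ /=.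
by rewrite /diag/= /map_section /two_point_map/= Du.
Qed.

Let msec x : measurable_fun setT (fun v : G => f (x, v)).
Proof. exact: (measurableT_comp (measurable_funPT f) (pair1_measurable x)). Qed.

Lemma integral_K1 x (h : E -> \bar R) : (forall z, 0 <= h z) ->
  \int[K1 x]_z h z = \int[beta]_v h (f (x, v)).
Proof.
by move=> h0; rewrite /Pi_kernel/= /random_map_kernel ge0_integral_pushforward//.
Qed.

Lemma integral_K2 u (h : E * E -> \bar R) : (forall z, 0 <= h z) ->
  \int[K2 u]_z h z = \int[beta]_v h (f (u.1, v), f (u.2, v)).
Proof.
by move=> h0; rewrite /Pi2_kernel/= /random_map_kernel ge0_integral_pushforward//.
Qed.

Lemma marginal1 n u A : kernel_iter K2 n u (fst @^-1` A) = kernel_iter K1 n u.1 A.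
Proof.
elim: n u => [|n ih] u; first by rewrite /= !diracE; congr (_%:R%:E).
rewrite [LHS]integral_K2; last by move=> z; exact: kernel_iter_ge0.
rewrite [RHS]integral_K1; last by move=> z; exact: kernel_iter_ge0.
by apply: eq_integral => v _; exact: ih.
Qed.

Lemma marginal2 n u A : kernel_iter K2 n u (snd @^-1` A) = kernel_iter K1 n u.2 A.
Proof.
elim: n u => [|n ih] u; first by rewrite /= !diracE; congr (_%:R%:E).
rewrite [LHS]integral_K2; last by move=> z; exact: kernel_iter_ge0.
rewrite [RHS]integral_K1; last by move=> z; exact: kernel_iter_ge0.
by apply: eq_integral => v _; exact: ih.
Qed.

Hypothesis acc : forall x y, kernel_accordable beta f x y.

Let accD (u : E * E) : exists l, 0 < kernel_iter K2 l u D.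
Proof. by case: u => x y; have [l _ l0] := acc x y; exists l. Qed.

(** The common law of the Z n is invariant under Pi_2, hence carried by the
    absorbing and accessible diagonal. *)
Lemma accordable_stationary_Pi2_diagonal : stationary_Pi2_chains_diagonal beta f.
Proof.
move=> d Om P Z mZ sZ.
have lawS j A : distribution P (Z (Posz j.+1)) A =
    \int[distribution P (Z (Posz j))]_z K2 z A.
  by rewrite -(markov_law (Posz j) mZ)// -PoszD addn1.
have law0 n A : distribution P (Z n) A = distribution P (Z 0%R) A.
  exact: stationary_law.
have PD n : P (Z n @^-1` (~` D)) = 0.
  rewrite -[LHS]/(distribution P (Z n) (~` D)) law0.
  apply: (invariant_absorbed cEE mEE diag_absorbing accD).
    by apply: (le_lt_trans (probability_le1 _ measurableT)); rewrite ltry.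
  move=> l; refine (etrans (esym (law0 (Posz (0 + l)) D)) _).
  apply: (law_evolution (lam := fun j => distribution P (Z (Posz j)))) => //.
  by move=> j; apply: (le_lt_trans (probability_le1 _ measurableT)); rewrite ltry.
by move=> j A _; exact: lawS.
have aen n : {ae P, forall w, (Z n w).1 = (Z n w).2}.
  exists (Z n @^-1` (~` D)); split => //.
  by rewrite -[X in measurable X]setTI; exact: measurable_funPT.
have ae1 := ae_foralln (fun n : nat => aen (Posz n)).
have ae2 := ae_foralln (fun n : nat => aen (Negz n)).
by apply: filterS2 ae1 ae2 => w h1 h2 [n|n].
Qed.

End two_points.

(** * Coupling from the past *)

Section completed.
Context d (Omega : measurableType d) (R : realType) (P : probability Omega R)
  dS (S : measurableType dS).
Implicit Types Z : int -> Omega -> S.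

Let csigma Z n : sigma_algebra setT (completed_past P Z n).
Proof. exact: smallest_sigma_algebra. Qed.

Lemma completed_past_setC Z n A : completed_past P Z n A -> completed_past P Z n (~` A).
Proof. by have [_ pC _] := csigma Z n; rewrite -setTD; exact: pC. Qed.

Lemma completed_past_setU Z n A B : completed_past P Z n A ->
  completed_past P Z n B -> completed_past P Z n (A `|` B).
Proof.
have [p0 _ pU] := csigma Z n => pA pB; rewrite -bigcup2E.
by apply: pU => -[|[|k]].
Qed.

Lemma completed_past_setI Z n A B : completed_past P Z n A ->
  completed_past P Z n B -> completed_past P Z n (A `&` B).
Proof.
move=> pA pB; rewrite -[_ `&` _]setCK setCI; apply: completed_past_setC.
by apply: completed_past_setU; exact: completed_past_setC.
Qed.

Lemma past_completed_past Z n A : past Z n A -> completed_past P Z n A.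
Proof. by move=> pA; apply: sub_sigma_algebra; left. Qed.

Lemma negligible_completed_past Z n A : P.-negligible A -> completed_past P Z n A.
Proof. by move=> pA; apply: sub_sigma_algebra; right. Qed.

Lemma completed_past_le Z (n m : int) : (n <= m)%R ->
  completed_past P Z n `<=` completed_past P Z m.
Proof.
move=> nm; apply: sub_sigma_algebra2 => A [pA|nA]; [left|by right].
exact: past_le nm _ pA.
Qed.

(** An event equal to an event of the past outside a null set belongs to the
    completed past. *)
Lemma completed_past_modN Z n A B N : past Z n B -> measurable N -> P N = 0 ->
  A `&` ~` N = B `&` ~` N -> completed_past P Z n A.
Proof.
move=> pB mN N0 AB.
have nN C : C `<=` N -> P.-negligible C by move=> CN; exists N.
rewrite (_ : A = (B `&` ~` N) `|` (A `&` N)).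
  apply: completed_past_setU.
    apply: completed_past_setI; first exact: past_completed_past.
    apply: completed_past_setC; apply: negligible_completed_past; exact: nN.
  by apply: negligible_completed_past; apply: nN; exact: subIsetr.
by rewrite -AB -setIUr setUC setUv setIT.
Qed.

End completed.

(** The position at time s + j of the path started at time s from the state x and
    driven by v. *)
Fixpoint run (E G : Type) (f : (E * G)%type -> E) (v : int -> G) (s : int) (x : E)
    (j : nat) : E :=
  if j is i.+1 then f (run f v s x i, v (s + Posz i + 1)%R) else x.

Section coupling_from_the_past.
Context (dE dG : measure_display) (E : measurableType dE) (G : measurableType dG)
  (R : realType).
Hypothesis cE : countable [set: E].
Hypothesis mE : forall A : set E, measurable A.
Variables (beta : probability G R) (f : {mfun (E * G)%type >-> E}).

Let cEE := countable_prod cE.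
Let mEE := measurable_prod_discrete cE mE.

Local Notation K1 := (Pi_kernel beta f).
Local Notation K2 := (Pi2_kernel beta f).
Local Notation D := (@diag E).

Context d (Omega : measurableType d) (P : probability Omega R)
  (V : int -> {RV P >-> G}) (X : int -> {RV P >-> E}).
Hypotheses (iidV : iid beta V) (govX : governed f V X) (sX : stationary X).

(* joint process of the states and of the innovations *)
Let XV k w := (X k w, V k w).

Let mXV k : measurable_fun setT (XV k).
Proof. exact: measurable_fun_pair. Qed.

Lemma innovation_indep n C B : measurable C -> past XV n B ->
  P (V (n + 1)%R @^-1` C `&` B) = beta C * P B.
Proof. by move=> mC pB; rewrite govX.2// (iid_law iidV). Qed.

Variable z : E.

(* path started from z at time s, compared with the stationary chain X *)
Let Y s j w := run f (V ^~ w) s z j.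

Let Y_past s j A : past V (s + Posz j)%R (Y s j @^-1` A).
Proof.
elim: j A => [|j ih] A.
  have [Az|Az] := pselect (A z).
    have -> : Y s 0 @^-1` A = setT by apply/seteqP; split.
    exact: past_setT.
  have -> : Y s 0 @^-1` A = ~` setT by apply/seteqP; split => // w; rewrite setCT.
  by apply: past_setC; exact: past_setT.
have -> : (s + Posz j.+1 = s + Posz j + 1)%R by rewrite -addn1 PoszD addrA.
apply: (adapted_step cE mE f (past_sigma V (s + Posz j + 1))).
  by move=> x; apply: past_le (ih [set x]); rewrite lerDl.
by move=> C mC; exact: past_mem.
Qed.

Let mY s j : measurable_fun setT (Y s j).
Proof.
move=> _ A mA; rewrite setTI; have mV k : measurable_fun setT (V k) by [].
exact: (past_measurable mV (@Y_past s j A)).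
Qed.

Let mW s j : measurable_fun setT (fun w => (Y s j w, X (s + Posz j)%R w)).
Proof. exact: measurable_fun_pair. Qed.

Let W s j : {mfun Omega >-> (E * E)%type} := mfun_Sub (mem_set (mW s j)).

Let lawW s j A : distribution P (W s j.+1) A = \int[distribution P (W s j)]_u K2 u A.
Proof.
apply: (driven_law cEE mEE (g := two_point_map f)
  (Q := fun j => past XV (s + Posz j)%R) (V := fun j => V (s + Posz j)%R)).
- by move=> i; exact: past_measurable.
- move=> i C B mC pB; have := innovation_indep mC pB.
  by rewrite -addrA -PoszD addn1.
- move=> i [a b]; rewrite (_ : _ @^-1` _ = Y s i @^-1` [set a] `&` X (s + Posz i)%R @^-1` [set b]).
    apply: past_setI.
      exact: (past_comp (Z := XV) (h := snd) measurable_snd) (@Y_past s i _).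
    exact: (past_comp (Z := XV) (h := fst) measurable_fst) (past_mem (lexx _) (mE _)).
  by apply/seteqP; split => w /=; [move=> [-> ->]|move=> [-> ->]].
- move=> i w; rewrite /= /two_point_map/=.
  have -> : (s + Posz i.+1 = s + Posz i + 1)%R by rewrite -addn1 PoszD addrA.
  by rewrite govX.1.
Qed.

Hypothesis acc : forall x y, kernel_accordable beta f x y.
Hypothesis recK1 : positive_recurrent K1.

Let accD (u : E * E) : exists l, 0 < kernel_iter K2 l u D.
Proof. by case: u => x y; have [l _ l0] := acc x y; exists l. Qed.

(* law of the pair (path, chain) after j steps; the starting time is irrelevant *)
Let lam j := distribution P (W 0%R j).

Let lamT (s : int) j : distribution P (W s j) setT < +oo.
Proof. by apply: (le_lt_trans (probability_le1 _ measurableT)); rewrite ltry. Qed.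

Let lawW_iter s j A : distribution P (W s j) A =
  \int[distribution P (W s 0)]_u kernel_iter K2 j u A.
Proof.
apply: (law_evolution (K := K2) (lam := fun j => distribution P (W s j)) (@lamT s) _ j 0%N (mEE A)).
by move=> i B _; exact: lawW.
Qed.

Let lawW_shift s j A : distribution P (W s j) A = lam j A.
Proof.
have law0 B : distribution P (W s 0) B = distribution P (W 0%R 0) B.
  rewrite -[LHS]/(distribution P (X (s + 0)%R) ((fun b => (z, b)) @^-1` B)).
  by rewrite stationary_law// -[LHS](@stationary_law _ _ _ _ _ P X (0 + 0)%R).
rewrite /lam (lawW_iter s) (lawW_iter 0%R).
by apply: eq_measure_integral => B _ _; exact: law0.
Qed.

(* the first marginal is the law of the chain started at z, the second one is
   constant in time *)
Let tight_law : exists e : E * E -> nat, injective e /\ forall eps : R, (0 < eps)%R ->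
  exists N, forall j, lam j [set u | (N <= e u)%N] <= eps%:E.
Proof.
have [e ie] := countable_index cE.
exists (pair_index e); split; first exact: pair_index_inj.
move=> eps eps0.
have e2 : (0 < eps / 2)%R by rewrite divr_gt0.
have [rz mz] := recK1 z.
have [M1 tM1] := positive_recurrent_tight mE ie rz mz e2.
have [M2 tM2] : exists M, P (X 0%R @^-1` [set b | (M <= e b)%N]) <= (eps / 2)%:E.
  pose A M := X 0%R @^-1` [set b | (M <= e b)%N].
  have A0 : (fun M => P (A M)) @ \oo --> 0.
    have I0 : \bigcap_M A M = set0.
      by apply/seteqP; split => // w Aw; have := Aw (e (X 0%R w)).+1 I; rewrite /A/= ltnn.
    have mA M : measurable (A M).
      by rewrite -[X in measurable X]setTI; exact: measurable_funPT.
    rewrite -(measure0 P) -I0; apply: nonincreasing_cvg_mu => //.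
    - by apply: (le_lt_trans (probability_le1 _ (mA _))); rewrite ltry.
    - by rewrite I0.
    - by move=> n m nm; apply/subsetPset => w /=; exact: leq_trans.
  have e2' : 0 < (eps / 2)%:E by rewrite lte_fin.
  have [M _ hM] := ereal_cvg_lt A0 e2'.
  by exists M; apply/ltW/hM => /=.
have [N NM] := pair_index_bound e (maxn M1 M2).
exists N => j.
apply: (@le_trans _ _ (lam j (fst @^-1` [set a | (M1 <= e a)%N] `|`
                              snd @^-1` [set b | (M2 <= e b)%N]))).
  apply: le_measure; rewrite ?inE// => u /NM [|] h; [left|right].
    by apply: leq_trans h; exact: leq_maxl.
  by apply: leq_trans h; exact: leq_maxr.
apply: le_trans (measureU2 _ _ _) _ => //.
rewrite (splitr eps) EFinD; apply: leeD.
  rewrite -[leLHS]/(distribution P (W 0%R j) (fst @^-1` [set a | (M1 <= e a)%N])) lawW_iter.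
  rewrite ge0_integral_pushforward//; last by move=> u _; exact: kernel_iter_ge0.
  rewrite (eq_integral (cst (kernel_iter K1 j z [set a | (M1 <= e a)%N]))); last first.
    by move=> w _; rewrite /= marginal1.
  rewrite preimage_setT integral_cst; last exact: measurableT.
  apply: (le_trans _ (tM1 j)); rewrite -[leRHS]mule1; apply: lee_wpmul2l.
    exact: kernel_iter_ge0.
  exact: probability_le1.
rewrite -[leLHS]/(distribution P (X (0 + Posz j)%R) [set b | (M2 <= e b)%N]).
by rewrite stationary_law//; exact: tM2.
Qed.

(** X k is almost surely the limit of the paths started from z at remote times,
    which are functions of the past of V. The path started m i steps before k
    misses X k with probability at most 1 / 2 ^ (i + 1), and the lemma of
    Borel-Cantelli applies. *)
Lemma coupled_from_the_past k C : completed_past P V k (X k @^-1` C).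
Proof.
have [e [ie tight]] := tight_law.
have lam1 j : lam j setT = 1 by exact: probability_setT.
have lim0 := absorbed_in_the_limit mEE (@diag_absorbing _ _ _ _ _ beta f) accD ie
  lam1 (fun j A => lawW 0%R j A) tight.
have /choice[m hm] : forall i, exists m, lam m (~` D) <= (1 / (2 ^ i.+1)%:R)%:E.
  move=> i; have e0 : (0 < 1 / (2 ^ i.+1)%:R :> R)%R.
    by rewrite divr_gt0// ltr0n expn_gt0.
  have /cvgr_lt /(_ _ e0)[M _ hM] := lim0.
  exists M; rewrite -[leLHS]fineK; first by rewrite lee_fin ltW// hM/=.
  by rewrite ge0_fin_numE// (le_lt_trans _ (lamT 0%R M))//; apply: le_measure; rewrite ?inE.
have kE i : (k - Posz (m i) + Posz (m i) = k)%R by rewrite subrK.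
pose Yi i := Y (k - Posz (m i))%R (m i).
pose Bad i := W (k - Posz (m i))%R (m i) @^-1` (~` D).
have mBad i : measurable (Bad i).
  by rewrite -[X in measurable X]setTI; exact: measurable_funPT.
have BadE i w : ~ Bad i w -> Yi i w = X k w.
  move=> /contrapT; rewrite /D/= /diag/= -/(Yi i w).
  by rewrite kE.
pose N := lim_sup_set Bad.
have N0 : P N = 0.
  apply: lim_sup_set_cvg0 => //.
  apply: (@le_lt_trans _ _ 1%:E); last by rewrite ltry.
  apply: le_trans (@epsilon_trick0 R 1%R xpredT ler01).
  by apply: lee_nneseries => // i _; rewrite -[leLHS]/(distribution P (W _ _) _) lawW_shift.
have mN : measurable N.
  apply: bigcapT_measurable => n; exact: bigcup_measurable.
(* outside the null set N, the event X k in C is the limit of the events Yi i in C *)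
pose A' := \bigcup_n \bigcap_i (Yi (n + i)%N @^-1` C).
apply: (@completed_past_modN _ _ _ P _ _ _ k _ A' N) => //.
  apply: past_bigcup => n; apply: past_bigcap => i.
  by have := @Y_past (k - Posz (m (n + i)%N))%R (m (n + i)%N) C; rewrite kE.
apply/seteqP; split => w [wC wN]; split => //.
- have [n hn] : exists n, forall j, (n <= j)%N -> ~ Bad j w.
    move: wN; rewrite /N /lim_sup_set => /existsNP[n] /not_implyP[_ nB].
    by exists n => j nj Bj; apply: nB; exists j.
  exists n => // i _; rewrite /= BadE//; apply: hn; exact: leq_addr.
- have [n _ wn] := wC.
  have [p hp] : exists n, forall j, (n <= j)%N -> ~ Bad j w.
    move: wN; rewrite /N /lim_sup_set => /existsNP[p] /not_implyP[_ nB].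
    by exists p => j nj Bj; apply: nB; exists j.
  have := wn p I; rewrite /= BadE//; apply: hp; exact: leq_addl.
Qed.

End coupling_from_the_past.

Section adapted.
Context (dE dG : measure_display) (E : measurableType dE) (G : measurableType dG)
  (R : realType).
Hypothesis cE : countable [set: E].
Hypothesis mE : forall A : set E, measurable A.
Variables (beta : probability G R) (f : {mfun (E * G)%type >-> E}).

Lemma accordable_stationary_adapted :
  (forall x y, kernel_accordable beta f x y) ->
  positive_recurrent (Pi_kernel beta f) ->
  stationary_chains_adapted_to_innovations beta f.
Proof.
move=> acc rec d Om P V X iidV govX sX n.
(* a sample space is nonempty, hence so is E *)
have z : E := X 0%R point.
apply: smallest_sub; first exact: smallest_sigma_algebra.
move=> A [|nA]; last exact: negligible_completed_past.
move: A; apply: smallest_sub; first exact: smallest_sigma_algebra.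
move=> _ [k /= kn [C mC <-]]; rewrite setTI.
apply: completed_past_le kn _ _.
exact: (coupled_from_the_past cE mE iidV govX sX z acc rec).
Qed.

End adapted.

(** * Time reversal of a random map *)

Section kernel_via.
Context d dS d' (X : measurableType d) (S : measurableType dS)
  (T : measurableType d') (R : realType).
Variables (h : X -> S) (m : S -> probability T R).

(** The kernel x |-> m (h x), where h is a measurable function with values in a
    discrete space. The measurability proofs are arguments of the definition so
    that kernel structures can be attached to it. *)
Definition kernel_via (mS : forall A : set S, measurable A)
  (mh : measurable_fun setT h) (x : X) : {measure set T -> \bar R} := m (h x).

Variables (mS : forall A : set S, measurable A) (mh : measurable_fun setT h).

Let measurable_kernel_via A : measurable A ->
  measurable_fun setT (kernel_via mS mh ^~ A).
Proof.
move=> mA; rewrite /kernel_via.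
have mm : measurable_fun setT (fun s => m s A) by exact: measurable_discrete.
exact: (measurableT_comp mm mh).
Qed.

HB.instance Definition _ := isKernel.Build _ _ _ _ _ (kernel_via mS mh)
  measurable_kernel_via.

Let kernel_via_prob x : kernel_via mS mh x setT = 1.
Proof. exact: probability_setT. Qed.

HB.instance Definition _ := Kernel_isProbability.Build _ _ _ _ _
  (kernel_via mS mh) kernel_via_prob.

End kernel_via.

Section reversal.
Context dS dG (S : measurableType dS) (G : measurableType dG) (R : realType).
Hypothesis cS : countable [set: S].
Hypothesis mS : forall A : set S, measurable A.
Variables (beta : probability G R) (g : {mfun (S * G)%type >-> S}).
Variable nu : probability S R.
Hypothesis nu_inv : forall A, nu A = \int[nu]_z random_map_kernel beta g z A.

Let mg A : measurable (g @^-1` A).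
Proof. by rewrite -[X in measurable X]setTI; exact: measurable_funPT. Qed.

Local Notation mu := (nu \x beta).

(** If Z has the invariant law nu and V is an independent innovation, then g (Z, V)
    has law nu. *)
Lemma law_one_step A : mu (g @^-1` A) = nu A.
Proof.
rewrite nu_inv /product_measure1; apply: eq_integral => z _ /=.
rewrite /random_map_kernel /distribution /pushforward /=; congr (beta _).
by apply/seteqP; split => v /=; rewrite /xsection/= inE.
Qed.

(** The conditional law of (Z, V) given g (Z, V) = z, when Z has law nu and V is an
    independent innovation. If nu does not charge z, it is the unconditional law. *)
Definition reversal (z : S) : probability (S * G)%type R :=
  mnormalize (mrestr mu (mg [set z])) mu.

Lemma reversalE z C : measurable C ->
  reversal z C * nu [set z] = mu (C `&` g @^-1` [set z]).
Proof.
move=> mC.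
have muE : mrestr mu (mg [set z]) setT = nu [set z].
  by rewrite /mrestr setTI law_one_step.
have nufin : nu [set z] \is a fin_num by rewrite fin_num_measure.
have -> : reversal z C = (if (nu [set z] == 0) || (nu [set z] == +oo)
    then fun U => mu U
    else fun U => mrestr mu (mg [set z]) U * (fine (nu [set z]))^-1%:E) C.
  by rewrite -muE.
have [nz0|nz0] := eqVneq (nu [set z]) 0.
  rewrite nz0 mule0; apply/esym; apply: (@subset_measure0 _ _ _ _ _ (g @^-1` [set z])) => //.
    exact: measurableI.
  exact: (etrans (law_one_step [set z]) nz0).
have nzy : nu [set z] != +oo by rewrite lt_eqF// -ge0_fin_numE.
rewrite (negbTE nzy)/= /mrestr -muleA -[X in _ * (_ * X)]fineK// -EFinM mulVf ?mule1//.
by rewrite fine_eq0.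
Qed.

Definition reversal_kernel : R.-pker S ~> (S * G)%type :=
  kernel_via reversal mS (@measurable_id _ S setT).

(** Drawing z with law nu, then (Z, V) from the reversal at z, gives the law of
    (Z, V): nu is invariant, so nu is the law of g (Z, V). *)
Lemma reversal_mixture C : measurable C -> \int[nu]_z reversal z C = mu C.
Proof.
move=> mC.
have [F [tF UF mF FE]] := countable_fibers cS mS (@measurable_id _ S setT).
rewrite -[X in \int[nu]_(z in X) _]UF ge0_integral_bigcup//.
rewrite -[in RHS](setIT C) -(preimage_setT g) -UF preimage_bigcup setI_bigcupr.
rewrite measure_semi_bigcup//; last 3 first.
- by move=> n; exact: measurableI.
- apply: trivIset_setIl; apply/trivIsetP => i j _ _ ij; rewrite -preimage_setI.
  by move/trivIsetP : tF => /(_ _ _ I I ij) ->; rewrite preimage_set0.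
- by apply: bigcup_measurable => n _; exact: measurableI.
apply: eq_eseriesr => n _; have [->|[s ->]] := FE n.
  by rewrite integral_set0 preimage_set0 setI0 measure0.
rewrite (eq_integral (cst (reversal s C))); last first.
  by move=> z; rewrite inE => ->.
by rewrite integral_cst// reversalE.
Qed.

End reversal.

(** * The law of a two-sided trajectory *)

Section backward_kernel.
Context dS dG (S : measurableType dS) (G : measurableType dG) (R : realType).

Local Notation W := ((S * G) * G)%type.

(** A two-sided trajectory is coded by a sequence with values in (S * G) * G. The
    term of index k >= 1 is ((Z_{-k}, V_{1-k}), V_k); the term of index 0 carries
    no information. state k is then Z_{-k}. *)
Definition state k (w : traj W) : S := (w k).1.1.

Lemma measurable_state k : measurable_fun setT (state k).
Proof.
have mf : measurable_fun setT (fun u : W => u.1.1).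
  exact: (measurableT_comp measurable_fst measurable_fst).
exact: (measurableT_comp mf (measurable_coord k)).
Qed.

Variable mS : forall A : set S, measurable A.
Variables (beta : probability G R) (g : {mfun (S * G)%type >-> S}).
Variable nu : probability S R.

(** Law of ((Z_{-1}, V_0), V_1): independent variables of laws nu, beta and beta. *)
Definition first_law (_ : S) : probability W R := (nu \x beta) \x beta.

(** Law of ((Z_{-k-1}, V_{-k}), V_{k+1}) given Z_{-k} = z. *)
Definition step_law (z : S) : probability W R := reversal mS beta g nu z \x beta.

Definition backward_kernel (k : nat) : R.-pker (traj W) ~> W :=
  if k is k'.+1 then kernel_via step_law mS (measurable_state k)
  else kernel_via first_law mS (measurable_state k).

End backward_kernel.

Section two_sided_chain.
Context dS dG (S : measurableType dS) (G : measurableType dG) (R : realType).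
Hypothesis cS : countable [set: S].
Hypothesis mS : forall A : set S, measurable A.
Variables (beta : probability G R) (g : {mfun (S * G)%type >-> S}).
Variable nu : probability S R.
Hypothesis nu_inv : forall A, nu A = \int[nu]_z random_map_kernel beta g z A.

Local Notation W := ((S * G) * G)%type.
Local Notation mu := (nu \x beta).
Local Notation rev := (reversal mS beta g nu).
Local Notation K := (backward_kernel mS beta g nu).

Let m1 A : measurable A -> measurable_fun setT (fun v : G => (\1_A v)%:E : \bar R).
Proof. by move=> mA; exact/measurable_EFinP. Qed.

Let mh d' (T : measurableType d') (h : S -> T) D : measurable_fun D h.
Proof. exact: measurable_discrete. Qed.

Let mhfst (h : S -> \bar R) : measurable_fun setT (fun p : S * G => h p.1).
Proof.
have mhh : measurable_fun setT h by exact: mh.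
exact: (measurableT_comp mhh measurable_fst).
Qed.

Let mAsnd (A : set G) : measurable A ->
  measurable_fun setT (fun p : S * G => (\1_A p.2)%:E : \bar R).
Proof. by move=> mA; exact: (measurableT_comp (m1 mA) measurable_snd). Qed.

Let mCsnd (C : set G) : measurable C ->
  measurable_fun setT (fun p : W => (\1_C p.2)%:E : \bar R).
Proof. by move=> mC; exact: (measurableT_comp (m1 mC) measurable_snd). Qed.

Lemma integral_rect1 (rho : probability (S * G)%type R) (h : S -> \bar R)
    (A C : set G) : (forall z, 0 <= h z) -> measurable A -> measurable C ->
  \int[rho \x beta]_u (h u.1.1 * ((\1_A u.1.2)%:E * (\1_C u.2)%:E)) =
  (\int[rho]_p (h p.1 * (\1_A p.2)%:E)) * beta C.
Proof.
move=> h0 mA mC.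
have mp : measurable_fun setT (fun p : S * G => h p.1 * (\1_A p.2)%:E).
  apply: emeasurable_funM.
    exact: mhfst.
  exact: mAsnd.
have p0 (p : S * G) : 0 <= h p.1 * (\1_A p.2)%:E by rewrite mule_ge0// lee_fin.
under eq_integral do rewrite muleA.
rewrite fubini_tonelli1//; last 2 first.
- apply: emeasurable_funM; first exact: (measurableT_comp mp measurable_fst).
  exact: mCsnd.
- by move=> u; rewrite mule_ge0// lee_fin.
rewrite -ge0_integralZr//; apply: eq_integral => p _.
rewrite /fubini_F/= ge0_integralZl//; last exact: m1.
by rewrite integral_indic// setIT.
Qed.

Lemma integral_rect2 (h : S -> \bar R) (A : set G) : (forall z, 0 <= h z) ->
  measurable A ->
  \int[mu]_p (h p.1 * (\1_A p.2)%:E) = (\int[nu]_z h z) * beta A.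
Proof.
move=> h0 mA; rewrite fubini_tonelli1//; last 2 first.
- apply: emeasurable_funM; first exact: mhfst.
  exact: mAsnd.
- by move=> u; rewrite mule_ge0// lee_fin.
rewrite -ge0_integralZr//; apply: eq_integral => z _.
rewrite /fubini_F/= ge0_integralZl//; last exact: m1.
by rewrite integral_indic// setIT.
Qed.

Variables (w0 : traj W).

Section rectangles.
Variables A C : nat -> set G.
Hypotheses (mA : forall i, measurable (A i)) (mC : forall i, measurable (C i)).

(** Indicator of the event that V_{-i} is in A i and V_{i+1} is in C i for all i < m. *)
Definition rect m (w : traj W) : \bar R :=
  \prod_(i < m) ((\1_(A i) (w i.+1).1.2)%:E * (\1_(C i) (w i.+1).2)%:E).

Lemma rect_ge0 m w : 0 <= rect m w.
Proof. by apply: prode_ge0 => i _; rewrite mule_ge0// lee_fin. Qed.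

Lemma tstep_rect m (h : S -> \bar R) w : (forall z, 0 <= h z) ->
  tstep K m (fun w => h (state m.+1 w) * rect m.+1 w) w =
  rect m w * \int[K m w]_u (h u.1.1 * ((\1_(A m) u.1.2)%:E * (\1_(C m) u.2)%:E)).
Proof.
move=> h0; rewrite -ge0_integralZl//; last 3 first.
- apply: emeasurable_funM; first exact: (measurableT_comp (mhfst h) measurable_fst).
  apply: emeasurable_funM; first exact: (measurableT_comp (mAsnd (mA m)) measurable_fst).
  exact: mCsnd.
- by move=> u _; rewrite !mule_ge0// lee_fin.
- exact: rect_ge0.
apply: eq_integral => u _; rewrite /state /upd ltnn /rect big_ord_recr/= ltnn.
rewrite [LHS]muleCA; congr (_ * _).
by apply: eq_bigr => i _; rewrite ltn_ord.
Qed.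

(** Under the law built from the backward kernel, Z_{-m-1} has law nu and is
    independent of V_{-m}, ..., V_{m+1}, which are independent of law beta. One
    reveals Z_{-m-1} and V_{-m} given Z_{-m}: by induction Z_{-m} has law nu and is
    independent of the other innovations, and the reversal turns nu into the
    product of nu and beta. *)
Lemma titer_rect m (h : S -> \bar R) : (forall z, 0 <= h z) ->
  titer K m.+1 0 (fun w => h (state m.+1 w) * rect m.+1 w) w0 =
  (\int[nu]_z h z) * \prod_(i < m.+1) (beta (A i) * beta (C i)).
Proof.
elim: m h => [|m ih] h h0.
  rewrite /= tstep_rect// /rect big_ord0 mul1e big_ord1.
  by rewrite integral_rect1// integral_rect2// muleA.
rewrite titerSr add0n.
pose q z := \int[rev z]_p (h p.1 * (\1_(A m.+1) p.2)%:E).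
have q0 z : 0 <= q z by apply: integral_ge0 => p _; rewrite mule_ge0// lee_fin.
have -> : tstep K m.+1 (fun w => h (state m.+2 w) * rect m.+2 w) =
   (fun w => (q (state m.+1 w) * beta (C m.+1)) * rect m.+1 w).
  by apply/funext => w; rewrite tstep_rect// integral_rect1// muleC.
rewrite (ih (fun z => q z * beta (C m.+1))); last by move=> z; rewrite mule_ge0.
rewrite ge0_integralZr//.
rewrite [in RHS]big_ord_recr/=.
suff -> : \int[nu]_z q z = (\int[nu]_z h z) * beta (A m.+1).
  by rewrite -!muleA; congr (_ * _); rewrite muleA muleC.
rewrite -integral_rect2//; apply/esym.
apply: (@integral_mixture _ _ S (S * G)%type R nu _ (reversal_kernel mS beta g nu) mu).
- exact: (le_lt_trans (probability_le1 nu measurableT) (ltry _)).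
- by move=> B mB; rewrite reversal_mixture.
- by move=> p; rewrite mule_ge0// lee_fin.
- apply: emeasurable_funM; first exact: mhfst.
  exact: mAsnd.
Qed.

End rectangles.

End two_sided_chain.

(** * Finite-dimensional laws of Markov chains *)

Lemma integral_mrestr d (T : measurableType d) (R : realType)
    (mu : {measure set T -> \bar R}) (D : set T) (mD : measurable D)
    (f : T -> \bar R) : measurable_fun setT f -> (forall x, 0 <= f x) ->
  \int[mrestr mu mD]_x f x = \int[mu]_(x in D) f x.
Proof.
move=> mf f0.
rewrite (@ge0_negligible_integral _ _ _ _ setT (~` D))//; last 2 first.
- exact: measurableC.
- by rewrite -[LHS]/(mu (~` D `&` D)) setICl measure0.
rewrite setTD setCK; apply: eq_measure_integral => A mA AD.
by rewrite -[LHS]/(mu (A `&` D)) setIidl.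
Qed.

Section markov.
Context d (Omega : measurableType d) dS (S : measurableType dS) (R : realType).
Variables (P : probability Omega R) (K : R.-pker S ~> S) (Z : int -> {RV P >-> S}).
Hypothesis markovZ : markov_chain K Z.

Let mZ n : measurable_fun setT (Z n). Proof. by []. Qed.

(** The Markov property for nonnegative functions instead of events. *)
Lemma markov_integral n B (h : S -> \bar R) : past Z n B ->
  measurable_fun setT h -> (forall z, 0 <= h z) ->
  \int[P]_(w in B) h (Z (n + 1)%R w) = \int[P]_(w in B) \int[K (Z n w)]_z h z.
Proof.
move=> pB mh h0.
have mB : measurable B by apply: past_measurable pB => k.
have PB (k : int) (f : S -> \bar R) : measurable_fun setT f -> (forall x, 0 <= f x) ->
    \int[P]_(w in B) f (Z k w) = \int[pushforward (mrestr P mB) (Z k)]_z f z.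
  move=> mf f0; rewrite ge0_integral_pushforward// preimage_setT integral_mrestr//.
    exact: measurableT_comp.
  by move=> w; exact: f0.
rewrite (PB _ h)// (PB n (fun s => \int[K s]_z h z)).
- apply: integral_mixture => //.
    have mZB : measurable (Z n @^-1` setT `&` B) by rewrite preimage_setT setTI.
    by apply: (le_lt_trans (probability_le1 P mZB)); rewrite ltry.
  move=> A mA; rewrite -PB//; last exact: measurable_kernel.
  by rewrite -markovZ// /pushforward/= /mrestr/= setIC.
- apply: measurable_fun_integral_kernel => //.
  by move=> U mU; exact: measurable_kernel.
- by move=> z; exact: integral_ge0.
Qed.

(** Probability that the chain started at z is in A 0, ..., A (l - 1) at the times
    1, ..., l. *)
Fixpoint transitions (l : nat) (A : nat -> set S) (z : S) : \bar R :=
  if l is l'.+1 then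
    \int[K z]_y ((\1_(A 0%N) y)%:E * transitions l' (fun i => A i.+1) y)
  else 1.

Lemma transitions_ge0 l A z : 0 <= transitions l A z.
Proof.
elim: l A z => [|l ih] A z //=; apply: integral_ge0 => y _.
by rewrite mule_ge0// lee_fin.
Qed.

Lemma measurable_transitions l A : (forall i, measurable (A i)) ->
  measurable_fun setT (transitions l A).
Proof.
elim: l A => [|l ih] A mA /=; first exact: measurable_cst.
apply: measurable_fun_integral_kernel.
- by move=> U mU; exact: measurable_kernel.
- by move=> y; rewrite mule_ge0// ?lee_fin ?transitions_ge0.
- by apply: emeasurable_funM; [exact/measurable_EFinP|exact: ih].
Qed.

Lemma markov_cylinder l n A B : (forall i, measurable (A i)) -> past Z n B ->
  P (B `&` \bigcap_(i in `I_l) (Z (n + 1 + Posz i)%R @^-1` A i)) =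
  \int[P]_(w in B) transitions l A (Z n w).
Proof.
move=> mA; elim: l n A mA B => [|l ih] n A mA B pB.
  rewrite II0 bigcap_set0 setIT /=; rewrite (eq_integral (cst 1))//.
  rewrite integral_cst ?mul1e//.
  by apply: past_measurable pB => k.
have mB : measurable B by apply: past_measurable pB => k.
rewrite /= -(@markov_integral _ _ (fun y => (\1_(A 0%N) y)%:E *
   transitions l (fun i => A i.+1) y))//; last 2 first.
- by apply: emeasurable_funM; [exact/measurable_EFinP|exact: measurable_transitions].
- by move=> y; rewrite mule_ge0// ?lee_fin ?transitions_ge0.
pose B' := B `&` Z (n + 1)%R @^-1` A 0%N.
have pB' : past Z (n + 1)%R B'.
  apply: past_setI; first by apply: past_le pB; rewrite lerDl.
  exact: past_mem.
have shift (i : nat) : (n + 1 + Posz i.+1 = n + 1 + 1 + Posz i)%R.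
  by rewrite -addn1 PoszD [(Posz i + _)%R]addrC addrA.
transitivity (P (B' `&` \bigcap_(i in `I_l) (Z (n + 1 + 1 + Posz i)%R @^-1` A i.+1))).
  congr (P _); apply/seteqP; split => w.
    move=> [Bw wl]; split; first by split => //; have := wl 0%N; rewrite addr0; apply.
    by move=> i /= il; rewrite -shift; exact: (wl i.+1 il).
  move=> [[Bw w0] wl]; split => // -[|i] /= il; first by rewrite addr0.
  by rewrite shift; exact: (wl i il).
rewrite (ih _ (fun i => A i.+1))//.
rewrite [LHS]integral_mkcondr; apply: eq_integral => w _.
rewrite /patch/= indicE; case: ifPn => wA.
  by rewrite mem_set ?mul1e//; exact: set_mem wA.
by rewrite memNset ?mul0e// => h; move/negP : wA; apply; exact/mem_set.
Qed.

(** A Markov chain all of whose one-dimensional laws are equal is stationary: its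
    finite-dimensional laws are determined by that law and by the kernel. *)
Lemma markov_stationary (nu : set S -> \bar R) :
  (forall n A, measurable A -> distribution P (Z n) A = nu A) -> stationary Z.
Proof.
move=> lawZ h I A mA.
have [a aI] : exists a : nat, forall k, k \in I -> (- Posz a <= k <= Posz a)%R.
  exists (\max_(k <- I) `|k|)%N => k kI; rewrite -ler_norml -abszE lez_nat.
  by apply: (leq_bigmax_seq (F := absz)).
pose l := (a + a).+1.
pose B i := if (Posz i - Posz a)%R \in I then A (Posz i - Posz a)%R else setT.
have mB i : measurable (B i) by rewrite /B; case: ifP.
(* all the times of I are after - a, so the event is a condition on the l first
   steps made from the time n - a - 1 *)
have E n : P (\bigcap_(k in [set` I]) (Z (k + n)%R @^-1` A k)) =
    \int[P]_w transitions l B (Z (n - Posz a - 1)%R w).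
  have pT : past Z (n - Posz a - 1)%R setT by exact: past_setT.
  rewrite -(markov_cylinder l mB pT) setTI; congr (P _).
  apply/seteqP; split => w wI.
    move=> i /= il; rewrite /B; case: ifPn => // iI.
    have -> : (n - Posz a - 1 + 1 + Posz i = Posz i - Posz a + n)%R by ring.
    exact: (wI _ iI).
  move=> k /= kI; have /andP[k1 k2] := aI k kI.
  have ka : (0 <= k + Posz a)%R by rewrite -lerBlDr sub0r.
  have := wI (`|(k + Posz a)%R|)%N; rewrite /B /= gez0_abs// addrK kI => /(_ _).
  have -> : (n - Posz a - 1 + 1 + (k + Posz a) = k + n)%R by ring.
  by apply; rewrite /l ltnS -lez_nat gez0_abs// PoszD lerD2r.
have E0 n : P (\bigcap_(k in [set` I]) (Z (k + n)%R @^-1` A k)) =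
    \int[distribution P (Z 0%R)]_z transitions l B z.
  have mtr := measurable_transitions l mB.
  rewrite E -[LHS](ge0_integral_pushforward (mZ _) P measurableT mtr); last first.
    by move=> z _; exact: transitions_ge0.
  by apply: eq_measure_integral => C mC _; exact: (etrans (lawZ _ C mC) (esym (lawZ 0%R C mC))).
rewrite E0 -(E0 0%R); congr (P _); apply: eq_bigcapr => k _.
by rewrite addr0.
Qed.

End markov.

Section governed_chain.
Context d (Omega : measurableType d) dS (S : measurableType dS)
  dG (G : measurableType dG) (R : realType).
Hypothesis cS : countable [set: S].
Hypothesis mS : forall A : set S, measurable A.
Variables (P : probability Omega R) (beta : probability G R).
Variable g : {mfun (S * G)%type >-> S}.
Variables (V : int -> {RV P >-> G}) (Z : int -> {RV P >-> S}).

Lemma governed_markov : iid beta V -> governed g V Z ->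
  markov_chain (random_map_kernel beta g) Z.
Proof.
move=> iidV [Zg Zind] n A B mA pB.
have mB : measurable B by apply: past_measurable pB => k.
have pZV C : past Z n C -> past (fun k w => (Z k w, V k w)) n C.
  exact: (past_comp (Z := fun k w => (Z k w, V k w)) (h := fst) measurable_fst).
rewrite -(random_map_step cS mS g (v := V (n + 1)%R) mB); last first.
  move=> s C mC; rewrite Zind//; first by rewrite (iid_law iidV).
  apply: pZV; apply: past_setI => //; exact: past_mem.
congr (P _); congr (_ `&` _); apply/seteqP.
by split => w; rewrite /preimage/= Zg.
Qed.

End governed_chain.

(** * Two-sided stationary chains *)

Section process.
Context dS dG (S : measurableType dS) (G : measurableType dG) (R : realType).
Hypothesis cS : countable [set: S].
Hypothesis mS : forall A : set S, measurable A.
Variables (beta : probability G R) (g : {mfun (S * G)%type >-> S}).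
Variable nu : probability S R.
Hypothesis nu_inv : forall A, nu A = \int[nu]_z random_map_kernel beta g z A.

Local Notation W := ((S * G) * G)%type.
Local Notation rev := (reversal mS beta g nu).
Local Notation K := (backward_kernel mS beta g nu).

Variables (w0 : traj W) (P : probability (traj W) R).
Hypothesis PE : forall N (A : set (traj W)), measurable A -> determined N A ->
  P A = titer K N 0 (@ind _ W R A) w0.

Let mcoord12 i : measurable_fun setT (fun w : traj W => (w i).1.2).
Proof.
have m12 : measurable_fun setT (fun u : W => u.1.2).
  exact: (measurableT_comp measurable_snd measurable_fst).
exact: (measurableT_comp m12 (measurable_coord i)).
Qed.

Let mcoord2 i : measurable_fun setT (fun w : traj W => (w i).2).
Proof. exact: (measurableT_comp measurable_snd (measurable_coord i)). Qed.

Let mcoord1 i : measurable_fun setT (fun w : traj W => (w i).1).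
Proof. exact: (measurableT_comp measurable_fst (measurable_coord i)). Qed.

Let mstate i : measurable_fun setT (fun w : traj W => state i w).
Proof. exact: measurable_state. Qed.

(** The event that V_{-i} is in A i and V_{i+1} is in C i. *)
Definition slot (A C : nat -> set G) (i : nat) : set (traj W) :=
  ((fun w : traj W => (w i.+1).1.2) @^-1` A i) `&`
  ((fun w : traj W => (w i.+1).2) @^-1` C i).

(** The event that Z_{-m-1} is in H and that V_{-i} is in A i and V_{i+1} in C i for
    all i <= m. *)
Definition rect_event (A C : nat -> set G) m (H : set S) : set (traj W) :=
  (state m.+1 @^-1` H) `&` \big[setI/setT]_(i < m.+1) slot A C i.

Lemma rect_event_prob A C m H : (forall i, measurable (A i)) ->
  (forall i, measurable (C i)) ->
  P (rect_event A C m H) = nu H * \prod_(i < m.+1) (beta (A i) * beta (C i)).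
Proof.
move=> mA mC.
have mR : measurable (rect_event A C m H).
  apply: measurableI.
    by rewrite -[X in measurable X]setTI; exact: mstate.
  apply: bigsetI_measurable => i _; apply: measurableI.
    by rewrite -[X in measurable X]setTI; exact: mcoord12.
  by rewrite -[X in measurable X]setTI; exact: mcoord2.
have dR : determined m.+1 (rect_event A C m H).
  have half w w' : (forall i, (i <= m.+1)%N -> w i = w' i) ->
      rect_event A C m H w -> rect_event A C m H w'.
    rewrite /rect_event -!bigcap_mkord => ww' [Hw ACw]; split.
      by rewrite /preimage/= /state -ww'.
    by move=> i /= im; have := ACw i im; rewrite /slot /preimage/= ww'.
  move=> w w' ww'; apply/propext; split; apply: half => // i im.
  by rewrite ww'.
rewrite (PE mR dR).
have -> : @ind _ W R (rect_event A C m H) =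
    (fun w => (\1_H (state m.+1 w))%:E * rect R A C m.+1 w).
  apply/funext => w; rewrite /ind /rect_event indicI EFinM; congr (_ * _).
  rewrite /rect; elim: m.+1 => [|n ih]; first by rewrite !big_ord0 indicT.
  by rewrite !big_ord_recr/= indicI EFinM ih /slot indicI EFinM.
rewrite (titer_rect cS mS nu_inv w0 mA mC m (h := fun z => (\1_H z)%:E))//.
by rewrite integral_indic// setIT.
Qed.

(** The event that Z_{-k-1} = g (Z_{-k-2}, V_{-k-1}). *)
Definition glued k : set (traj W) := [set w | g (w k.+2).1 = (w k.+1).1.1].

Lemma measurable_glued k : measurable (glued k).
Proof.
have mgk : measurable_fun setT (fun w : traj W => (g (w k.+2).1, (w k.+1).1.1)).
  apply: measurable_fun_pair; last exact: mstate.
  exact: (measurableT_comp (measurable_funPT g) (mcoord1 _)).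
rewrite -[X in measurable X]setTI.
exact: (mgk measurableT _ (measurable_prod_discrete cS mS [set u | u.1 = u.2])).
Qed.

Lemma integral_reversal_fiber : \int[nu]_z rev z (g @^-1` [set z]) = 1.
Proof.
have mh D : measurable_fun D (fun z => rev z (g @^-1` [set z])).
  exact: measurable_discrete.
have [F [tF UF mF FE]] := countable_fibers cS mS (@measurable_id _ S setT).
rewrite -[X in \int[nu]_(z in X) _]UF ge0_integral_bigcup//.
have <- : nu (\bigcup_n F n) = 1 by rewrite UF; exact: probability_setT.
rewrite measure_semi_bigcup//; apply: eq_eseriesr => n _.
have [->|[s ->]] := FE n; first by rewrite integral_set0 measure0.
rewrite (eq_integral (cst (rev s (g @^-1` [set s])))); last first.
  by move=> z; rewrite inE => ->.
rewrite integral_cst// reversalE//; last exact: measurable_funPTI.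
by rewrite setIid law_one_step.
Qed.

Lemma glued_prob k : P (glued k) = 1.
Proof.
have dG' : determined k.+2 (glued k).
  by move=> w w' ww'; rewrite /glued/= !ww'.
rewrite (PE (measurable_glued k) dG') titerSr add0n.
have -> : tstep K k.+1 (@ind _ W R (glued k)) = (fun w =>
    rev (state k.+1 w) (g @^-1` [set state k.+1 w]) * rect R (fun=> setT) (fun=> setT) k.+1 w).
  apply/funext => w; rewrite /rect big1; last by move=> i _; rewrite !indicT mule1.
  rewrite mule1 /tstep.
  set B := g @^-1` [set state k.+1 w].
  have mB : measurable B by exact: measurable_funPTI.
  under eq_integral.
    move=> u _.
    rewrite (_ : ind R (glued k) (upd w k.+1 u) = (\1_(B `*` setT) u)%:E); last first.
      rewrite /ind !indicE; congr ((nat_of_bool _)%:R%:E).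
      apply/idP/idP; rewrite !inE /glued/= /upd/= ltnn leqnn.
        by move=> gu; split.
      by move=> [].
    over.
  rewrite integral_indic//; last exact: measurableX.
  rewrite setIT/= /kernel_via/= product_measure1E// -[RHS]mule1; congr (_ * _).
  exact: probability_setT.
rewrite (titer_rect cS mS nu_inv w0 (fun=> measurableT) (fun=> measurableT) k
  (h := fun z => rev z (g @^-1` [set z])))//.
rewrite integral_reversal_fiber mul1e big1// => i _.
by rewrite probability_setT mule1.
Qed.

(** The innovation at time n, decoded from the sequence w. *)
Definition vt (n : int) (w : traj W) : G :=
  match n with
  | Posz 0 => (w 1%N).1.2
  | Posz i.+1 => (w i.+1).2
  | Negz i => (w i.+2).1.2
  end.

(** The state at time k >= 0, obtained by running the recursion from Z_{-1}. *)
Fixpoint zpos (k : nat) (w : traj W) : S :=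
  if k is j.+1 then g (zpos j w, (w j.+1).2) else g (w 1%N).1.

(** The state at time n, decoded from the sequence w. *)
Definition zt (n : int) (w : traj W) : S :=
  match n with Posz k => zpos k w | Negz i => state i.+1 w end.

Lemma measurable_vt n : measurable_fun setT (vt n).
Proof. by case: n => [[|i]|i]; [exact: mcoord12|exact: mcoord2|exact: mcoord12]. Qed.

Lemma measurable_zt n : measurable_fun setT (zt n).
Proof.
case: n => [k|i]; last exact: mstate.
rewrite /zt; elim: k => [|k ih] /=.
  exact: (measurableT_comp (measurable_funPT g) (mcoord1 _)).
apply: (measurableT_comp (measurable_funPT g)).
by apply: measurable_fun_pair => //; exact: mcoord2.
Qed.

(** The almost sure event that all the recursions at negative times hold. *)
Definition good : set (traj W) := \bigcap_k glued k.

Lemma measurable_good : measurable good.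
Proof. by apply: bigcapT_measurable => k; exact: measurable_glued. Qed.

Lemma good_prob : P (~` good) = 0.
Proof.
have mC k : measurable (~` glued k) by apply: measurableC; exact: measurable_glued.
apply/eqP; rewrite eq_le measure_ge0 andbT /good setC_bigcap.
apply: (le_trans (@measure_sigma_subadditive _ _ _ P _ (fun k => ~` glued k) _ _ _)) => //.
  exact: bigcup_measurable.
have C0 k : P (~` glued k) = 0.
  by rewrite probability_setC ?glued_prob ?subee//; exact: measurable_glued.
by rewrite eseries0// => k _ _; exact: C0.
Qed.

Lemma zt_step n w : good w -> zt (n + 1)%R w = g (zt n w, vt (n + 1)%R w).
Proof.
move=> gw; case: n => [k|[|i]].
- by rewrite -PoszD addn1.
- rewrite (_ : Negz 0 + 1 = 0)%R//= /state; by case: (w 1%N).1.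
rewrite (_ : Negz i.+1 + 1 = Negz i)%R; last by rewrite !NegzE; lia.
have := gw i I; rewrite /glued /= /state => <-.
by congr (g _); case: (w i.+2).1.
Qed.

Let good_point : {w | good w}.
Proof.
apply: cid; apply: contrapT => /forallNP ng.
have g0 : good = set0 by apply/seteqP; split => // w /ng.
have := good_prob; rewrite g0 setC0 probability_setT => /eqP.
by rewrite onee_eq0.
Qed.

(** A modification of the identity with values in the almost sure event where the
    recursion holds: a governed process has to satisfy it at every sample point. *)
Definition retract (w : traj W) : traj W :=
  if pselect (good w) then w else projT1 good_point.

Lemma retract_good w : good (retract w).
Proof. by rewrite /retract; case: pselect => [gw|nw] //=; case: good_point. Qed.

Lemma retract_id w : good w -> retract w = w.
Proof. by rewrite /retract; case: pselect. Qed.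

Lemma measurable_retract : measurable_fun setT retract.
Proof.
move=> _ A mA; rewrite setTI; have mgood := measurable_good.
rewrite (_ : _ @^-1` A = (good `&` A) `|`
    (~` good `&` [set _ | A (projT1 good_point)])).
  apply: measurableU; first exact: measurableI.
  apply: measurableI; first exact: measurableC.
  have [Ap|Ap] := pselect (A (projT1 good_point)).
    by rewrite (_ : [set _ | _] = setT)//; apply/seteqP; split.
  by rewrite (_ : [set _ | _] = set0)//; apply/seteqP; split.
apply/seteqP; split => w; rewrite /preimage/= /retract; case: pselect => gw /=.
- by left.
- by right.
- by case=> -[].
- by case=> -[].
Qed.

Lemma retract_law A : measurable A -> P (retract @^-1` A) = P A.
Proof.
move=> mA; have mgood := measurable_good.
have mrA : measurable (retract @^-1` A).
  by rewrite -[X in measurable X]setTI; exact: measurable_retract.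
have split B : measurable B -> P B = P (B `&` good).
  move=> mB; rewrite -[in LHS](setIT B) -(setUv good) setIUr.
  rewrite measureU0//; [exact: measurableI|by apply: measurableI => //; exact: measurableC|].
  apply: (subset_measure0 _ _ _ good_prob) => //.
  - by apply: measurableI => //; exact: measurableC.
  - exact: measurableC.
rewrite split// [RHS]split//; congr (P _); apply/seteqP.
by split => w [wA gw]; split => //; move: wA; rewrite /preimage/= retract_id.
Qed.

Definition Vproc (n : int) : {RV P >-> G} :=
  mfun_Sub (mem_set (measurableT_comp (measurable_vt n) measurable_retract)).

Definition Zproc (n : int) : {RV P >-> S} :=
  mfun_Sub (mem_set (measurableT_comp (measurable_zt n) measurable_retract)).

Lemma Zproc_step n w : Zproc (n + 1)%R w = g (Zproc n w, Vproc (n + 1)%R w).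
Proof. exact: (zt_step n (retract_good w)). Qed.

(* times -m, ..., m + 1 *)
(** The times -m, ..., m + 1. *)
Definition window (m : nat) : seq int :=
  [seq (- Posz i)%R | i <- iota 0 m.+1] ++ [seq Posz i.+1 | i <- iota 0 m.+1].

Lemma mem_window m k : (k \in window m) = (- Posz m <= k <= Posz m.+1)%R.
Proof.
rewrite mem_cat; apply/orP/idP => [[]/mapP[i]|].
- by rewrite mem_iota => im ->; lia.
- by rewrite mem_iota => im ->; lia.
move=> km; have [k0|k0] := lerP k 0%R; [left|right]; apply/mapP.
  by exists `|k|%N; rewrite ?mem_iota; lia.
by exists (`|k|.-1)%N; rewrite ?mem_iota; lia.
Qed.

Lemma uniq_window m : uniq (window m).
Proof.
rewrite cat_uniq; apply/and3P; split.
- by rewrite map_inj_uniq ?iota_uniq// => i j /oppr_inj [].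
- by apply/hasPn => k /mapP[i _ ->]; apply/mapP => -[j _]; lia.
- by rewrite map_inj_uniq ?iota_uniq// => i j [].
Qed.

(** Z_{-m-1} has law nu and is independent of the innovations V_{-m}, ..., V_{m+1},
    which are independent of law beta. *)
Lemma Zproc_cylinder m H (I : {fset int}) (A : int -> set G) :
  (forall k, measurable (A k)) -> (forall k, k \in I -> k \in window m) ->
  P (Zproc (Negz m) @^-1` H `&` \bigcap_(k in [set` I]) (Vproc k @^-1` A k)) =
  nu H * \prod_(k <- I) beta (A k).
Proof.
move=> mA Im.
pose B k := if k \in I then A k else setT.
have mB k : measurable (B k) by rewrite /B; case: ifP.
have mR : measurable (rect_event (fun i => B (- Posz i)%R) (fun i => B (Posz i.+1)) m H).
  apply: measurableI.
    by rewrite -[X in measurable X]setTI; exact: mstate.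
  apply: bigsetI_measurable => i _; apply: measurableI.
    by rewrite -[X in measurable X]setTI; exact: mcoord12.
  by rewrite -[X in measurable X]setTI; exact: mcoord2.
transitivity (P (rect_event (fun i => B (- Posz i)%R) (fun i => B (Posz i.+1)) m H)).
  rewrite -(retract_law mR); congr (P _); apply/seteqP; split => w.
    move=> [Hw wI]; split => //.
    rewrite -bigcap_mkord => i /= im; split.
      rewrite /preimage/= /B; case: ifPn => // iI.
      by have := wI _ iI; rewrite /Vproc/= /vt; case: (i).
    rewrite /preimage/= /B; case: ifPn => // iI.
    exact: (wI _ iI).
  rewrite /rect_event -bigcap_mkord => -[Hw wB]; split => // k /= kI.
  have := Im k kI; rewrite mem_window => km.
  case: k kI km => [[|i]|i] kI km.
  - by have [+ _] := wB 0%N isT; rewrite /preimage/= /B oppr0 kI.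
  - by have [_] := wB i ltac:(rewrite /=; lia); rewrite /preimage/= /B kI.
  - by have [+ _] := wB i.+1 ltac:(rewrite /=; lia); rewrite /preimage/= /B -NegzE kI.
rewrite rect_event_prob//; congr (_ * _).
rewrite big_split/=.
transitivity (\prod_(k <- window m) beta (B k)).
  rewrite big_cat !big_map/=; congr (_ * _).
    by rewrite -(big_mkord xpredT (fun i => beta (B (- Posz i)%R))) /index_iota subn0.
  by rewrite -(big_mkord xpredT (fun i => beta (B (Posz i.+1)))) /index_iota subn0.
rewrite (eq_bigr (fun k => if k \in I then beta (A k) else 1)); last first.
  by move=> k _; rewrite /B; case: ifP => // _; exact: probability_setT.
rewrite -big_mkcond -big_filter; apply: perm_big; apply: uniq_perm.
- by rewrite filter_uniq// uniq_window.
- exact: fset_uniq.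
- by move=> k; rewrite mem_filter; apply/andP/idP => [[]//|kI]; split => //; exact: Im.
Qed.

Let large (I : {fset int}) : exists m, forall k, k \in I -> k \in window m.
Proof.
exists (\max_(k <- I) `|k|)%N => k kI; rewrite mem_window.
have : (`|k| <= \max_(k <- I) `|k|)%N by apply: (leq_bigmax_seq (F := absz)).
by move: (\max_(_ <- _) _)%N => m; lia.
Qed.

Lemma Vproc_cylinder (I : {fset int}) (A : int -> set G) :
  (forall k, measurable (A k)) ->
  P (\bigcap_(k in [set` I]) (Vproc k @^-1` A k)) = \prod_(k <- I) beta (A k).
Proof.
move=> mA; have [m Im] := large I.
have := Zproc_cylinder setT mA Im.
by rewrite preimage_setT setTI => ->; rewrite probability_setT mul1e.
Qed.

Lemma Vproc_law n A : measurable A -> P (Vproc n @^-1` A) = beta A.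
Proof.
move=> mA; have := @Vproc_cylinder [fset n]%fset (fun=> A) (fun=> mA).
by rewrite set_fset1 bigcap_set1 big_seq_fset1.
Qed.

Lemma Vproc_iid : iid beta Vproc.
Proof.
split; last by move=> n A mA; exact: Vproc_law.
move=> I A mA; rewrite Vproc_cylinder//; apply: eq_bigr => k _.
by rewrite Vproc_law.
Qed.

(** For m large, an event which constrains (Z_k, V_k) for finitely many k <= n
    belongs to the sigma-algebra generated by Z_{-m-1}, V_{-m}, ..., V_n, of which
    V_{n+1} is independent. *)
Lemma Vproc_indep n C B : measurable C ->
  past (fun k w => (Zproc k w, Vproc k w)) n B ->
  P (Vproc (n + 1)%R @^-1` C `&` B) = P (Vproc (n + 1)%R @^-1` C) * P B.
Proof.
move=> mC; apply: past_indep_finite.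
- by move=> k; exact: measurable_fun_pair.
- exact: measurable_funPTI.
move=> _ [I [D [mD In ->]]].
have [m [Im nm]] : exists m, (forall k, k \in I -> (- Posz m <= k)%R) /\ (`|n| <= m)%N.
  have [m1 Im1] := large I; exists (maxn m1 `|n|%N); split => [k kI|]; last by rewrite leq_maxr.
  by have := Im1 k kI; rewrite mem_window; lia.
pose GG := [set B | exists (H : set S) (J : {fset int}) (A : int -> set G),
  [/\ forall k, measurable (A k), forall k, k \in J -> (- Posz m <= k <= n)%R &
      B = Zproc (Negz m) @^-1` H `&` \bigcap_(k in [set` J]) (Vproc k @^-1` A k)]].
have mcap (J : {fset int}) (A : int -> set G) : (forall k, measurable (A k)) ->
    measurable (\bigcap_(k in [set` J]) (Vproc k @^-1` A k)).
  by move=> mA; apply: fin_bigcap_measurable => // k _; exact: measurable_funPTI.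
have GGind B' : <<s GG >> B' ->
    P (Vproc (n + 1)%R @^-1` C `&` B') = P (Vproc (n + 1)%R @^-1` C) * P B'.
  apply: independent_generated => //.
  - exact: measurable_funPTI.
  - exists setT, fset0, (fun=> setT); split => //.
    by rewrite set_fset0 bigcap_set0 preimage_setT setTI.
  - move=> _ _ [H [J [A [mA Jn ->]]]] [H' [J' [A' [mA' Jn' ->]]]].
    exists (H `&` H'), (J `|` J')%fset, (fun k => (if k \in J then A k else setT) `&`
     (if k \in J' then A' k else setT)); split.
    + by move=> k; apply: measurableI; case: ifP.
    + by move=> k; rewrite inE => /orP[/Jn|/Jn'].
    + apply/seteqP; split => w /=.
        move=> [[Hw wI] [Hw' wJ]]; split => // k /=; rewrite inE => _; split.
          by case: ifP => // kI; exact: wI.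
        by case: ifP => // kJ; exact: wJ.
      move=> [[Hw Hw'] wIJ]; split; split => // k /= kI.
        by have := wIJ k; rewrite /= inE kI => /(_ isT)[].
      by have := wIJ k; rewrite /= inE kI orbT => /(_ isT)[].
  - move=> _ [H [J [A [mA Jn ->]]]]; apply: measurableI; last exact: mcap.
    by rewrite -[X in measurable X]setTI; exact: measurable_funPT.
  - move=> _ [H [J [A [mA Jn ->]]]].
    have nJ : (n + 1)%R \notin J by apply/negP => /Jn; lia.
    pose D' k := if k == (n + 1)%R then C else A k.
    have mD' k : measurable (D' k) by rewrite /D'; case: ifP.
    transitivity (P (Zproc (Negz m) @^-1` H `&`
        \bigcap_(k in [set` ((n + 1)%R |` J)%fset]) (Vproc k @^-1` D' k))).
      congr (P _); apply/seteqP; split => w /=.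
        move=> [wC [wH wJ]]; split => // k /=; rewrite !inE /D'.
        case: eqP => [-> //|_ /= kJ]; exact: wJ.
      move=> [wH wJ]; split.
        by have := wJ (n + 1)%R; rewrite /= !inE eqxx /D' eqxx; exact.
      split => // k /= kJ; have := wJ k; rewrite /= !inE kJ orbT /D'.
      by case: eqP => [kn|_]; [rewrite -kn kJ in nJ|exact].
    rewrite (Zproc_cylinder H mD'); last first.
      by move=> k; rewrite in_fset1U mem_window => /orP[/eqP ->|/Jn]; lia.
    rewrite (Zproc_cylinder H mA); last by move=> k /Jn; rewrite mem_window; lia.
    rewrite big_fsetU1//= {1}/D' eqxx Vproc_law// muleCA; congr (_ * (_ * _)).
    rewrite !big_seq; apply: eq_bigr => k kJ; rewrite /D'; case: eqP => // kn.
    by rewrite kn (negPf nJ) in kJ.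
apply: GGind.
have sGG : sigma_algebra setT <<s GG >> by exact: smallest_sigma_algebra.
(* the innovations and the states at times up to n are measurable for this
   sigma-algebra *)
have GV k A : (- Posz m <= k <= n)%R -> measurable A -> <<s GG >> (Vproc k @^-1` A).
  move=> kn mA; apply: sub_sigma_algebra.
  exists setT, [fset k]%fset, (fun=> A); split => //.
    by move=> j; rewrite inE => /eqP ->.
  by rewrite preimage_setT setTI set_fset1 bigcap_set1.
have GZ j A : (Negz m + Posz j <= n)%R -> <<s GG >> (Zproc (Negz m + Posz j)%R @^-1` A).
  elim: j A => [|j ih] A jn.
    apply: sub_sigma_algebra; exists A, fset0, (fun=> setT); split => //.
    by rewrite set_fset0 bigcap_set0 setIT addr0.
  have -> : Zproc (Negz m + Posz j.+1)%R @^-1` A =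
      (fun w => g (Zproc (Negz m + Posz j)%R w, Vproc (Negz m + Posz j.+1)%R w)) @^-1` A.
    have -> : (Negz m + Posz j.+1 = Negz m + Posz j + 1)%R by lia.
    by apply/seteqP; split => w /= Aw; have := Zproc_step (Negz m + Posz j)%R w;
      move: Aw => + E; rewrite /preimage /= -E.
  apply: (adapted_step cS mS g sGG).
    by move=> s; apply: ih; lia.
  by move=> C' mC'; apply: GV => //; lia.
apply: (@fin_bigcap_measurable _ (g_sigma_algebraType GG)) => // k kI.
apply: (adapted_pair cS mS sGG); last exact: mD.
  move=> s; have := GZ `|(k - Negz m)%R|%N [set s].
  have -> : (Negz m + Posz `|k - Negz m| = k)%R by have := Im k kI; lia.
  by apply; exact: In.
by move=> C' mC'; apply: GV => //; rewrite Im//= In.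
Qed.

Lemma Zproc_law n A : distribution P (Zproc n) A = nu A.
Proof.
have neg m B : P (Zproc (Negz m) @^-1` B) = nu B.
  have := @Zproc_cylinder m B fset0 (fun=> setT) (fun=> measurableT).
  by rewrite set_fset0 bigcap_set0 setIT big_seq_fset0 mule1; exact.
have mZ := governed_markov cS mS Vproc_iid (conj Zproc_step Vproc_indep).
have step k : (forall B, distribution P (Zproc k) B = nu B) ->
    forall B, distribution P (Zproc (k + 1)%R) B = nu B.
  move=> lk B; rewrite (markov_law k mZ (mS B)) nu_inv.
  by apply: eq_measure_integral => C mC _; exact: lk.
have pos j : forall B, distribution P (Zproc (Negz 0 + Posz j)%R) B = nu B.
  elim: j => [|j ih]; first by rewrite addr0 => B; exact: neg.
  have -> : (Negz 0 + Posz j.+1 = Negz 0 + Posz j + 1)%R by lia.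
  exact: step.
case: n => [k|m]; last exact: neg.
by have -> : Posz k = (Negz 0 + Posz k.+1)%R by lia.
Qed.

Lemma Zproc_stationary : stationary Zproc.
Proof.
have mZ := governed_markov cS mS Vproc_iid (conj Zproc_step Vproc_indep).
by apply: (markov_stationary mZ (nu := nu)) => n A _; exact: Zproc_law.
Qed.

End process.

(** An invariant law of the kernel of a random map on a countable space is the law
    at each time of a two-sided stationary chain governed by independent innovations. *)
Theorem stationary_process_exists dS dG (S : measurableType dS)
    (G : measurableType dG) (R : realType) (cS : countable [set: S])
    (mS : forall A : set S, measurable A) (beta : probability G R)
    (g : {mfun (S * G)%type >-> S}) (nu : probability S R) :
  (forall A, nu A = \int[nu]_z random_map_kernel beta g z A) ->
  exists (d : measure_display) (Omega : measurableType d) (P : probability Omega R)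
    (V : int -> {RV P >-> G}) (Z : int -> {RV P >-> S}),
  [/\ iid beta V, governed g V Z, stationary Z &
      forall n A, distribution P (Z n) A = nu A].
Proof.
move=> nu_inv.
have [P PE] := ionescu_tulcea (backward_kernel mS beta g nu) (fun=> point).
do 2 eexists; exists P, (Vproc cS nu_inv PE), (Zproc cS nu_inv PE).
split.
- exact: Vproc_iid.
- by split; [exact: Zproc_step|exact: Vproc_indep].
- exact: Zproc_stationary.
- exact: Zproc_law.
Qed.

(** * Invariant laws off the diagonal *)

Section symmetrized.
Context d (T : measurableType d) (R : realType).

Definition exchange (u : T * T) : T * T := (u.2, u.1).

Let measurable_exchange : measurable_fun setT exchange.
Proof. exact: measurable_fun_pair. Qed.

HB.instance Definition _ :=
  isMeasurableFun.Build _ _ _ _ exchange measurable_exchange.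

Variable nu : probability (T * T)%type R.

Let half : {nonneg R} := (2^-1 : R)%:nng%R.

(** The average of nu and of its image by the exchange of coordinates. *)
Definition symmetrized : set (T * T) -> \bar R :=
  measure_add (mscale half nu) (mscale half (distribution nu exchange)).

HB.instance Definition _ := Measure.on symmetrized.

Lemma symmetrizedE A : symmetrized A =
  (2^-1)%:E * nu A + (2^-1)%:E * nu (exchange @^-1` A).
Proof. by rewrite /symmetrized measure_addE. Qed.

Let symmetrized1 : symmetrized setT = 1.
Proof.
rewrite symmetrizedE preimage_setT probability_setT mule1 -EFinD.
by congr (_%:E); lra.
Qed.

HB.instance Definition _ := Measure_isProbability.Build _ _ _ symmetrized symmetrized1.

Lemma symmetrized_exchange A : symmetrized (exchange @^-1` A) = symmetrized A.
Proof.
rewrite !symmetrizedE addeC; congr (_ + _).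
by rewrite (_ : _ @^-1` (_ @^-1` A) = A)//; apply/seteqP; split => -[].
Qed.

End symmetrized.

Section off_diagonal.
Context (dE dG : measure_display) (E : measurableType dE) (G : measurableType dG)
  (R : realType).
Hypothesis cE : countable [set: E].
Hypothesis mE : forall A : set E, measurable A.
Variables (beta : probability G R) (f : {mfun (E * G)%type >-> E}).

Let cEE := countable_prod cE.
Let mEE := measurable_prod_discrete cE mE.

Local Notation K1 := (Pi_kernel beta f).
Local Notation K2 := (Pi2_kernel beta f).
Local Notation D := (@diag E).

Lemma symmetrized_invariant (nu : probability (E * E)%type R) :
  (forall A, nu A = \int[nu]_u K2 u A) ->
  forall A, symmetrized nu A = \int[symmetrized nu]_u K2 u A.
Proof.
move=> nu_inv A.
have mK B : measurable_fun setT (fun u => K2 u B) by exact: measurable_kernel.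
rewrite ge0_integral_measure_add// !ge0_integral_mscale//.
rewrite ge0_integral_pushforward// symmetrizedE preimage_setT.
by rewrite nu_inv [in X in _ + X]nu_inv.
Qed.

(** If x and y are not accordable, then the chain started at (x, y) never meets the
    diagonal. It is tight because its two marginals are chains with kernel Pi, so
    its averages have a limit, which is invariant and does not charge the diagonal;
    it remains to symmetrize it. *)
Lemma off_diagonal_invariant x y : positive_recurrent K1 ->
  ~ kernel_accordable beta f x y ->
  exists nu : probability (E * E)%type R,
    [/\ forall A, nu A = \int[nu]_u K2 u A,
        forall A, nu (@exchange _ E @^-1` A) = nu A & nu D = 0].
Proof.
move=> recK1 nacc.
have [e ie] := countable_index cE.
pose e2 := pair_index e; have ie2 : injective e2 by exact: pair_index_inj.
pose lam k : {measure set (E * E) -> \bar R} := kiter K2 k (x, y).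
have lamE k A : lam k A = kernel_iter K2 k (x, y) A by rewrite kernel_iterE.
have lam1 k : lam k setT = 1 by exact: prob_kernel.
have lamS k A : lam k.+1 A = \int[lam k]_u K2 u A.
  rewrite lamE -addn1 chapman_kolmogorov//; apply: eq_integral => u _.
  by rewrite kernel_iter1.
have lamD k : lam k D = 0.
  have Sk j : lam j.+1 D = 0.
    apply/eqP; rewrite eq_le measure_ge0 andbT leNgt; apply/negP => lj.
    by apply: nacc; exists j.+1 => //; rewrite -lamE.
  case: k => [|k]; last exact: Sk.
  rewrite lamE /= diracE memNset// => Dxy; apply: nacc; exists 1%N => //.
  by rewrite kernel_iter1// diag_absorbing.
(* each marginal leaves a finite set with probability at most 1/4, hence the pair
   stays in a finite set with probability at least 1/2 *)
have q : (0 < 4^-1 :> R)%R by rewrite invr_gt0.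
have [M1 tM1] := positive_recurrent_tight mE ie (recK1 x).1 (recK1 x).2 q.
have [M2 tM2] := positive_recurrent_tight mE ie (recK1 y).1 (recK1 y).2 q.
have [N NM] := pair_index_bound e (maxn M1 M2).
have lamN k : (2^-1)%:E <= lam k [set u | (e2 u < N)%N].
  have far : lam k [set u | (N <= e2 u)%N] <= (2^-1)%:E.
    apply: (@le_trans _ _ (lam k (fst @^-1` [set a | (M1 <= e a)%N] `|`
                                  snd @^-1` [set b | (M2 <= e b)%N]))).
      apply: le_measure; rewrite ?inE// => u /NM [|] h; [left|right].
        by apply: leq_trans h; exact: leq_maxl.
      by apply: leq_trans h; exact: leq_maxr.
    apply: le_trans (measureU2 _ _ _) _ => //.
    have -> : (2^-1)%:E = (4^-1)%:E + (4^-1)%:E :> \bar R.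
      by rewrite -EFinD; congr (_%:E); lra.
    apply: leeD.
      by have := tM1 k; rewrite -(marginal1 cE mE beta f k (x, y)) -lamE.
    by have := tM2 k; rewrite -(marginal2 cE mE beta f k (x, y)) -lamE.
  have : 1 <= lam k [set u | (e2 u < N)%N] + lam k [set u | (N <= e2 u)%N].
    rewrite -(lam1 k); apply: le_trans (measureU2 _ _ _) => //.
    apply: le_measure; rewrite ?inE// => u _ /=.
    by have [h|h] := ltnP (e2 u) N; [left|right].
  move=> le1; rewrite -(@leeD2rE _ (2^-1)%:E)//.
  apply: le_trans (leeD (lexx _) far).
  by apply: le_trans le1; rewrite -EFinD lee_fin; lra.
have half0 : (0 < 2^-1 :> R)%R by rewrite invr_gt0.
have [nu [nu_inv nu0]] := limit_of_averages mEE ie2 lam1 lamS half0 lamN.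
exists (symmetrized nu); split.
- exact: symmetrized_invariant.
- exact: symmetrized_exchange.
- refine (etrans (symmetrizedE nu D) _).
  rewrite (nu0 D lamD) (nu0 (@exchange _ E @^-1` D)) ?mule0 ?adde0//.
  move=> k; rewrite -(lamD k); congr (lam k _).
  by apply/seteqP; split => u /=; rewrite /diag /= => ->.
Qed.

End off_diagonal.

(** * Necessity of accordability *)

Section completion.
Context d (Omega : measurableType d) (R : realType) (P : probability Omega R)
  dS (S : measurableType dS).

(** Up to a null set, an event of the completed past is an event of the past. *)
Lemma completed_past_approx (Z : int -> Omega -> S) n A :
  completed_past P Z n A -> exists B N,
  [/\ past Z n B, measurable N, P N = 0 & A `&` ~` N = B `&` ~` N].
Proof.
have [p0 pC pU] := past_sigma Z n.
apply: (smallest_sub (X := [set A | exists B N,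
  [/\ past Z n B, measurable N, P N = 0 & A `&` ~` N = B `&` ~` N]])).
  split.
  - by exists set0, set0; split.
  - move=> C [B [N [pB mN N0 CB]]]; exists (setT `\` B), N; split => //.
      exact: pC.
    apply/seteqP; split => w [[_ Cw] Nw]; split => //; split => // Bw; apply: Cw.
      by have : (B `&` ~` N) w by []; rewrite -CB => -[].
    by have : (C `&` ~` N) w by []; rewrite CB => -[].
  - move=> F /= /choice[B] /choice[N BN]; exists (\bigcup_i B i), (\bigcup_i N i); split.
    + by apply: pU => i; have [] := BN i.
    + by apply: bigcup_measurable => i _; have [] := BN i.
    + apply/eqP; rewrite eq_le measure_ge0 andbT.
      apply: (le_trans (@measure_sigma_subadditive _ _ _ P _ N _ _ _)) => //.
      * by move=> i; have [] := BN i.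
      * by apply: bigcup_measurable => i _; have [] := BN i.
      * by rewrite eseries0// => i _ _; have [] := BN i.
    + have E i : F i `&` ~` N i = B i `&` ~` N i by have [] := BN i.
      apply/seteqP; split => w [[i _ Fw] Nw]; split => //; exists i => //.
        have : (F i `&` ~` N i) w by split => // Niw; apply: Nw; exists i.
        by rewrite E => -[].
      have : (B i `&` ~` N i) w by split => // Niw; apply: Nw; exists i.
      by rewrite -E => -[].
move=> B [pB|[N [mN N0 BN]]].
  by exists B, set0; split.
exists set0, N; split => //; apply/seteqP; split => w [] //.
by move=> /BN.
Qed.

End completion.

Section same_driver.
Context (dE dG : measure_display) (E : measurableType dE) (G : measurableType dG)
  (R : realType).
Hypothesis cE : countable [set: E].
Hypothesis mE : forall A : set E, measurable A.
Context d (Omega : measurableType d) (P : probability Omega R).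

(** If v is independent of (x, B) and of (y, B), and if x and y have the same law on B,
    then so do (x, v) and (y, v). *)
Lemma independent_pair_law (x y : {RV P >-> E}) (v : {RV P >-> G}) (B : set Omega)
    (C : set (E * G)) :
  measurable B ->
  (forall s A, measurable A -> P (v @^-1` A `&` (x @^-1` [set s] `&` B)) =
     P (v @^-1` A) * P (x @^-1` [set s] `&` B)) ->
  (forall s A, measurable A -> P (v @^-1` A `&` (y @^-1` [set s] `&` B)) =
     P (v @^-1` A) * P (y @^-1` [set s] `&` B)) ->
  (forall s, P (x @^-1` [set s] `&` B) = P (y @^-1` [set s] `&` B)) ->
  measurable C ->
  P ((fun w => (x w, v w)) @^-1` C `&` B) = P ((fun w => (y w, v w)) @^-1` C `&` B).
Proof.
move=> mB xv yv xy mC.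
have [F [tF UF mF FE]] := countable_fibers cE mE (@measurable_id _ E setT).
have mCs s : measurable (pair s @^-1` C).
  by rewrite -[X in measurable X]setTI; exact: (pair1_measurable s).
have sum (z : {RV P >-> E}) : P ((fun w => (z w, v w)) @^-1` C `&` B) =
    \sum_(0 <= n <oo) P ((fun w => (z w, v w)) @^-1` C `&` (z @^-1` F n `&` B)).
  rewrite -[X in P (_ `&` X)]setTI -(preimage_setT z) -UF preimage_bigcup.
  rewrite setI_bigcupl setI_bigcupr measure_semi_bigcup//.
  - move=> n; apply: measurableI; last first.
      by apply: measurableI => //; exact: measurable_funPTI.
    have mzv : measurable_fun setT (fun w => (z w, v w)) by exact: measurable_fun_pair.
    by rewrite -[X in measurable X]setTI; exact: mzv.
  - by apply: trivIset_setIl; apply: trivIset_setIr; 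
    by move=> i j _ _ [w [wi wj]]; apply: (tF i j) => //; exists (z w).
  - apply: bigcup_measurable => n _; apply: measurableI; last first.
      by apply: measurableI => //; exact: measurable_funPTI.
    have mzv : measurable_fun setT (fun w => (z w, v w)) by exact: measurable_fun_pair.
    by rewrite -[X in measurable X]setTI; exact: mzv.
rewrite !sum; apply: eq_eseriesr => n _.
have [->|[s Fs]] := FE n; first by rewrite !preimage_set0 !set0I !setI0.
have slice (z : {RV P >-> E}) :
    (fun w => (z w, v w)) @^-1` C `&` (z @^-1` F n `&` B) =
    v @^-1` (pair s @^-1` C) `&` (z @^-1` [set s] `&` B).
  rewrite Fs; apply/seteqP; split => w /= [h1 [h2 h3]]; split => //; move: h1.
    by rewrite -h2.
  by rewrite h2.
by rewrite !slice xv// yv// xy.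
Qed.

Variables (beta : probability G R) (f : {mfun (E * G)%type >-> E}).
Variables (V : int -> {RV P >-> G}) (X Y : int -> {RV P >-> E}).
Hypotheses (iidV : iid beta V) (govX : governed f V X) (govY : governed f V Y).
Hypothesis lawXY : forall n A, P (X n @^-1` A) = P (Y n @^-1` A).

(* the event that the j innovations after time s are in A 0, ..., A (j - 1) *)
Let box (s : int) (A : nat -> set G) (j : nat) : set Omega :=
  \bigcap_(i in `I_j) (V (s + Posz i + 1)%R @^-1` A i).

Let boxS s A j : box s A j.+1 = box s A j `&` V (s + Posz j + 1)%R @^-1` A j.
Proof.
apply/seteqP; split => w.
  by move=> wA; split => [i /= ij|]; apply: wA => //=; rewrite ltnS ltnW.
by move=> [wA wj] i /=; rewrite ltnS leq_eqVlt => /orP[/eqP ->//|]; exact: wA.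
Qed.

Let box_past s A j : (forall i, measurable (A i)) -> past V (s + Posz j)%R (box s A j).
Proof.
move=> mA; elim: j => [|j ih].
  by rewrite /box II0 bigcap_set0; exact: past_setT.
rewrite boxS; apply: past_setI; first by apply: past_le ih; lia.
by apply: past_mem => //; lia.
Qed.

Let box_step (W : int -> {RV P >-> E}) s A j H : governed f V W ->
  W (s + Posz j.+1)%R @^-1` H `&` box s A j.+1 =
  (fun w => (W (s + Posz j)%R w, V (s + Posz j + 1)%R w)) @^-1`
    (f @^-1` H `&` snd @^-1` A j) `&` box s A j.
Proof.
move=> govW; have -> : (s + Posz j.+1 = s + Posz j + 1)%R by lia.
rewrite boxS; apply/seteqP; split => w /=; rewrite /preimage/= govW.1.
  by move=> [hH [hB hA]].
by move=> [[hH hA] hB].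
Qed.

Let box_law s A j : (forall i, measurable (A i)) -> forall H,
  P (X (s + Posz j)%R @^-1` H `&` box s A j) =
  P (Y (s + Posz j)%R @^-1` H `&` box s A j).
Proof.
move=> mA; elim: j => [|j ih] H.
  by rewrite /box II0 bigcap_set0 !setIT; exact: lawXY.
have ind (W : int -> {RV P >-> E}) : governed f V W -> forall t C, measurable C ->
    P (V (s + Posz j + 1)%R @^-1` C `&` (W (s + Posz j)%R @^-1` [set t] `&` box s A j)) =
    P (V (s + Posz j + 1)%R @^-1` C) * P (W (s + Posz j)%R @^-1` [set t] `&` box s A j).
  move=> govW t C mC; apply: govW.2 => //; apply: past_setI.
    apply: (past_comp (Z := fun k w => (W k w, V k w)) (h := fst) measurable_fst).
    exact: past_mem.
  apply: (past_comp (Z := fun k w => (W k w, V k w)) (h := snd) measurable_snd).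
  exact: box_past.
have mbox : measurable (box s A j).
  have mV k : measurable_fun setT (V k) by [].
  exact: (past_measurable mV (@box_past s A j mA)).
rewrite (@box_step X s A j H govX) (@box_step Y s A j H govY).
apply: independent_pair_law => //; [exact: ind|exact: ind|].
apply: measurableI; rewrite -[X in measurable X]setTI.
  exact: measurable_funPT.
exact: measurable_snd.
Qed.

(** Two chains governed by the same innovations and with the same one-dimensional
    laws have the same joint law with the past of the innovations. *)
Lemma governed_same_law n B : past V n B -> forall H,
  P (X n @^-1` H `&` B) = P (Y n @^-1` H `&` B).
Proof.
move=> pB H.
have mH (W : int -> {RV P >-> E}) : measurable (W n @^-1` H) by exact: measurable_funPTI.
rewrite ![_ `&` B]setIC -[LHS]/(mrestr P (mH X) B) -[RHS]/(mrestr P (mH Y) B).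
move: B pB; apply: past_measure_unique => [k//| |].
  rewrite [ltLHS]/= /mrestr setTI.
  exact: (le_lt_trans (probability_le1 P (mH X)) (ltry _)).
move=> _ [I [A [mA In ->]]].
(* a time n - a before all those of the cylinder *)
have [a aI] : exists a : nat, forall k, k \in I -> (n - Posz a < k)%R.
  exists (\max_(k <- I) `|n - k|).+1%N => k kI.
  have : (`|n - k| <= \max_(k <- I) `|n - k|)%N.
    by apply: (leq_bigmax_seq (F := fun k => `|n - k|%N)).
  by move: (\max_(_ <- _) _)%N => m; lia.
pose A' i := if (n - Posz a + Posz i + 1)%R \in I then A (n - Posz a + Posz i + 1)%R else setT.
have -> : \bigcap_(k in [set` I]) (V k @^-1` A k) = box (n - Posz a)%R A' a.
  apply/seteqP; split => w wA.
    by move=> i /= ia; rewrite /preimage/= /A'; case: ifP => // iI; exact: (wA _ iI).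
  move=> k /= kI; have ka := aI k kI; have kn := In k kI.
  pose i := `|(k - 1 - (n - Posz a))%R|%N.
  have iE : (n - Posz a + Posz i + 1 = k)%R by rewrite /i; lia.
  have := wA i; rewrite /preimage/= /A' iE.
  by rewrite kI; apply; lia.
have mA' i : measurable (A' i) by rewrite /A'; case: ifP.
have := @box_law (n - Posz a)%R A' a mA' H.
by rewrite subrK [RHS]/= /mrestr ![_ `&` box _ _ _]setIC.
Qed.

End same_driver.

Section necessity.
Context (dE dG : measure_display) (E : measurableType dE) (G : measurableType dG)
  (R : realType).
Hypothesis cE : countable [set: E].
Hypothesis mE : forall A : set E, measurable A.
Variables (beta : probability G R) (f : {mfun (E * G)%type >-> E}).

Let cEE := countable_prod cE.
Let mEE := measurable_prod_discrete cE mE.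

Local Notation K1 := (Pi_kernel beta f).
Local Notation K2 := (Pi2_kernel beta f).
Local Notation D := (@diag E).

Hypothesis recK1 : positive_recurrent K1.

Lemma off_diagonal_not_diagonal (nu : probability (E * E)%type R) :
  nu D = 0 -> nu (~` D) = 0 -> False.
Proof.
move=> D0; rewrite probability_setC// D0 sube0 => /eqP.
by rewrite onee_eq0.
Qed.

Lemma Pi2_diagonal_accordable : stationary_Pi2_chains_diagonal beta f ->
  forall x y, kernel_accordable beta f x y.
Proof.
move=> diagonal x y; apply: contrapT => nacc.
have [nu [nu_inv _ nuD]] := off_diagonal_invariant cE mE recK1 nacc.
have [d [Om [P [V [Z [iidV govZ sZ lawZ]]]]]] :=
  stationary_process_exists cEE mEE nu_inv.
have mZ := governed_markov cEE mEE iidV govZ.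
have [N [mN N0 dN]] := diagonal _ _ _ _ mZ sZ.
apply: (off_diagonal_not_diagonal nuD); rewrite -(lawZ 0%R).
apply: (subset_measure0 _ mN _ N0).
  exact: measurable_funPTI.
by move=> w nD; apply: dN => /(_ 0%R).
Qed.

Section component.
Context d (Omega : measurableType d) (P : probability Omega R)
  (V : int -> {RV P >-> G}) (Z : int -> {RV P >-> (E * E)%type}).
Variable h : {mfun (E * E)%type >-> E}.
Hypothesis hf : forall u v, h (two_point_map f (u, v)) = f (h u, v).

Let mX n : measurable_fun setT (fun w => h (Z n w)).
Proof. exact: measurableT_comp. Qed.

(** A coordinate of a two-point motion, as a process of its own. *)
Definition component n : {RV P >-> E} := mfun_Sub (mem_set (mX n)).

Lemma component_governed : governed (two_point_map f) V Z -> governed f V component.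
Proof.
move=> [Zg Zind]; split => [n w|n A B mA pB].
  by rewrite /component/= Zg hf.
apply: Zind => //.
apply: (past_comp (Z := fun k w => (Z k w, V k w)) (h := fun p => (h p.1, p.2))) pB.
apply: measurable_fun_pair => //; exact: measurableT_comp.
Qed.

Lemma component_stationary : stationary Z -> stationary component.
Proof.
move=> sZ t I A mA; apply: (sZ t I (fun k => h @^-1` A k)) => k.
exact: measurable_funPTI.
Qed.

End component.

Let mfst : {mfun (E * E)%type >-> E} := mfun_Sub (mem_set measurable_fst).
Let msnd : {mfun (E * E)%type >-> E} := mfun_Sub (mem_set measurable_snd).

(** Otherwise there is a stationary two-point motion whose coordinates X and Y have
    the same law at each time and almost surely differ. By assumption X_0 = a is, up to a null
    set, an event B of the past of V. The pairs formed by X_0 and Y_0 with the past of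
    V have the same law, so Y_0 = a is almost surely contained in B; these events having
    the same probability, they coincide for every a. *)
Lemma adapted_accordable : stationary_chains_adapted_to_innovations beta f ->
  forall x y, kernel_accordable beta f x y.
Proof.
move=> adapted x y; apply: contrapT => nacc.
have [nu [nu_inv nu_exch nuD]] := off_diagonal_invariant cE mE recK1 nacc.
have [d [Om [P [V [Z [iidV govZ sZ lawZ]]]]]] :=
  stationary_process_exists cEE mEE nu_inv.
pose X := component Z mfst; pose Y := component Z msnd.
have govX : governed f V X by exact: component_governed.
have govY : governed f V Y by exact: component_governed.
have sX : stationary X by exact: component_stationary.
have mXs a : measurable (X 0%R @^-1` [set a]) by exact: measurable_funPTI.
have mYs a : measurable (Y 0%R @^-1` [set a]) by exact: measurable_funPTI.
have lawXY n A : P (X n @^-1` A) = P (Y n @^-1` A).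
  rewrite -[LHS]/(distribution P (Z n) (fst @^-1` A)) lawZ.
  by rewrite -[RHS]/(distribution P (Z n) (snd @^-1` A)) lawZ -nu_exch.
have XY a : P (X 0%R @^-1` [set a] `\` Y 0%R @^-1` [set a]) = 0.
  have : completed_past P X 0%R (X 0%R @^-1` [set a]).
    by apply: past_completed_past; exact: past_mem.
  move=> /(adapted _ _ _ _ _ iidV govX sX) /completed_past_approx[B [N [pB mN N0 BN]]].
  have mV k : measurable_fun setT (V k) by [].
  have mB : measurable B by exact: (past_measurable mV pB).
  have null C : measurable C -> P (C `&` ~` N) = P C.
    move=> mC; rewrite -setDE [RHS](measureDI P mC mN).
    have CN : P (C `&` N) = 0.
      by apply: (subset_measure0 _ mN _ N0) => //; exact: measurableI.
    by rewrite -[LHS]adde0; congr (_ + _).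
  (* B and X_0 = a differ by a null set *)
  have swapB C : measurable C ->
      P (C `&` B) = P (C `&` X 0%R @^-1` [set a]).
    move=> mC; rewrite -null; last exact: measurableI.
    by rewrite -setIA -BN setIA null//; exact: measurableI.
  have XYa : P (X 0%R @^-1` [set a] `&` Y 0%R @^-1` [set a]) = P (X 0%R @^-1` [set a]).
    rewrite setIC -swapB// -(governed_same_law cE mE govX govY lawXY pB).
    by rewrite swapB// setIid.
  have Xfin := le_lt_trans (probability_le1 P (mXs a)) (ltry _).
  refine (etrans (measureD (mXs a) (mYs a) Xfin) _).
  by refine (etrans (congr1 (fun r => _ - r) XYa) _); rewrite subee// fin_num_measure.
apply: (off_diagonal_not_diagonal nuD); rewrite -(lawZ 0%R).
have [F [tF UF mF FE]] := countable_fibers cE mE (@measurable_id _ E setT).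
pose U n := X 0%R @^-1` F n `\` Y 0%R @^-1` F n.
have mU n : measurable (U n) by apply: measurableD; exact: measurable_funPTI.
have U0 : P (\bigcup_n U n) = 0.
  apply/eqP; rewrite eq_le measure_ge0 andbT.
  apply: (le_trans (@measure_sigma_subadditive _ _ _ P _ U mU _ _)) => //.
    exact: bigcup_measurable.
  rewrite eseries0// => n _ _; rewrite /U.
  by have [->|[s ->]] := FE n; [rewrite !preimage_set0 setD0 measure0|exact: XY].
apply: (subset_measure0 _ _ _ U0).
- exact: measurable_funPTI.
- exact: bigcup_measurable.
move=> w nD; have [n _ Fn] : (\bigcup_n F n) (X 0%R w) by rewrite UF.
exists n => //; split => // Fn'; apply: nD; rewrite /diag /=.
have [F0|[s Fs]] := FE n; first by rewrite F0 in Fn.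
by move: Fn Fn'; rewrite Fs => /= -> ->.
Qed.

End necessity.

(** * The three conditions are equivalent *)

Section accordable_iff.
Context (dE dG : measure_display) (E : measurableType dE) (G : measurableType dG)
  (R : realType).
Hypothesis cE : countable [set: E].
Hypothesis mE : forall A : set E, measurable A.
Variables (beta : probability G R) (f : {mfun (E * G)%type >-> E}).

(** A constant chain is governed by any innovations, and this provides a
    realization of them. *)
Lemma iid_exists (x : E) : exists (d : measure_display) (Omega : measurableType d)
  (P : probability Omega R) (V : int -> {RV P >-> G}), iid beta V.
Proof.
pose g : {mfun (E * G)%type >-> E} := mfun_Sub (mem_set measurable_fst).
have dirac_inv A : \d_x A = \int[\d_x]_z random_map_kernel beta g z A :> \bar R.
  rewrite integral_dirac//.
  rewrite diracT mul1e diracE; have [Ax|Ax] := boolP (x \in A).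
    rewrite -(@probability_setT _ _ _ beta); congr (beta _).
    by apply/seteqP; split => // v _; exact: set_mem.
  transitivity (beta set0); first by rewrite measure0.
  congr (beta _); apply/seteqP; split => // v Av.
  by move/negP : Ax; apply; exact/mem_set.
have [d [Om [P [V [Z [iidV _ _ _]]]]]] := stationary_process_exists cE mE dirac_inv.
by exists d, Om, P, V.
Qed.

Lemma accordableP x y : accordable beta f x y <-> kernel_accordable beta f x y.
Proof.
split; first exact: accordable_kernel.
move=> [l l0 Dl]; have [d [Om [P [V iidV]]]] := iid_exists x.
by exists d, Om, P, V, l; split => //; rewrite (iid_coupling cE mE f x y l iidV).
Qed.

End accordable_iff.

Theorem theorem9 (R : realType) (dE dG : measure_display)
    (E : measurableType dE) (G : measurableType dG)
    (E_countable : countable [set: E])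
    (E_discrete : forall A : set E, measurable A)
    (f : {mfun (E * G)%type >-> E}) (beta : probability G R)
    (Pi_irreducible : irreducible (Pi_kernel beta f))
    (Pi_positive_recurrent : positive_recurrent (Pi_kernel beta f)) :
  (pairwise_accordable beta f <->
     stationary_chains_adapted_to_innovations beta f) /\
  (stationary_chains_adapted_to_innovations beta f <->
     stationary_Pi2_chains_diagonal beta f).
Proof.
have accP := accordableP E_countable E_discrete beta f.
have to_adapted : (forall x y, kernel_accordable beta f x y) ->
    stationary_chains_adapted_to_innovations beta f.
  by move=> acc; exact: accordable_stationary_adapted.
split; split.
- by move=> acc; apply: to_adapted => x y; apply/accP.
- by move=> adapted x y; apply/accP; exact: adapted_accordable.
- move=> adapted; apply: (accordable_stationary_Pi2_diagonal E_countable E_discrete).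
  exact: adapted_accordable.
- by move=> diagonal; apply: to_adapted; exact: Pi2_diagonal_accordable.
Qed.
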